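(* Let $\alpha>0$, $0<p<\infty$, and $0<r<\infty$. Let $\mu$ be a positive Borel measure on $\mathbb H$ such that $\mu^1:=\mu|_{\mathbb H\setminus\mathbb R}$ is a Radon measure on $\mathbb H\setminus\mathbb R$. Then the following are equivalent: (a) $\mu$ is a quaternionic Fock--Carleson measure for $F_\alpha^p$, i.e. there is a constant $C>0$ such that $\int_{\mathbb H}|f(w)e^{-\frac{\alpha}{2}|w|^2}|^p\,d\mu(w)\le C\|f\|_{p,\alpha}^p$ for every $f\in F_\alpha^p$; (b) there exists a constant $C>0$ such that $$\int_{\mathbb H}\left|k_z(w)e^{-\frac{\alpha}{2}|w|^2}\right|^p\,d\mu(w)\le C\qquad\text{for all }z\in\mathbb H;$$ (c) there exists a constant $C>0$ such that $\mu(S(z,r))\le C$ for all $z\in\mathbb H$.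
   Context: $\mathbb H$ denotes the quaternions, $\mathbb S=\{I\in\mathbb H: I^2=-1\}$, $\mathbb C_I=\{x+yI:x,y\in\mathbb R\}$ for $I\in\mathbb S$, and $m_{2,I}$ is Lebesgue measure on $\mathbb C_I$. A (left) slice function is $f:\mathbb H\to\mathbb H$ of the form $f(x+yI)=f_0(x,y)+If_1(x,y)$ for all $x,y\in\mathbb R$, $I\in\mathbb S$, where $f_0,f_1:\mathbb R^2\to\mathbb H$ satisfy $f_0(x,-y)=f_0(x,y)$ and $f_1(x,-y)=-f_1(x,y)$. It is slice regular if moreover $f_0,f_1$ are $C^1$ and $\partial_xf_0-\partial_yf_1=0$, $\partial_yf_0+\partial_xf_1=0$. Every non-real quaternion is uniquely $x+yI$ with $I\in\mathbb S$, $y>0$, so $\mathbb H\setminus\mathbb R\cong\mathbb S\times\mathbb C^+$ (with $\mathbb C^+$ the open upper half plane), and $dV(x+yI)=dm_{2,I}(x+yI)\,d\sigma(I)$, where $\sigma$ is the normalized surface measure on $\mathbb S$; the real axis has $dV$-measure $0$. Put $\|f\|_{p,\alpha}^p=\frac{p\alpha}{\pi}\int_{\mathbb H}|f(z)e^{-\alpha|z|^2/2}|^p\,dV(z)$. The global quaternionic Fock space $F_\alpha^p$ is the space of slice regular $f$ on $\mathbb H$ with $\|f\|_{p,\alpha}<\infty$. $K_\alpha(z,w)=\sum_{n\ge0}\frac{\alpha^n}{n!}z^n\overline w^{\,n}$ is the reproducing kernel, and $k_z(w)=K_\alpha(w,z)e^{-\alpha|z|^2/2}$ is the normalized reproducing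 kernel. Symmetric boxes: for $z=x+yJ\in\mathbb H$ with $y\ge0$, $J\in\mathbb S$, and $r>0$, put $z_I=x+yI$ and $S(z,r)=\bigcup_{I\in\mathbb S}B_I(z_I,r)$, where $B_I(z_I,r)$ is the Euclidean disk in $\mathbb C_I$ with center $z_I$ and radius $r$. *)

(* Defs.v *)
From HB Require Import structures.
From mathcomp Require Import all_boot all_order all_algebra.
From mathcomp Require Import all_classical all_reals all_analysis.
From mathcomp Require Import measurable_realfun ring lra.

Set Implicit Arguments.
Unset Strict Implicit.
Unset Printing Implicit Defensive.

Import Order.TTheory GRing.Theory Num.Theory.
Import numFieldNormedType.Exports.

Local Open Scope classical_set_scope.
Local Open Scope ring_scope.

(* (a, b, c, d) stands for a + bi + cj + dk.  The additive, topological and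
   measurable structures are those of the product.  Pitfalls: the canonical
   ring product of a product type is componentwise, so the quaternion product
   is qmul below and never *; the canonical norm `|_| is the max norm, so the
   Euclidean norm is qnorm below. *)
Notation quat R := (R * R * R * R)%type.

Section quaternions.
Context {R : realType}.
Implicit Types (z w I : quat R) (t : R * R).

Definition qone : quat R := (1, 0, 0, 0).

Definition qmul z w : quat R :=
  let: (a, b, c, d) := z in let: (a', b', c', d') := w in
  (a * a' - b * b' - c * c' - d * d',
   a * b' + b * a' + c * d' - d * c',
   a * c' - b * d' + c * a' + d * b',
   a * d' + b * c' - c * b' + d * a').

Definition qconj z : quat R := let: (a, b, c, d) := z in (a, - b, - c, - d).

Definition qpow z (n : nat) : quat R := iter n (qmul z) qone.

Definition qnorm z : R :=
  let: (a, b, c, d) := z in Num.sqrt (a ^+ 2 + b ^+ 2 + c ^+ 2 + d ^+ 2).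

Definition qRe z : R := z.1.1.1.

Definition qIm_norm z : R := qnorm (z - qRe z *: qone).

Definition real_axis : set (quat R) := range (fun x : R => x *: qone).

Definition imag_units : set (quat R) := [set I | qmul I I = - qone].

(* x + yI, for t = (x, y) *)
Definition slice_pt I t : quat R := t.1 *: qone + t.2 *: I.

Definition slice_plane I : set (quat R) := range (slice_pt I).

Lemma imag_unitsP (b c d a : R) : imag_units (a, b, c, d) <->
  a = 0 /\ b ^+ 2 + c ^+ 2 + d ^+ 2 = 1.
Proof.
rewrite /imag_units /= /qone; split.
  case=> h1 h2 h3 h4.
  have a0 : a = 0.
    apply/eqP; apply: contraT => a0.
    have hz x : a * x + x * a = 0 -> x = 0.
      rewrite (mulrC x) -mulr2n => /eqP; rewrite mulrn_eq0 /= mulf_eq0.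
      by rewrite (negbTE a0) => /eqP.
    have b0 : b = 0 by apply: hz; nra.
    have c0 : c = 0 by apply: hz; nra.
    have d0 : d = 0 by apply: hz; nra.
    have := sqr_ge0 a; move: h1; rewrite b0 c0 d0 -expr2 !mul0r !subr0 => ->.
    by rewrite ler0N1.
  by split=> //; rewrite a0 in h1; lra.
case=> -> h; transitivity ((-1, - 0, - 0, - 0) : quat R); last by [].
congr (_, _, _, _); lra.
Qed.

(* z = x + yJ with y >= 0 determines x and y, also when z is real and J is
   not determined *)
Lemma slice_ptE J t : imag_units J -> 0 <= t.2 ->
  qRe (slice_pt J t) = t.1 /\ qIm_norm (slice_pt J t) = t.2.
Proof.
case: J => [[[a b] c] d] /imag_unitsP[a0 h]; case: t => x y /= y0.
rewrite /qIm_norm /qRe /slice_pt /= a0 /qnorm /=.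
rewrite !scaler0 !add0r !addr0 /= !subr0.
have e (u v : R) : u *: v = u * v by [].
rewrite !e !mulr1; split=> //.
rewrite [X in Num.sqrt X](_ : _ = y ^+ 2); first by rewrite sqrtr_sqr ger0_norm.
transitivity (y ^+ 2 * (b ^+ 2 + c ^+ 2 + d ^+ 2)); last by rewrite h mulr1.
by ring.
Qed.

End quaternions.

(* The product sigma-algebra of quat R is its Borel sigma-algebra. *)
Section borel.

Let prod_basis (T1 T2 : topologicalType) (B1 : set (set T1))
    (B2 : set (set T2)) : countable B1 -> basis B1 -> countable B2 ->
  basis B2 -> let B := [set A `*` A' | A in B1 & A' in B2] in
  countable B /\ basis B.
Proof.
move=> cB1 [oB1 bB1] cB2 [oB2 bB2] B; split.
  have -> : B = (fun p : set T1 * set T2 => p.1 `*` p.2) @` (B1 `*` B2).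
    apply/seteqP; split=> [_ [A hA] [A' hA'] <-|_ [[A A'] [hA hA'] <-]].
      by exists (A, A').
    by exists A => //; exists A'.
  by apply: sub_countable (card_image_le _ _) _; exact: countableX.
split=> [_ [A hA] [A' hA'] <-|[x y] U].
  rewrite openE => -[u v] [/= Au Av]; exists (A, A') => //=.
  by split; apply: open_nbhs_nbhs; split=> //; [exact: oB1|exact: oB2].
case=> -[U1 U2] /= [/bB1[A1 [hA1 A1x] sA1] /bB2[A2 [hA2 A2y] sA2]] sU.
exists (A1 `*` A2); first by split=> //; exists A1 => //; exists A2.
by move=> [u v] [/sA1 ? /sA2 ?]; exact: sU.
Qed.

Let itv_basis (R : realType) (B := [set A : set R |
    exists p : rat * rat, A = `]ratr p.1, ratr p.2[%classic]) :
  countable B /\ basis B.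
Proof.
split.
  have -> : B = (fun p : rat * rat => `](ratr p.1 : R), ratr p.2[%classic) @` setT.
    by apply/seteqP; split=> [A [p ->]|A [p _ <-]]; exists p.
  by apply: sub_countable (card_image_le _ _) _; exact: countableP.
split=> [_ [p ->]|x U]; first exact: interval_open.
move=> /nbhs_ballP[e /= e0 sU].
have [p /andP[xp px]] : exists q, (x - e < ratr q < x).
  have /rat_in_itvoo[q] : x - e < x by rewrite ltrBlDr ltrDl.
  by rewrite in_itv /= => ?; exists q.
have [q /andP[xq qx]] : exists q, (x < ratr q < x + e).
  have /rat_in_itvoo[q] : x < x + e by rewrite ltrDl.
  by rewrite in_itv /= => ?; exists q.
exists `]ratr p, ratr q[%classic.
  by split; [exists (p, q)|rewrite /= in_itv /= px xq].
move=> y; rewrite /= in_itv /= => /andP[py yq]; apply: sU.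
by rewrite /ball /= ltr_distlC; apply/andP; split; lra.
Qed.

Lemma open_quat_measurable (R : realType) (U : set (quat R)) :
  open U -> measurable U.
Proof.
move=> oU; have [cR bR] := itv_basis R.
have [c2 b2] := prod_basis cR bR cR bR.
have [c3 b3] := prod_basis c2 b2 cR bR.
have [c4 b4] := prod_basis c3 b3 cR bR.
set B := (X in countable X) in c4 b4.
have mB A : B A -> measurable A.
  move=> [_ [_ [_ [p1 ->] [_ [p2 ->] <-]] [_ [p3 ->] <-]] [_ [p4 ->] <-]].
  by do 3 (apply: measurableX; last exact: measurable_itv); exact: measurable_itv.
have -> : U = \bigcup_(A in [set A | B A /\ A `<=` U]) A.
  apply/seteqP; split=> [x Ux|x [A [_]]]; last exact.
  have [A [BA Ax] AU] := b4.2 x U (open_nbhs_nbhs (conj oU Ux)).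
  by exists A.
have cB : countable [set A | B A /\ A `<=` U].
  by apply: sub_countable c4; apply: subset_card_le => A [].
case/pfcard_geP : cB => [->|[f]]; first by rewrite bigcup_set0.
rewrite (_ : \bigcup_(_ in _) _ = \bigcup_n f n).
  apply: bigcupT_measurable => n; apply: mB.
  have : [set A | B A /\ A `<=` U] (f n) by exact: funS.
  by case.
apply/seteqP; split=> [x [A hA Ax]|x [n _ fx]].
  by have [n _ e] : (f @` setT) A by [exact: surj]; exists n => //; rewrite e.
by exists (f n) => //; exact: funS.
Qed.

Lemma quat_borelE (R : realType) :
  @measurable _ (quat R) = <<s @open (quat R) >>.
Proof.
apply/seteqP; split; last first.
  apply: smallest_sub; first exact: sigma_algebra_measurable.
  exact: open_quat_measurable.
pose Q := g_sigma_algebraType (@open (quat R)).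
have mc (f : quat R -> R) : continuous f -> measurable_fun [set: Q] (f : Q -> R).
  move=> /continuousP cf.
  apply: (measurability _ (@RGenOpens.measurableE R)).
  move=> _ [_ [a [b ->] <-]]; rewrite setTI; apply: sub_sigma_algebra.
  by apply: cf; exact: interval_open.
have mid : measurable_fun [set: Q] (idfun : Q -> quat R).
  apply/measurable_fun_pairP; split; last by apply: mc => x; exact: cvg_snd.
  apply/measurable_fun_pairP; split; last first.
    by apply: mc => x; apply: continuous_comp; [exact: cvg_fst|exact: cvg_snd].
  apply/measurable_fun_pairP; split.
    apply: mc => x; apply: continuous_comp; last exact: cvg_fst.
    by apply: continuous_comp; exact: cvg_fst.
  apply: mc => x; apply: continuous_comp; last exact: cvg_snd.
  by apply: continuous_comp; exact: cvg_fst.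
by move=> A mA; have := mid measurableT A mA; rewrite setTI.
Qed.

End borel.

Section volume.
Context {R : realType}.
Local Notation mR := (measurableTypeR R).
Local Open Scope ereal_scope.

Definition area : set (mR * mR) -> \bar R :=
  @lebesgue_measure R \x @lebesgue_measure R.

HB.instance Definition _ := Measure.on area.

Let area_sigma_finite : sigma_finite setT area.
Proof.
have /sigma_finiteP[F [TF ndF Foo]] := sigma_finiteT (@lebesgue_measure R).
exists (fun n => F n `*` F n) => [|n].
  rewrite -setXTT TF; apply/seteqP; split=> [[x y] []|[x y] [n _ []]]; last first.
    by split; exists n.
  move=> /= [n _ Fnx] [k _ Fky]; exists (maxn n k) => //; split.
    by move: x Fnx; exact/subsetPset/ndF/leq_maxl.
  by move: y Fky; exact/subsetPset/ndF/leq_maxr.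
have [? ?] := Foo n; split; first exact: measurableX.
by rewrite [area _]product_measure1E// lte_mul_pinfty// ge0_fin_numE.
Qed.

HB.instance Definition _ :=
  Measure_isSigmaFinite.Build _ _ _ area area_sigma_finite.

(* t.1 is the polar angle, in [0, pi], and t.2 the azimuth, in [0, 2 pi] *)
Definition sph_param (t : mR * mR) : quat R :=
  (0%R, sin t.1 * cos t.2, sin t.1 * sin t.2, cos t.1)%R.

Definition sph_dom : set (mR * mR) := `[0%R, pi] `*` `[0%R, (2 * pi)%R].

(* Normalized surface measure of imag_units: sin t.1 is the Jacobian of
   sph_param, and 4 pi the area of the sphere. *)
Definition sphere_measure (A : set (quat R)) : \bar R :=
  ((4 * pi)^-1)%:E *
  \int[area]_(t in sph_dom `&` sph_param @^-1` A) (sin t.1)%:E.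

Lemma imag_units_sph_param t : imag_units (sph_param t).
Proof.
apply/imag_unitsP; split=> //.
have := cos2Dsin2 t.1; have := cos2Dsin2 t.2 => h1 h2.
rewrite !exprMn -mulrDr h1 mulr1 addrC //.
Qed.

Let m1 : measurable_fun [set: mR * mR] (fst : mR * mR -> R).
Proof. exact: measurable_fst. Qed.
Let m2 : measurable_fun [set: mR * mR] (snd : mR * mR -> R).
Proof. exact: measurable_snd. Qed.

Let msin (f : mR * mR -> R) : measurable_fun setT f ->
  measurable_fun setT (fun t => sin (f t)).
Proof.
move=> mf; apply: measurableT_comp mf.
by apply: continuous_measurable_fun; exact: continuous_sin.
Qed.

Let mcos (f : mR * mR -> R) : measurable_fun setT f ->
  measurable_fun setT (fun t => cos (f t)).
Proof.
move=> mf; apply: measurableT_comp mf.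
by apply: continuous_measurable_fun; exact: continuous_cos.
Qed.

Lemma measurable_sph_param : measurable_fun setT sph_param.
Proof.
apply: measurable_fun_pair; last exact: mcos.
apply: measurable_fun_pair; last first.
  by apply: measurable_funM; exact: msin.
apply: measurable_fun_pair; first exact: measurable_cst.
by apply: measurable_funM; [exact: msin|exact: mcos].
Qed.

Lemma measurable_sph_dom : measurable sph_dom.
Proof. by apply: measurableX; exact: measurable_itv. Qed.

Let sin_dom_ge0 A t : (sph_dom `&` sph_param @^-1` A) t ->
  0 <= (sin t.1)%:E :> \bar R.
Proof.
by move=> [[]] /=; rewrite lee_fin => t1 _ _; rewrite sin_ge0_pi.
Qed.

Let pi4_ge0 : 0 <= ((4 * pi)^-1 : R)%:E :> \bar R.
Proof. by rewrite lee_fin invr_ge0 mulr_ge0 ?pi_ge0. Qed.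

Let sphere_measure0 : sphere_measure set0 = 0.
Proof. by rewrite /sphere_measure preimage_set0 setI0 integral_set0 mule0. Qed.

Let sphere_measure_ge0 A : 0 <= sphere_measure A.
Proof.
by rewrite mule_ge0 ?pi4_ge0//; apply: integral_ge0 => t; exact: sin_dom_ge0.
Qed.

Let sphere_measure_sigma_additive : semi_sigma_additive sphere_measure.
Proof.
move=> F mF tF mUF.
have mpF A : measurable A -> measurable (sph_dom `&` sph_param @^-1` A).
  move=> mA; apply: (measurable_funTS measurable_sph_param) => //.
  exact: measurable_sph_dom.
rewrite [X in _ --> X](_ : _ = \sum_(n <oo) sphere_measure (F n)).
  by apply/cvg_closeP; split; [exact: is_cvg_nneseries|rewrite closeE].
rewrite nneseriesZl; last first.
  by move=> n _; apply: integral_ge0 => t; exact: sin_dom_ge0.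
congr (_ * _); rewrite preimage_bigcup setI_bigcupr ge0_integral_bigcup//.
- by move=> n; exact: mpF.
- by apply/measurable_funTS/measurable_EFinP; exact: msin.
- by move=> t [n _]; exact: sin_dom_ge0.
- apply/trivIsetP => i j _ _ ij; rewrite setIACA setIid -preimage_setI.
  by move/trivIsetP : tF => /(_ i j I I ij) ->; rewrite preimage_set0 setI0.
Qed.

HB.instance Definition _ := isMeasure.Build _ _ _ sphere_measure
  sphere_measure0 sphere_measure_ge0 sphere_measure_sigma_additive.

(* the set of the (I, (x, y)) with y > 0 and x + yI in A *)
Definition half_slices (A : set (quat R)) : set (quat R * (mR * mR)) :=
  [set p | (0 < p.2.2)%R /\ A (slice_pt p.1 p.2)].

(* dm_{2,I} d sigma(I) on (H minus R) = S x C^+ *)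
Definition qvolume (A : set (quat R)) : \bar R :=
  (sphere_measure \x area) (half_slices A).

Lemma measurable_slice_pt :
  measurable_fun setT (fun p : quat R * (mR * mR) => slice_pt p.1 p.2).
Proof.
pose c (e : R) (k : quat R -> R) (p : quat R * (mR * mR)) :=
  (p.2.1 * e + p.2.2 * k p.1)%R.
have mc e k : measurable_fun setT k -> measurable_fun setT (c e k).
  move=> mk; apply: measurable_funD; apply: measurable_funM.
  - exact: (measurableT_comp measurable_fst measurable_snd).
  - exact: measurable_cst.
  - exact: (measurableT_comp measurable_snd measurable_snd).
  - exact: (measurableT_comp mk measurable_fst).
rewrite (_ : (fun p => _) = (fun p => (c 1%R (fun z => z.1.1.1) p,
  c 0%R (fun z => z.1.1.2) p, c 0%R (fun z => z.1.2) p,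
  c 0%R (fun z => z.2) p))); last first.
  by apply/funext => -[[[[? ?] ?] ?] ?].
have m1' d1 d2 d3 (T1 : measurableType d1) (T2 : measurableType d2)
    (T3 : measurableType d3) (f : T1 -> T2 * T3) :
    measurable_fun setT f -> measurable_fun setT (fun x => (f x).1).
  exact: measurableT_comp measurable_fst.
apply: measurable_fun_pair; last by apply: mc; exact: measurable_snd.
apply: measurable_fun_pair; last first.
  by apply: mc; exact: (measurableT_comp measurable_snd measurable_fst).
apply: measurable_fun_pair; apply: mc; last first.
  exact: (measurableT_comp measurable_snd (m1' _ _ _ _ _ _ _ measurable_fst)).
exact: m1' (m1' _ _ _ _ _ _ _ measurable_fst).
Qed.

Lemma measurable_half_slices A : measurable A -> measurable (half_slices A).
Proof.
move=> mA; have mg := measurable_slice_pt measurableT mA.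
rewrite setTI in mg; rewrite (_ : half_slices A =
  (setT `&` (fun p : quat R * (mR * mR) => p.2.2) @^-1` `]0%R, +oo[) `&`
  (fun p => slice_pt p.1 p.2) @^-1` A); last first.
  apply/seteqP; split=> p; rewrite /half_slices /= in_itv /= andbT.
    by move=> [].
  by move=> [[]].
apply: measurableI mg.
apply: (measurableT_comp measurable_snd measurable_snd) => //.
Qed.

Let qvolume0 : qvolume set0 = 0.
Proof.
rewrite /qvolume (_ : half_slices set0 = set0) ?measure0//.
by apply/seteqP; split=> // p [].
Qed.

Let qvolume_ge0 A : 0 <= qvolume A.
Proof. exact: measure_ge0. Qed.

Let qvolume_sigma_additive : semi_sigma_additive qvolume.
Proof.
move=> F mF tF mUF; rewrite /qvolume.
rewrite (_ : half_slices (\bigcup_n F n) = \bigcup_n half_slices (F n)).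
  apply: measure_sigma_additive.
    by move=> n; exact: measurable_half_slices.
  apply/trivIsetP => i j _ _ ij.
  move/trivIsetP : tF => /(_ i j I I ij) Fij.
  apply/seteqP; split=> // p [[_ pi] [_ pj]].
  by suff : (F i `&` F j) (slice_pt p.1 p.2) by rewrite Fij.
apply/seteqP; split=> [p [p0 [n _ Fn]]|p [n _ [p0 Fn]]]; first by exists n.
by split=> //; exists n.
Qed.

HB.instance Definition _ := isMeasure.Build _ _ _ qvolume
  qvolume0 qvolume_ge0 qvolume_sigma_additive.

End volume.

Section fock_space.
Context {R : realType}.
Local Notation mR := (measurableTypeR R).

(* C^1 in the sense that both partial derivatives exist and are continuous *)
Definition C1 (g : R * R -> quat R) :=
  forall v : R * R, v = (1, 0) \/ v = (0, 1) ->
    (forall t, derivable g t v) /\ continuous (fun t => 'D_v g t).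

Definition slice_components (f : quat R -> quat R) (f0 f1 : R * R -> quat R) :=
  [/\ forall x y, f0 (x, - y) = f0 (x, y),
      forall x y, f1 (x, - y) = - f1 (x, y) &
      forall I t, imag_units I -> f (slice_pt I t) = f0 t + qmul I (f1 t)].

Definition slice_function (f : quat R -> quat R) :=
  exists f0 f1, slice_components f f0 f1.

Definition slice_regular (f : quat R -> quat R) :=
  exists f0 f1, [/\ slice_components f f0 f1, C1 f0, C1 f1 &
    forall t, 'D_((1, 0) : R * R) f0 t - 'D_((0, 1) : R * R) f1 t = 0 /\
              'D_((0, 1) : R * R) f0 t + 'D_((1, 0) : R * R) f1 t = 0].

(* |f(z) e^{- alpha |z|^2 / 2}|^p *)
Definition gauss_pow (alpha p : R) (f : quat R -> quat R) (z : quat R) : R :=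
  qnorm (expR (- (alpha / 2) * qnorm z ^+ 2) *: f z) `^ p.

(* || f ||_{p, alpha}^p *)
Definition fock_norm_pow (alpha p : R) (f : quat R -> quat R) : \bar R :=
  ((p * alpha / pi)%:E * \int[qvolume]_z (gauss_pow alpha p f z)%:E)%E.

Definition fock_space (alpha p : R) : set (quat R -> quat R) :=
  [set f | slice_regular f /\ (fock_norm_pow alpha p f < +oo)%E].

Definition fock_kernel (alpha : R) (z w : quat R) : quat R :=
  limn (series (fun n =>
    (alpha ^+ n / n`!%:R) *: qmul (qpow z n) (qpow (qconj w) n))).

Definition normalized_kernel (alpha : R) (z w : quat R) : quat R :=
  expR (- (alpha / 2) * qnorm z ^+ 2) *: fock_kernel alpha w z.

Definition fock_carleson (alpha p : R)
    (mu : set (quat R) -> \bar R) :=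
  exists2 C : R, 0 < C & forall f, fock_space alpha p f ->
    (\int[mu]_w (gauss_pow alpha p f w)%:E <= C%:E * fock_norm_pow alpha p f)%E.

(* Euclidean disk of C_I *)
Definition slice_disk (I c : quat R) (r : R) : set (quat R) :=
  [set w | slice_plane I w /\ qnorm (w - c) < r].

(* S(z, r), where x = qRe z and y = qIm_norm z, see slice_ptE *)
Definition symmetric_box (z : quat R) (r : R) : set (quat R) :=
  \bigcup_(I in imag_units)
    slice_disk I (slice_pt I (qRe z, qIm_norm z)) r.

(* The restriction of mu to the open set U is a Radon measure on U: finite on
   compact sets, outer regular on Borel sets, inner regular on open sets.  As
   U is open, its open subsets are those of quat R contained in U. *)
Definition radon_on (U : set (quat R)) (mu : set (quat R) -> \bar R) :=
  [/\ forall K, compact K -> K `<=` U -> (mu K < +oo)%E,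
      forall A, measurable A -> A `<=` U ->
        mu A = ereal_inf [set mu V | V in
          [set V | [/\ open V, A `<=` V & V `<=` U]]] &
      forall V, open V -> V `<=` U ->
        mu V = ereal_sup [set mu K | K in [set K | compact K /\ K `<=` V]]].

End fock_space.

(* Main.v *)
Require Import Defs.
From HB Require Import structures.
From mathcomp Require Import all_boot all_order all_algebra.
From mathcomp Require Import all_classical all_reals all_analysis.
From mathcomp Require Import measurable_realfun ring lra.

Set Implicit Arguments.
Unset Strict Implicit.
Unset Printing Implicit Defensive.

Import Order.TTheory GRing.Theory Num.Theory.
Import numFieldNormedType.Exports.

Local Open Scope classical_set_scope.
Local Open Scope ring_scope.

(* On a slice C_I, the components of f along a pair of conjugate directions form
   a holomorphic function.  Multiplying it by a suitable e^(affine function)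
   turns the mean value property into
     |f e^(-alpha |.|^2 / 2)|(c) <= C l^(-2) times its integral over a square
   of half side l <= 1, hence, by the Hardy--Littlewood, Fefferman--Stein
   argument, the same for p-th powers, p > 0.  The values on a slice are
   controlled by those on any two slices J, J' in opposite caps of the sphere,
   so integrating against mu, exchanging integrals, and averaging over the caps
   bounds the mu-integral of |f e^(-alpha |.|^2 / 2)|^p by the supremum of the
   mu(S(z, r)) times the norm of f.
   Conversely, for w = u + vI and z = x + yJ, with k = <I, J>,
     |k_z(w) e^(-alpha |w|^2 / 2)|^2 =
       (1 + k)/2 e^(-alpha ((u - x)^2 + (v - y)^2)) +
       (1 - k)/2 e^(-alpha ((u - x)^2 + (v + y)^2)),
   so that the k_z have bounded norms, and k_z and k_{\bar z} together are
   bounded below on S(z, r). *)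

(** * Functions of class C^1 on the plane *)

Section C1_functions.
Context {R : realType}.
Implicit Types (h hx hy : R * R -> R).

(** The norm integrates over almost every half slice, so a value of f has to be bounded by many half
    slices at once. Two units J, J' suffice for one bound, with a constant governed by 1/|J - J'|.
    Opposite caps keep this difference bounded below and have positive measure, so the bound can be
    averaged. As the volume counts each non-real point once, on the half slice y > 0, a square that
    crosses the real axis is folded back through [|w.2|]. Exchanging the integrals requires a
    sigma-finite mu; this is itself drawn from the box condition, since countably many boxes with
    rational centers cover H. The Gaussian is absorbed into a holomorphic factor at exponent 1,
    before any power is taken: the passage to p-th powers asks only for the mean value inequality on
    all small squares, and so treats p < 1 and p > 1 alike. Squares take the place of disks because
    the area is a product measure: Fubini and the fundamental theorem of calculus on lines then do
    the work of Green's formula. All calculus is done on real functions, obtained from f by pairing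
    with fixed quaternions. *)

Lemma is_derive_cvg (F : R -> R) (t d : R) :
  h^-1 *: (F (h *: (1 : R) + t) - F t) @[h --> 0^'] --> d ->
  is_derive t (1 : R) F d.
Proof.
move=> cF; split; first by apply/cvg_ex; exists d.
by rewrite /derive; apply/cvg_lim.
Qed.

(** A form free of division, for derivatives that come from inequalities rather than from
    differentiation rules. *)
Lemma is_derive_eps (F : R -> R) (t d : R) :
  (forall e : R, 0 < e ->
    \forall k \near (0 : R), `|F (t + k) - F t - d * k| <= e * `|k|) ->
  is_derive t (1 : R) F d.
Proof.
move=> H; apply: is_derive_cvg; apply/cvgrPdist_le => e e0.
have He := H _ e0.
near=> k.
have k0 : k != 0 by near: k; exact: nbhs_dnbhs_neq.
have : `|F (t + k) - F t - d * k| <= e * `|k| by near: k; exact: (nbhs_dnbhs He).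
rewrite -ler_pdivrMr ?normr_gt0// -normf_div distrC; congr (`|_| <= _).
have -> : k *: (1 : R) = k by rewrite -[LHS]/(k * 1) mulr1.
have -> : k^-1 *: (F (k + t) - F t) = k^-1 * (F (t + k) - F t).
  by rewrite [k + t]addrC.
by field.
Unshelve. all: by end_near. Qed.

Lemma is_derive_affine_bound (F dF : R -> R) (a c e : R) (b : R) :
  (forall s : R, is_derive s (1 : R) F (dF s)) ->
  (forall s : R, `|s - a| <= `|b - a| -> `|dF s - c| <= e) ->
  `|F b - F a - c * (b - a)| <= e * `|b - a|.
Proof.
move=> dFs dFc.
have cF : continuous F.
  by move=> s; apply/differentiable_continuous/derivable1_diffP; case: (dFs s).
have [ab|ba] := leP a b; last first.
  have [s] := @MVT_segment R F dF b a (ltW ba) (fun x _ => dFs x)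
    (continuous_subspaceT cF).
  rewrite in_itv /= => /andP[bs sa] E.
  have -> : F b - F a - c * (b - a) = (dF s - c) * (b - a).
    by rewrite mulrBl; congr (_ - _); rewrite -opprB E -mulrN opprB.
  rewrite normrM ler_wpM2r//; apply: dFc.
  by rewrite distrC (distrC b) !ger0_norm ?subr_ge0 ?(ltW ba)// lerB.
have [s] := @MVT_segment R F dF a b ab (fun x _ => dFs x)
  (continuous_subspaceT cF).
rewrite in_itv /= => /andP[sa sb] ->.
rewrite -mulrBl normrM ler_wpM2r//; apply: dFc.
by rewrite !ger0_norm ?subr_ge0// lerB.
Qed.

(** The partials are carried as explicit functions, so that identities between derivatives, such as
    Cauchy--Riemann, become identities that [ring] can check. *)
Definition C1_partials h hx hy :=
  [/\ forall x y : R, is_derive x (1 : R) (fun s => h (s, y)) (hx (x, y)),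
      forall x y : R, is_derive y (1 : R) (fun s => h (x, s)) (hy (x, y)),
      continuous hx & continuous hy].

Lemma cvg_eps_box h (a b e : R) : {for (a, b), continuous h} -> 0 < e ->
  exists2 d : R, 0 < d & forall x y, `|x - a| <= d -> `|y - b| <= d ->
    `|h (x, y) - h (a, b)| <= e.
Proof.
move=> /cvgrPdist_le/(_ e) + e0 => /(_ e0).
move/nbhs_ballP => [d /= d0 H]; exists (d / 2); first by rewrite divr_gt0.
move=> x y xa yb; rewrite distrC; apply: (H (x, y)).
have dd : d / 2 < d by rewrite gtr_pMr// invf_lt1// ltr1n.
by split => /=; rewrite /ball /= distrC (le_lt_trans _ dd).
Qed.

Lemma eps_box_cvg h (a b : R) :
  (forall e : R, 0 < e -> exists2 d : R, 0 < d &
    forall x y, `|x - a| <= d -> `|y - b| <= d ->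
    `|h (x, y) - h (a, b)| <= e) ->
  {for (a, b), continuous h}.
Proof.
move=> H; apply/cvgrPdist_le => e e0; have [d d0 D] := H e e0.
exists (ball a d, ball b d); first by split; exact: nbhsx_ballx.
case=> x y [/=]; rewrite /ball /= => /ltW xa /ltW yb.
by rewrite distrC D// distrC.
Qed.

(** Continuous partials give differentiability: move from (a, b) to (a, b + q), then to (a + p, b +
    q), and linearize on each leg by the mean value theorem. *)
Lemma C1_partials_diff h hx hy a b : C1_partials h hx hy ->
  forall e : R, 0 < e -> exists2 d : R, 0 < d & forall p q, `|p| <= d -> `|q| <= d ->
    `|h (a + p, b + q) - h (a, b) - hx (a, b) * p - hy (a, b) * q|
      <= e * (`|p| + `|q|).
Proof.
case=> dx dy cx cy e e0.
have [d1 d10 H1] := cvg_eps_box (cx (a, b)) e0.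
have [d2 d20 H2] := cvg_eps_box (cy (a, b)) e0.
exists (Num.min d1 d2); first by rewrite lt_min d10.
move=> p q; rewrite !le_min => /andP[p1 p2] /andP[q1 q2].
have E1 : `|h (a + p, b + q) - h (a, b + q) - hx (a, b) * (a + p - a)|
    <= e * `|a + p - a|.
  apply: (is_derive_affine_bound (dF := fun s => hx (s, b + q))
    (F := fun s => h (s, b + q))) => // s; rewrite addrAC subrr add0r => sp.
  by apply: H1; rewrite ?(le_trans sp)// addrAC subrr add0r.
have E2 : `|h (a, b + q) - h (a, b) - hy (a, b) * (b + q - b)|
    <= e * `|b + q - b|.
  apply: (is_derive_affine_bound (dF := fun s => hy (a, s))
    (F := fun s => h (a, s))) => // s; rewrite addrAC subrr add0r => sp.
  by apply: H2; rewrite ?(le_trans sp)// subrr normr0 ltW.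
move: E1 E2; rewrite [a + p]addrC addrK [b + q]addrC addrK => E1 E2.
have -> : h (p + a, q + b) - h (a, b) - hx (a, b) * p - hy (a, b) * q =
  (h (p + a, q + b) - h (a, q + b) - hx (a, b) * p) +
  (h (a, q + b) - h (a, b) - hy (a, b) * q) by ring.
by rewrite mulrDr; apply: le_trans (ler_normD _ _) _; exact: lerD E1 E2.
Qed.

Lemma C1_partials_continuous h hx hy : C1_partials h hx hy -> continuous h.
Proof.
move=> H [a b]; apply: eps_box_cvg => e e0.
have [d d0 D] := C1_partials_diff a b H ltr01.
(* With tolerance 1 in the linearization, the increment is at most (|hx| + 1)|p| + (|hy| + 1)|q|,
   which is M (e / M) when |p|, |q| <= e / M. *)
pose M := `|hx (a, b)| + `|hy (a, b)| + 2.
have M0 : 0 < M by rewrite /M ltr_wpDl// addr_ge0.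
exists (Num.min d (e / M)).
  by rewrite lt_min d0 divr_gt0.
move=> x y; rewrite !le_min => /andP[xd xe] /andP[yd ye].
have := D _ _ xd yd; rewrite !subrKC.
set p := x - a in xd xe *; set q := y - b in yd ye *.
move=> E.
have -> : h (x, y) - h (a, b) = (h (x, y) - h (a, b) - hx (a, b) * p -
  hy (a, b) * q) + hx (a, b) * p + hy (a, b) * q by ring.
apply: le_trans (ler_normD _ _) _.
apply: le_trans (lerD (ler_normD _ _) (lexx _)) _; rewrite !normrM.
apply: le_trans (lerD (lerD E (lexx _)) (lexx _)) _.
have eM : e = M * (e / M) by rewrite mulrC divfK// gt_eqF.
rewrite [leRHS]eM /M !mulrDl mul1r.
have := ler_wpM2l (normr_ge0 (hx (a, b))) xe.
have := ler_wpM2l (normr_ge0 (hy (a, b))) ye.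
move: xe ye; lra.
Qed.

Lemma C1_partials_line h hx hy a b p q (t : R) : C1_partials h hx hy ->
  is_derive t (1 : R) (fun t => h (a + t * p, b + t * q))
    (p * hx (a + t * p, b + t * q) + q * hy (a + t * p, b + t * q)).
Proof.
move=> H; apply: is_derive_eps => e e0.
(* The increment k(p, q) has size at most |k| M, hence the tolerance e / M; the 1 keeps M positive
   when p = q = 0. *)
pose M := `|p| + `|q| + 1.
have M0 : 0 < M by rewrite /M ltr_wpDl// addr_ge0.
have eM0 : 0 < e / M by rewrite divr_gt0.
have [d d0 D] := C1_partials_diff (a + t * p) (b + t * q) H eM0.
apply/nbhs_ballP; exists (d / M); first exact: divr_gt0.
move=> k /=; rewrite /ball /= sub0r normrN => /ltW kd.
have kM : `|k| * M <= d by rewrite -ler_pdivlMr.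
have kp : `|k * p| <= d.
  by rewrite normrM (le_trans _ kM)// ler_wpM2l// /M -addrA lerDl addr_ge0.
have kq : `|k * q| <= d.
  by rewrite normrM (le_trans _ kM)// ler_wpM2l// /M addrAC lerDr addr_ge0.
have := D _ _ kp kq.
have -> : a + t * p + k * p = a + (t + k) * p by ring.
have -> : b + t * q + k * q = b + (t + k) * q by ring.
set A := hx _; set B := hy _.
rewrite -addrA -opprD (_ : (p * A + q * B) * k = A * (k * p) + B * (k * q)); last by ring.
move=> /le_trans; apply.
rewrite !normrM (_ : e / M * _ = e * `|k| * ((`|p| + `|q|) / M)); last first.
  by field; rewrite gt_eqF.
have pM : (`|p| + `|q|) / M <= 1 by rewrite ler_pdivrMr// mul1r /M lerDl.
by rewrite ler_piMr// mulr_ge0// ltW.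
Qed.

Lemma eq_C1_partials h hx hy h' hx' hy' : C1_partials h hx hy ->
  h =1 h' -> hx =1 hx' -> hy =1 hy' -> C1_partials h' hx' hy'.
Proof. by move=> H /funext <- /funext <- /funext <-. Qed.

Lemma C1_partialsD h hx hy g gx gy :
  C1_partials h hx hy -> C1_partials g gx gy ->
  C1_partials (fun w => h w + g w) (fun w => hx w + gx w)
    (fun w => hy w + gy w).
Proof.
move=> [h1 h2 h3 h4] [g1 g2 g3 g4]; split.
- by move=> x y; exact: is_deriveD.
- by move=> x y; exact: is_deriveD.
- by move=> w; apply: cvgD; [exact: h3|exact: g3].
- by move=> w; apply: cvgD; [exact: h4|exact: g4].
Qed.

Lemma C1_partialsM h hx hy g gx gy :
  C1_partials h hx hy -> C1_partials g gx gy ->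
  C1_partials (fun w => h w * g w) (fun w => hx w * g w + h w * gx w)
    (fun w => hy w * g w + h w * gy w).
Proof.
move=> H G; have ch := C1_partials_continuous H.
have cg := C1_partials_continuous G.
move: H G => [h1 h2 h3 h4] [g1 g2 g3 g4]; split.
- move=> x y; apply: (is_derive_eq (is_deriveM (h1 x y) (g1 x y))).
  by rewrite addrC; congr (_ + _); exact: mulrC.
- move=> x y; apply: (is_derive_eq (is_deriveM (h2 x y) (g2 x y))).
  by rewrite addrC; congr (_ + _); exact: mulrC.
- by move=> w; apply: cvgD; apply: cvgM; [exact: h3|exact: cg|exact: ch|exact: g3].
- by move=> w; apply: cvgD; apply: cvgM; [exact: h4|exact: cg|exact: ch|exact: g4].
Qed.

Lemma C1_partials_affine (p q c : R) :
  C1_partials (fun w => p * w.1 + q * w.2 + c) (fun=> p) (fun=> q).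
Proof.
split=> [x y|x y|w|w]; try exact: cvg_cst.
- have -> : (fun s : R => p * (s, y).1 + q * (s, y).2 + c) =
    (p \*: (@id R) + cst (q * y + c)) by apply/funext => s; rewrite addrA.
  by apply: is_derive_eq; rewrite addr0 -[LHS]/(p * 1) mulr1.
- have -> : (fun s : R => p * (x, s).1 + q * (x, s).2 + c) =
    (q \*: (@id R) + cst (p * x + c)).
    by apply/funext => s; rewrite [LHS]/= addrAC addrC.
  by apply: is_derive_eq; rewrite addr0 -[LHS]/(q * 1) mulr1.
Qed.

Lemma C1_partials_cst (c : R) : C1_partials (fun=> c) (fun=> 0) (fun=> 0).
Proof.
by apply: eq_C1_partials (C1_partials_affine 0 0 c) _ _ _ => // w;
  rewrite !mul0r !add0r.
Qed.

Lemma C1_partialsZ (c : R) h hx hy : C1_partials h hx hy ->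
  C1_partials (fun w => c * h w) (fun w => c * hx w) (fun w => c * hy w).
Proof.
move=> H; apply: eq_C1_partials (C1_partialsM (C1_partials_cst c) H) _ _ _ => //;
  by move=> w; rewrite mul0r add0r.
Qed.

Lemma C1_partialsN h hx hy : C1_partials h hx hy ->
  C1_partials (fun w => - h w) (fun w => - hx w) (fun w => - hy w).
Proof.
move=> H; apply: eq_C1_partials (C1_partialsZ (- 1) H) _ _ _ => //;
  by move=> w; rewrite mulN1r.
Qed.

Lemma C1_partials_comp (F dF : R -> R) h hx hy :
  (forall s : R, is_derive s (1 : R) F (dF s)) -> continuous dF ->
  C1_partials h hx hy ->
  C1_partials (fun w => F (h w)) (fun w => dF (h w) * hx w)
    (fun w => dF (h w) * hy w).
Proof.
move=> FdF cdF H; have ch := C1_partials_continuous H.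
move: H => [h1 h2 h3 h4]; split.
- by move=> x y; exact: is_derive1_comp.
- by move=> x y; exact: is_derive1_comp.
- move=> w; apply: cvgM; last exact: h3.
  exact: (cvg_comp _ _ (ch w) (cdF (h w))).
- move=> w; apply: cvgM; last exact: h4.
  exact: (cvg_comp _ _ (ch w) (cdF (h w))).
Qed.

Lemma continuous_pair (T U V : topologicalType) (f : T -> U) (g : T -> V) :
  continuous f -> continuous g -> continuous (fun w => (f w, g w)).
Proof. by move=> cf cg w; exact: (cvg_pair (cf w) (cg w)). Qed.

Lemma continuous_affine (p q c : R) :
  continuous (fun w : R * R => p * w.1 + q * w.2 + c).
Proof. exact: C1_partials_continuous (C1_partials_affine p q c). Qed.

(** A dilation moves each axis along itself, so both partials are derivatives along a line parallel
    to an axis. *)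
Lemma C1_partials_dilate h hx hy (a b t : R) : C1_partials h hx hy ->
  C1_partials (fun w => h (a + t * (w.1 - a), b + t * (w.2 - b)))
    (fun w => t * hx (a + t * (w.1 - a), b + t * (w.2 - b)))
    (fun w => t * hy (a + t * (w.1 - a), b + t * (w.2 - b))).
Proof.
move=> H.
have cD : continuous
    (fun w : R * R => (a + t * (w.1 - a), b + t * (w.2 - b))).
  apply: continuous_pair.
    rewrite (_ : (fun w => _) = fun w => t * w.1 + 0 * w.2 + (a - t * a)).
      exact: continuous_affine.
    by apply/funext => w; ring.
  rewrite (_ : (fun w => _) = fun w => 0 * w.1 + t * w.2 + (b - t * b)).
    exact: continuous_affine.
  by apply/funext => w; ring.
have [h1 h2 h3 h4] := H; split.
- move=> x y; have := C1_partials_line (a - t * a) (b + t * (y - b)) t 0 x H.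
  rewrite mulr0 addr0 mul0r addr0.
  have -> : a - t * a + x * t = a + t * (x - a) by ring.
  congr is_derive; apply/funext => s; rewrite mulr0 addr0.
  by congr (h (_, _)); rewrite /=; ring.
- move=> x y; have := C1_partials_line (a + t * (x - a)) (b - t * b) 0 t y H.
  rewrite mulr0 addr0 mul0r add0r.
  have -> : b - t * b + y * t = b + t * (y - b) by ring.
  congr is_derive; apply/funext => s; rewrite mulr0 addr0.
  by congr (h (_, _)); rewrite /=; ring.
- move=> w; apply: cvgM; first exact: cvg_cst.
  exact: (cvg_comp _ _ (cD w) (h3 _)).
- move=> w; apply: cvgM; first exact: cvg_cst.
  exact: (cvg_comp _ _ (cD w) (h4 _)).
Qed.

(* Cauchy--Riemann: u + iv is holomorphic *)
Definition conjugate_pair (u v : R * R -> R) := exists ux uy,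
  C1_partials u ux uy /\ C1_partials v (fun w => - uy w) ux.

Lemma conjugate_pairM u v s t : conjugate_pair u v -> conjugate_pair s t ->
  conjugate_pair (fun w => u w * s w - v w * t w)
    (fun w => u w * t w + v w * s w).
Proof.
move=> [ux [uy [Hu Hv]]] [sx [sy [Hs Ht]]].
exists (fun w => (ux w * s w + u w * sx w) + (uy w * t w - v w * - sy w)).
exists (fun w => (uy w * s w + u w * sy w) - (ux w * t w + v w * sx w)).
split.
- apply: eq_C1_partials (C1_partialsD (C1_partialsM Hu Hs)
    (C1_partialsN (C1_partialsM Hv Ht))) _ _ _ => w //; ring.
- apply: eq_C1_partials (C1_partialsD (C1_partialsM Hu Ht)
    (C1_partialsM Hv Hs)) _ _ _ => w //; ring.
Qed.

(* s + it is the affine function (p - iq)(x + iy) + (c + id) *)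
Lemma conjugate_pair_exp (p q c d : R) :
  let s w := p * w.1 + q * w.2 + c in
  let t w := - q * w.1 + p * w.2 + d in
  conjugate_pair (fun w => expR (s w) * cos (t w))
    (fun w => expR (s w) * sin (t w)).
Proof.
move=> s t.
have Hs : C1_partials s (fun=> p) (fun=> q) := C1_partials_affine p q c.
have Ht : C1_partials t (fun=> - q) (fun=> p) := C1_partials_affine (- q) p d.
have He := C1_partials_comp (@is_derive_expR R) (@continuous_expR R) Hs.
have Hsin := C1_partials_comp (@is_derive_sin R) (@continuous_cos R) Ht.
have cNsin : continuous (fun x : R => - sin x).
  by move=> x; apply: cvgN; exact: continuous_sin.
have Hcos := C1_partials_comp (@is_derive_cos R) cNsin Ht.
exists (fun w => expR (s w) * (p * cos (t w) + q * sin (t w))).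
exists (fun w => expR (s w) * (q * cos (t w) - p * sin (t w))).
split.
- apply: eq_C1_partials (C1_partialsM He Hcos) _ _ _ => w //; ring.
- apply: eq_C1_partials (C1_partialsM He Hsin) _ _ _ => w //; ring.
Qed.

End C1_functions.

(** * The mean value inequality *)

Section mean_value.
Context {R : realType}.
Local Notation mR := (measurableTypeR R).
Local Notation area := (@area R).
Implicit Types (a b l : R) (h hx hy u v : R * R -> R) (w : R * R).

Lemma continuous_quat_measurable (H : quat R -> R) :
  continuous H -> measurable_fun setT H.
Proof.
move=> /continuousP cH.
apply: (measurability _ (@RGenOpens.measurableE R)).
move=> _ [_ [a [b ->] <-]]; rewrite setTI.
by apply: open_quat_measurable; apply: cH; exact: interval_open.
Qed.

(** The plane is embedded in the quaternions as (x, y, 0, 0), where open sets are already known to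
    be measurable for the product structure. *)
Lemma continuous_plane_measurable h :
  continuous h -> measurable_fun setT (h : mR * mR -> R).
Proof.
move=> ch; pose H (z : quat R) := h z.1.1.
have cH : continuous H.
  move=> z; apply: continuous_comp; last exact: ch.
  by apply: continuous_comp; exact: cvg_fst.
have mj : measurable_fun setT (fun w : mR * mR => (w.1, w.2, 0, 0) : quat R).
  do 2 (apply: measurable_fun_pair; last exact: measurable_cst).
  by apply: measurable_fun_pair; [exact: measurable_fst|exact: measurable_snd].
rewrite (_ : h = H \o (fun w : mR * mR => (w.1, w.2, 0, 0) : quat R)).
  exact: measurableT_comp (continuous_quat_measurable cH) mj.
by apply/funext => -[].
Qed.

(** Closed, hence compact, for the extremal arguments and for integrability; a product of intervals,
    for Fubini. *)
Definition box (a b l : R) : set (R * R) :=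
  `[a - l, a + l] `*` `[b - l, b + l].

Lemma boxP a b l w : box a b l w <-> `|w.1 - a| <= l /\ `|w.2 - b| <= l.
Proof. by rewrite /box /= !in_itv /= !ler_distl. Qed.

Lemma measurable_box a b l : measurable (box a b l : set (mR * mR)).
Proof. by apply: measurableX; exact: measurable_itv. Qed.

Lemma area_box a b l : 0 <= l -> area (box a b l) = ((2 * l) ^+ 2)%:E.
Proof.
move=> l0; rewrite /box /area product_measure1E; [|exact: measurable_itv..].
have E c : @lebesgue_measure R `[c - l, c + l] = (2 * l)%:E.
  rewrite lebesgue_measure_itv /= lte_fin.
  case: ltP => [_|cl].
    by rewrite -EFinB; congr (_%:E); ring.
  by congr (_%:E); move: cl l0; lra.
by rewrite expr2 EFinM; congr (_ * _)%E; exact: E.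
Qed.

Lemma box_bounded a b l h : 0 <= l -> continuous h ->
  exists2 M : R, 0 < M & forall w, box a b l w -> `|h w| <= M.
Proof.
move=> l0 ch.
have ne : box a b l !=set0.
  by exists (a, b); apply/boxP; rewrite /= !subrr normr0.
have cb : compact (box a b l) by apply: compact_setX; exact: segment_compact.
have cnh : continuous (fun w => `|h w|).
  by move=> w; apply: cvg_norm; exact: ch.
have [c _ cM] := compact_EVT_max ne cb (continuous_subspaceT cnh).
exists (`|h c| + 1); first by rewrite ltr_wpDl.
by move=> w bw; rewrite (le_trans (cM w _)) ?lerDl// inE.
Qed.

Lemma integrable_box a b l h : 0 <= l -> continuous h ->
  area.-integrable (box a b l) (EFin \o h).
Proof.
move=> l0 ch; apply: measurable_bounded_integrable.
- exact: measurable_box.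
- by rewrite [X in (X < _)%E](area_box a b l0) ltry.
- apply: measurable_funTS; exact: continuous_plane_measurable.
- have [M M0 H] := box_bounded a b l0 ch.
  exists M; split; first exact: num_real.
  by move=> x Mx w bw; exact: le_trans (H w bw) (ltW Mx).
Qed.

Lemma le_Rintegral_box (c d k a b l : R) (g h : R * R -> R) :
  0 <= k -> 0 <= l -> continuous g -> continuous h ->
  (forall w, box a b l w -> 0 <= h w) ->
  (forall w, box c d k w -> g w <= h w) -> box c d k `<=` box a b l ->
  \int[area]_(w in box c d k) g w <= \int[area]_(w in box a b l) h w.
Proof.
move=> k0 l0 cg ch h0 gh sub.
have iE (a' b' k' : R) f : 0 <= k' -> continuous f ->
    area.-integrable setT (EFin \o (f \_ (box a' b' k'))).
  move=> k'0 cf; rewrite -restrict_EFin -integrable_mkcond.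
    exact: integrable_box k'0 cf.
  exact: measurable_box.
rewrite Rintegral_mkcond [leRHS]Rintegral_mkcond.
apply: le_Rintegral => //; [exact: iE|exact: iE|].
move=> w _; rewrite !patchE; case: ifPn => [|_]; last first.
  by case: ifPn => //; rewrite inE => /h0.
by rewrite inE => bw; rewrite ifT ?gh// inE; exact: sub.
Qed.

Lemma integral_is_derive (g dg : R -> R) (a b : R) : a < b ->
  (forall s : R, is_derive s (1 : R) g (dg s)) -> continuous dg ->
  (\int[lebesgue_measure]_(x in `[a, b]) (dg x)%:E = (g b - g a)%:E)%E.
Proof.
move=> ab gdg cdg.
have cg : continuous g.
  by move=> s; apply/differentiable_continuous/derivable1_diffP; case: (gdg s).
rewrite (@continuous_FTC2 _ dg g)//.
- exact: continuous_subspaceT.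
- split; first by move=> x _; case: (gdg x).
    by apply: cvg_at_right_filter; exact: cg.
  by apply: cvg_at_left_filter; exact: cg.
- by move=> x _; rewrite derive1E; have [] := gdg x.
Qed.

Lemma continuous_slice1 h (y : R) :
  continuous h -> continuous (fun x : R => h (x, y)).
Proof.
move=> ch x; apply: continuous_comp; last exact: ch.
exact: (continuous_pair (fun x => cvg_id) (@cst_continuous _ _ y)).
Qed.

Lemma continuous_slice2 h (x : R) :
  continuous h -> continuous (fun y : R => h (x, y)).
Proof.
move=> ch y; apply: continuous_comp; last exact: ch.
exact: (continuous_pair (@cst_continuous _ _ x) (fun x => cvg_id)).
Qed.

(** Integrate first in the variable of differentiation: the inner integral is a difference of
    boundary values, and both vanish. *)
Lemma integral_box_dy a b l h hx hy : 0 < l -> C1_partials h hx hy ->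
  (forall x, h (x, b - l) = 0) -> (forall x, h (x, b + l) = 0) ->
  \int[area]_(w in box a b l) hy w = 0.
Proof.
move=> l0 [_ h2 _ h4] h0 h1.
have iF : area.-integrable setT ((EFin \o hy) \_ (box a b l)).
  rewrite -integrable_mkcond; last exact: measurable_box.
  exact: integrable_box (ltW l0) h4.
rewrite /Rintegral integral_mkcond -(integral12_prod_meas1 iF).
rewrite integral0_eq// => x _; rewrite /fubini_F.
have [xI|xI] := boolP (x \in `[a - l, a + l]); last first.
  rewrite integral0_eq// => y _; rewrite patchE ifF//.
  by apply/negbTE; apply: contra xI; rewrite inE => -[].
rewrite (_ : (fun y => _) = (EFin \o (fun y => hy (x, y))) \_ `[b - l, b + l]).
  rewrite -integral_mkcond (integral_is_derive _ (h2 x)) ?h0 ?h1 ?subrr//.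
    by rewrite ltrD2l gt0_cp.
  exact: continuous_slice2.
apply/funext => y; rewrite !patchE.
suff -> : ((x, y) \in box a b l) = (y \in `[b - l, b + l]%classic) by [].
apply/idP/idP; first by rewrite !inE => -[].
by rewrite !inE => I; split.
Qed.

Lemma integral_box_dx a b l h hx hy : 0 < l -> C1_partials h hx hy ->
  (forall y, h (a - l, y) = 0) -> (forall y, h (a + l, y) = 0) ->
  \int[area]_(w in box a b l) hx w = 0.
Proof.
move=> l0 [h1 _ h3 _] e0 e1.
have iF : area.-integrable setT ((EFin \o hx) \_ (box a b l)).
  rewrite -integrable_mkcond; last exact: measurable_box.
  exact: integrable_box (ltW l0) h3.
rewrite /Rintegral integral_mkcond -(integral21_prod_meas1 iF).
rewrite integral0_eq// => y _; rewrite /fubini_G.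
have [yI|yI] := boolP (y \in `[b - l, b + l]); last first.
  rewrite integral0_eq// => x _; rewrite patchE ifF//.
  by apply/negbTE; apply: contra yI; rewrite inE => -[].
rewrite (_ : (fun x => _) = (EFin \o (fun x => hx (x, y))) \_ `[a - l, a + l]).
  rewrite -integral_mkcond (integral_is_derive _ (h1 ^~ y)) ?e0 ?e1 ?subrr//.
    by rewrite ltrD2l gt0_cp.
  exact: continuous_slice1.
apply/funext => x; rewrite !patchE.
suff -> : ((x, y) \in box a b l) = (x \in `[a - l, a + l]%classic) by [].
apply/idP/idP; first by rewrite !inE => -[].
by rewrite !inE => I; split.
Qed.

(** Whatever the signs of s and s + k, the error of the linearization is at most k^2. *)
Lemma is_derive_sqr_pos (s : R) :
  is_derive s (1 : R) (fun x => Num.max 0 x ^+ 2) (2 * Num.max 0 s).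
Proof.
apply: is_derive_eps => e e0; near=> k.
apply: (@le_trans _ _ (k ^+ 2)).
  rewrite ler_norml; have [] := leP 0 s; have [] := leP 0 (s + k);
    by move=> ? ?; apply/andP; split; nra.
rewrite -real_normK ?num_real// expr2 ler_wpM2r//.
Unshelve. all: by end_near. Qed.

Lemma continuous_pos : continuous (fun x : R => Num.max 0 x).
Proof.
by move=> x; apply: continuous_max; [exact: cvg_cst|exact: cvg_id].
Qed.

(** Radial, so that its gradient, [bump_slope] times w - (a, b), has no angular component; squared,
    so that it is C^1 across the circle; supported in the disk inscribed in [box a b l], so that it
    vanishes on the four sides. *)
Definition bump a b l w : R :=
  Num.max 0 (l ^+ 2 - (w.1 - a) ^+ 2 - (w.2 - b) ^+ 2) ^+ 2.

Definition bump_slope a b l w : R :=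
  - 4 * Num.max 0 (l ^+ 2 - (w.1 - a) ^+ 2 - (w.2 - b) ^+ 2).

Lemma C1_partials_bump a b l : C1_partials (bump a b l)
  (fun w => bump_slope a b l w * (w.1 - a))
  (fun w => bump_slope a b l w * (w.2 - b)).
Proof.
have H1 := C1_partials_affine 1 0 (- a); have H2 := C1_partials_affine 0 1 (- b).
have cd : continuous (fun x : R => 2 * Num.max 0 x).
  by move=> x; apply: cvgM; [exact: cvg_cst|exact: continuous_pos].
have H := C1_partialsD (C1_partials_cst (l ^+ 2))
  (C1_partialsN (C1_partialsD (C1_partialsM H1 H1) (C1_partialsM H2 H2))).
have E w : l ^+ 2 + - ((1 * w.1 + 0 * w.2 + - a) * (1 * w.1 + 0 * w.2 + - a) +
     (0 * w.1 + 1 * w.2 + - b) * (0 * w.1 + 1 * w.2 + - b)) =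
   l ^+ 2 - (w.1 - a) ^+ 2 - (w.2 - b) ^+ 2 by ring.
apply: eq_C1_partials (C1_partials_comp is_derive_sqr_pos cd H) _ _ _ => w.
- by rewrite E.
- by rewrite E /bump_slope; ring.
- by rewrite E /bump_slope; ring.
Qed.

Lemma bump_ge0 a b l w : 0 <= bump a b l w. Proof. exact: sqr_ge0. Qed.

Lemma bump_le a b l w : bump a b l w <= l ^+ 4.
Proof.
rewrite /bump (_ : l ^+ 4 = (l ^+ 2) ^+ 2); last by rewrite -exprM.
rewrite lerXn2r// ?nnegrE ?sqr_ge0 ?le_max ?lexx// ge_max sqr_ge0 /=.
have := sqr_ge0 (w.1 - a); have := sqr_ge0 (w.2 - b); lra.
Qed.

Lemma bump_ge a b l w : box a b (l / 2) w -> l ^+ 4 / 4 <= bump a b l w.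
Proof.
move=> /boxP[w1 w2]; have l0 : 0 <= l / 2 := le_trans (normr_ge0 _) w1.
have sq (x : R) : `|x| <= l / 2 -> x ^+ 2 <= l ^+ 2 / 4.
  rewrite -[x ^+ 2]real_normK ?num_real// => xl.
  rewrite (_ : l ^+ 2 / 4 = (l / 2) ^+ 2); last by field.
  by rewrite lerXn2r// nnegrE.
rewrite /bump (_ : l ^+ 4 / 4 = (l ^+ 2 / 2) ^+ 2); last by field.
rewrite lerXn2r// ?nnegrE ?divr_ge0 ?sqr_ge0 ?le_max ?lexx//.
by apply/orP; right; move: (sq _ w1) (sq _ w2); lra.
Qed.

Lemma bump_eq0 a b l w : l ^+ 2 <= (w.1 - a) ^+ 2 \/ l ^+ 2 <= (w.2 - b) ^+ 2 ->
  bump a b l w = 0.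
Proof.
have := sqr_ge0 (w.1 - a); have := sqr_ge0 (w.2 - b) => h1 h2 h.
rewrite /bump max_l ?expr0n//; case: h; move: h1 h2; lra.
Qed.

Lemma continuous_bump a b l : continuous (bump a b l).
Proof. exact: C1_partials_continuous (C1_partials_bump a b l). Qed.

Lemma box_center a b l : 0 <= l -> box a b l (a, b).
Proof. by move=> l0; apply/boxP; rewrite /= !subrr normr0. Qed.

(* The dilation average int k(w) u(c + t (w - c)) dw against a radial bump k
   does not depend on t: by Cauchy--Riemann the radial derivative of u is the
   angular derivative of v, which integrates to 0 against k. *)
Lemma bump_mean u v a b l : 0 < l -> conjugate_pair u v ->
  \int[area]_(w in box a b l) (bump a b l w * u w) =
  u (a, b) * \int[area]_(w in box a b l) bump a b l w.
Proof.
move=> l0 [ux [uy [Hu Hv]]].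
pose D t w := (a + t * (w.1 - a), b + t * (w.2 - b)).
pose f t w := bump a b l w * u (D t w).
pose df t w := bump a b l w * ((w.1 - a) * ux (D t w) + (w.2 - b) * uy (D t w)).
pose F t := \int[area]_(w in box a b l) f t w.
have cu := C1_partials_continuous Hu.
have cf t : continuous (f t).
  move=> w; apply: cvgM; first exact: continuous_bump.
  exact: C1_partials_continuous (C1_partials_dilate a b t Hu) w.
have fdf (t : R) w : is_derive t (1 : R) (f ^~ w) (df t w).
  exact: (is_deriveZ (bump a b l w)
    (C1_partials_line a b (w.1 - a) (w.2 - b) t Hu)).
have [_ _ cux cuy] := Hu.
(* The open interval ]-2, 2[ contains [0, 1] with its endpoints. For t in it, the dilated box stays
   in [box a b (2 * l)], where the partials of u are bounded; this provides the dominating constant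
   G. *)
have l20 : 0 <= 2 * l by rewrite mulr_ge0// ltW.
have [M1 M10 HM1] := box_bounded a b l20 cux.
have [M2 M20 HM2] := box_bounded a b l20 cuy.
pose G : R * R -> R := fun=> l ^+ 4 * (l * M1 + l * M2).
have dfG (t : R) w : t \in `]-2, 2[%R -> box a b l w -> `|df t w| <= G w.
  rewrite in_itv /= => /andP[t1 t2] bw.
  have tb : `|t| <= 2 by rewrite ler_norml !ltW.
  have bD : box a b (2 * l) (D t w).
    move/boxP : bw => [w1 w2]; apply/boxP; rewrite /D /=.
    by rewrite [a + _]addrC [b + _]addrC !addrK !normrM !ler_pM.
  move/boxP : bw => [w1 w2].
  rewrite /df /G normrM ler_pM//; first by rewrite ger0_norm ?bump_ge0 ?bump_le.
  apply: le_trans (ler_normD _ _) _; rewrite !normrM.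
  by rewrite lerD// ler_pM// ?HM1// ?HM2.
have FdF (t : R) : t \in `]-2, 2[%R ->
    derivable F t 1 /\ derive1 F t = \int[area]_(w in box a b l) df t w.
  move=> t2.
  have intf (x : R) : `]-2, 2[%classic x -> area.-integrable (box a b l) (EFin \o f x).
    by move=> _; apply: integrable_box (ltW l0) (cf x).
  have der (x : R) w : `]-2, 2[%classic x -> box a b l w -> derivable (f ^~ w) x 1.
    by move=> _ _; case: (fdf x w).
  have dE x w : partial1of2 f x w = df x w.
    by rewrite partial1of2E; case: (fdf x w).
  have G0 w : 0 <= G w.
    by rewrite /G mulr_ge0 ?exprn_ge0 ?addr_ge0 ?mulr_ge0 ?ltW.
  have intG : area.-integrable (box a b l) (EFin \o G).
    by apply: integrable_box (ltW l0) _ => w; exact: cvg_cst.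
  have Gub (x : R) w : `]-2, 2[%classic x -> box a b l w -> `|partial1of2 f x w| <= G w.
    by rewrite dE => x2; exact: dfG.
  split.
    exact: (derivable_under_integral (measurable_box a b l) t2 intf der G0 intG Gub).
  have := differentiation_under_integral (measurable_box a b l) t2 intf der G0 intG Gub.
  by rewrite /F => ->; apply: eq_Rintegral => w _; exact: dE.
have dF0 (t : R) : t != 0 -> \int[area]_(w in box a b l) df t w = 0.
  move=> t0.
  have Hk := C1_partials_bump a b l.
  have HV := C1_partials_dilate a b t Hv.
  (* With k the bump, t [df t] is the y-derivative of k (x - a) v(D t w) minus the x-derivative of k
     (y - b) v(D t w). The terms that differentiate k cancel because k is radial, and the others
     match by Cauchy--Riemann. *)
  have H1 := C1_partialsM (C1_partialsM Hk (C1_partials_affine 1 0 (- a))) HV.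
  have H2 := C1_partialsM (C1_partialsM Hk (C1_partials_affine 0 1 (- b))) HV.
  have zy x y : l ^+ 2 <= (y - b) ^+ 2 ->
      bump a b l (x, y) * (1 * x + 0 * y + - a) * v (D t (x, y)) = 0.
    by move=> yl; rewrite bump_eq0 ?mul0r//; right.
  have zx x y : l ^+ 2 <= (x - a) ^+ 2 ->
      bump a b l (x, y) * (0 * x + 1 * y + - b) * v (D t (x, y)) = 0.
    by move=> xl; rewrite bump_eq0 ?mul0r//; left.
  move: H1; set g1 := (X in C1_partials _ _ X) => H1.
  move: H2; set g2 := (X in C1_partials _ X _) => H2.
  have I1 : \int[area]_(w in box a b l) g1 w = 0.
    apply: integral_box_dy l0 H1 _ _ => x; apply: zy.
      by rewrite (_ : b - l - b = - l) ?sqrrN//; ring.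
    by rewrite (_ : b + l - b = l)//; ring.
  have I2 : \int[area]_(w in box a b l) g2 w = 0.
    apply: integral_box_dx l0 H2 _ _ => x; apply: zx.
      by rewrite (_ : a - l - a = - l) ?sqrrN//; ring.
    by rewrite (_ : a + l - a = l)//; ring.
  have [_ _ _ c1] := H1; have [_ _ c2 _] := H2.
  transitivity (\int[area]_(w in box a b l) (t^-1 * (g1 w - g2 w))).
    by apply: eq_Rintegral => w _; rewrite /df /g1 /g2 /D; field.
  have c12 : continuous (fun w => g1 w - g2 w).
    by move=> w; apply: cvgB; [exact: c1|exact: c2].
  rewrite RintegralZl; [|exact: measurable_box|exact: integrable_box (ltW l0) c12].
  rewrite RintegralB ?I1 ?I2 ?subrr ?mulr0//; first exact: measurable_box.
    exact: integrable_box (ltW l0) c1.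
  exact: integrable_box (ltW l0) c2.
have cF : {within `[0, 1], continuous F}.
  apply: derivable_within_continuous => t t01.
  have t2 : t \in `]-2, 2[%R.
    by move: t01; rewrite !in_itv /= => /andP[? ?]; apply/andP; split; lra.
  by have [] := FdF _ t2.
(* At t = 0 the division by t in [dF0] is not possible; continuity of F on [0, 1] takes care of this
   endpoint. *)
have F'0 (t : R) : t \in `]0, 1[%R -> is_derive t (1 : R) F (0 : R).
  rewrite in_itv /= => /andP[t0 t1].
  have t2 : t \in `]-2, 2[%R by rewrite in_itv /=; apply/andP; split; lra.
  have [dF F'] := FdF _ t2; apply: DeriveDef => //.
  by rewrite -derive1E F' dF0// gt_eqF.
have [_ _] := MVT_segment ler01 F'0 cF.
rewrite mul0r => /eqP; rewrite subr_eq0 => /eqP F10.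
have -> : \int[area]_(w in box a b l) (bump a b l w * u w) = F 1.
  apply: eq_Rintegral => w _; rewrite /f /D !mul1r.
  by rewrite ![_ + (_ - _)]addrC !subrK; case: w.
rewrite F10 mulrC -RintegralZr//.
- by apply: eq_Rintegral => w _; rewrite /f /D !mul0r !addr0.
- exact: measurable_box.
- exact: integrable_box (ltW l0) (@continuous_bump a b l).
Qed.

Lemma conjugate_pair_submean u v a b l : 0 < l -> conjugate_pair u v ->
  u (a, b) * l ^+ 2 <= 4 * \int[area]_(w in box a b l) `|u w|.
Proof.
move=> l0 H; have [ux [uy [Hu _]]] := H.
have cu := C1_partials_continuous Hu.
have cn : continuous (fun w => `|u w|) by move=> w; apply: cvg_norm; exact: cu.
have [u0|u0] := leP (u (a, b)) 0.
  by rewrite (@le_trans _ _ 0)// ?pmulr_lle0 ?exprn_gt0// mulr_ge0// Rintegral_ge0.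
have mb := measurable_box a b l.
have h := bump_mean a b l0 H.
have l4 : 0 < l ^+ 4 by rewrite exprn_gt0.
have I : u (a, b) * \int[area]_(w in box a b l) bump a b l w <=
    l ^+ 4 * \int[area]_(w in box a b l) `|u w|.
  rewrite -h -RintegralZl//; last exact: integrable_box (ltW l0) cn.
  apply: le_Rintegral => //.
  - by apply: integrable_box (ltW l0) _ => w; apply: cvgM; [exact: continuous_bump|exact: cu].
  - by apply: integrable_box (ltW l0) _ => w; apply: cvgM; [exact: cvg_cst|exact: cn].
  - move=> w _; apply: le_trans (ler_norm _) _; rewrite normrM ler_wpM2r//.
    by rewrite ger0_norm ?bump_ge0 ?bump_le.
(* The bump is at least l^4/4 on the square of half side l/2, whose area is l^2. Against the upper
   bound l^4 for the bump, this gives the constant 4. *)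
have J : l ^+ 4 / 4 * l ^+ 2 <= \int[area]_(w in box a b l) bump a b l w.
  have l2 : 0 <= l / 2 by rewrite divr_ge0// ltW.
  have -> : l ^+ 4 / 4 * l ^+ 2 = \int[area]_(w in box a b (l / 2)) (l ^+ 4 / 4).
    rewrite Rintegral_cst; last exact: measurable_box.
    by rewrite [X in fine X](area_box a b l2) /=; congr (_ * _ ^+ 2); field.
  apply: le_Rintegral_box => //; first exact: ltW.
  - by move=> w; exact: cvg_cst.
  - exact: continuous_bump.
  - by move=> w _; exact: bump_ge0.
  - by move=> w bw; exact: bump_ge.
  - move=> w /boxP[w1 w2]; apply/boxP.
    by split; [apply: le_trans w1 _|apply: le_trans w2 _]; lra.
have := le_trans (ler_wpM2l (ltW u0) J) I.
rewrite (_ : u (a, b) * (l ^+ 4 / 4 * l ^+ 2) =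
  l ^+ 4 * (4^-1 * (u (a, b) * l ^+ 2))); last by field.
by rewrite ler_pM2l// ler_pdivrMl.
Qed.

End mean_value.

(** * The mean value inequality for p-th powers *)

Section submean_powers.
Context {R : realType}.
Local Notation area := (@area R).

Lemma continuous_norm_powR (p : R) : 0 < p ->
  continuous (fun x : R => `|x| `^ p).
Proof.
move=> p0 x; have [->|x0] := eqVneq x 0.
  rewrite /prop_for /continuous_at normr0 powR0 ?gt_eqF//.
  apply/cvgrPdist_le => e e0; near=> y.
  rewrite sub0r normrN (ger0_norm (powR_ge0 _ _)).
  rewrite (_ : e = (e `^ p^-1) `^ p); last first.
    by rewrite -powRrM mulVf ?gt_eqF// powRr1// ltW.
  apply: ge0_ler_powR; rewrite ?nnegrE ?powR_ge0//; first exact: ltW.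
  near: y; exists (e `^ p^-1); first exact: powR_gt0.
  by move=> z /=; rewrite /ball /= sub0r normrN => /ltW.
apply: (@continuous_comp _ _ _ (fun x : R => `|x|) (fun y : R => y `^ p)).
  exact: norm_continuous.
apply/differentiable_continuous/derivable1_diffP/derivable_powR.
by rewrite in_itv /= andbT normr_gt0.
Unshelve. all: by end_near. Qed.

Lemma continuous_powR_comp (T : topologicalType) (p : R) (g : T -> R) :
  0 < p -> continuous g -> (forall w, 0 <= g w) ->
  continuous (fun w => g w `^ p).
Proof.
move=> p0 cg g0; rewrite (_ : (fun w => _) = (fun w => `|g w| `^ p)).
  move=> w; exact: (continuous_comp (cg w) (@continuous_norm_powR p p0 (g w))).
by apply/funext => w; rewrite ger0_norm.
Qed.

(** If g > e, write g = g^(1-p) g^p. The factor g^(1-p) is at most L^(1-p) when p <= 1 and at most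
    e^(1-p) when p > 1; the sum of the two serves both cases. *)
Lemma le_eps_powR (p g e L : R) : 0 < p -> 0 <= g <= L -> 0 < e ->
  g <= e + (e `^ (1 - p) + L `^ (1 - p)) * g `^ p.
Proof.
move=> p0 /andP[g0 gL] e0; have [ge|eg] := leP g e.
  by rewrite (le_trans ge)// lerDl mulr_ge0 ?addr_ge0 ?powR_ge0.
have gp : 0 < g by exact: lt_trans eg.
have {1}-> : g = g `^ (1 - p) * g `^ p.
  by rewrite -powRD ?subrK ?powRr1// gt_eqF ?implybT.
rewrite ler_wpDl ?(ltW e0)// ler_wpM2r ?powR_ge0//.
have [p1|p1] := leP p 1.
  rewrite ler_wpDl ?powR_ge0// ge0_ler_powR ?subr_ge0 ?nnegrE//.
  exact: le_trans gL.
rewrite ler_wpDr ?powR_ge0// -opprB !powRN lef_pV2 ?posrE ?powR_gt0//.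
by rewrite ge0_ler_powR ?subr_ge0 ?nnegrE ?ltW.
Qed.

(* The argument of Hardy--Littlewood and Fefferman--Stein: at a maximum point
   of g^p dist(., boundary)^2, the value of g controls g on a comparable box,
   so that there int g is dominated by a small multiple of g plus a multiple
   of g^(1-p) int g^p. *)
Lemma submean_powR (p C : R) : 0 < p -> 0 < C -> exists2 C' : R, 0 < C' &
  forall (g : R * R -> R) (a b s : R), 0 < s -> continuous g ->
  (forall w, 0 <= g w) ->
  (forall c d l, 0 < l -> l <= s ->
    g (c, d) * l ^+ 2 <= C * \int[area]_(w in box c d l) g w) ->
  g (a, b) `^ p * s ^+ 2 <= C' * \int[area]_(w in box a b s) (g w `^ p).
Proof.
(* This is the factor of [le_eps_powR] for e = G / (8 C) and L = 4^(1/p) G, with G^(1-p) taken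
   out. *)
move=> p0 C0; pose k := ((8 * C)^-1) `^ (1 - p) + (4 `^ p^-1) `^ (1 - p).
have k0 : 0 < k by rewrite /k addr_gt0 ?powR_gt0 ?invr_gt0 ?mulr_gt0.
exists (8 * C * k); first by rewrite !mulr_gt0.
move=> g a b s s0 cg g0 H.
have cgp := continuous_powR_comp p0 cg g0.
pose D (w : R * R) := s - Num.max `|w.1 - a| `|w.2 - b|.
have cD : continuous D.
  have c1 : continuous (fun w : R * R => `|w.1 - a|).
    by move=> w; apply: cvg_norm; apply: cvgB; [exact: cvg_fst|exact: cvg_cst].
  have c2 : continuous (fun w : R * R => `|w.2 - b|).
    by move=> w; apply: cvg_norm; apply: cvgB; [exact: cvg_snd|exact: cvg_cst].
  move=> w; apply: cvgB; first exact: cvg_cst.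
  exact: (continuous_max (c1 w) (c2 w)).
pose phi w := g w `^ p * D w ^+ 2.
have cphi : continuous phi.
  by move=> w; apply: cvgM; [exact: cgp|apply: cvgM; exact: cD].
have ne : box a b s !=set0 by exists (a, b); exact/box_center/ltW.
have cb : compact (box a b s) by apply: compact_setX; exact: segment_compact.
have [[c d] /set_mem bcd cmax] := compact_EVT_max ne cb (continuous_subspaceT cphi).
have phiab : g (a, b) `^ p * s ^+ 2 <= phi (c, d).
  have := cmax (a, b); rewrite /phi /D /= !subrr normr0 maxxx subr0; apply.
  by rewrite inE; exact/box_center/ltW.
apply: (le_trans phiab).
have I0 : 0 <= \int[area]_(w in box a b s) (g w `^ p).
  by apply: Rintegral_ge0 => w _; exact: powR_ge0.
have [phi0|phi0] := leP (phi (c, d)) 0.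
  by apply: (le_trans phi0); rewrite mulr_ge0// ltW// !mulr_gt0.
set D0 := D (c, d); set G := g (c, d).
have D00 : 0 <= D0.
  by move/boxP : bcd => /= [c1 c2]; rewrite subr_ge0 ge_max c1.
have DD : 0 < D0.
  by rewrite lt_neqAle D00 andbT; apply/eqP => h; move: phi0; rewrite /phi -/D0 -h expr0n mulr0 ltxx.
have GG : 0 < G.
  rewrite lt_neqAle g0 andbT; apply/eqP => h.
  by move: phi0; rewrite /phi -/G -h powR0 ?gt_eqF// mul0r ltxx.
pose l := D0 / 2; have l0 : 0 < l by rewrite divr_gt0.
have Ds : D0 <= s by rewrite gerBl le_max normr_ge0.
have ls : l <= s by rewrite /l; lra.
have DE w : box c d l w -> D0 / 2 <= D w.
  move=> /boxP[/= w1 w2]; rewrite /D lerBrDr -lerBrDl ge_max.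
  have h1 : `|c - a| <= s - D0 by rewrite /D0 /D subKr le_max lexx.
  have h2 : `|d - b| <= s - D0 by rewrite /D0 /D subKr le_max lexx orbT.
  have -> : s - D0 / 2 = l + (s - D0) by rewrite /l; lra.
  by rewrite (le_trans (ler_distD c _ _)) ?lerD// (le_trans (ler_distD d _ _)) ?lerD.
have sub : box c d l `<=` box a b s.
  move=> w /DE h; apply/boxP; apply/andP; rewrite -ge_max.
  by move: h DD; rewrite /D; lra.
(* On this box the distance to the boundary is at least D0 / 2, so maximality of [phi] at (c, d)
   yields g^p <= 4 G^p. *)
have gL w : box c d l w -> g w <= 4 `^ p^-1 * G.
  move=> bw; rewrite leNgt; apply/negP => Lg.
  have : (4 `^ p^-1 * G) `^ p < g w `^ p.
    have L0 : 0 <= 4 `^ p^-1 * G by rewrite mulr_ge0 ?powR_ge0// ltW.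
    by apply: gt0_ltr_powR; rewrite ?nnegrE.
  rewrite powRM ?powR_ge0 ?(ltW GG)// -powRrM mulVf ?gt_eqF// powRr1//.
  apply/negP; rewrite -leNgt.
  have h1 := cmax w (mem_set (sub _ bw)); have h2 := DE _ bw.
  have h3 : (D0 / 2) ^+ 2 <= D w ^+ 2.
    by rewrite lerXn2r// nnegrE ?(le_trans _ h2)// divr_ge0.
  have := ler_wpM2l (powR_ge0 (g w) p) h3 => /le_trans/(_ h1).
  rewrite (_ : g w `^ p * _ = D0 ^+ 2 * (g w `^ p / 4)); last by field.
  rewrite /phi -/G -/D0 [G `^ p * _]mulrC ler_pM2l ?exprn_gt0//; lra.
(* Chosen so that C e (2 l)^2 = G l^2 / 2, which the left-hand side absorbs. *)
pose e := G / (8 * C); have e0 : 0 < e by rewrite divr_gt0// mulr_gt0.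
have KE : e `^ (1 - p) + (4 `^ p^-1 * G) `^ (1 - p) = k * G `^ (1 - p).
  have C8 : 0 <= (8 * C)^-1 by rewrite invr_ge0 mulr_ge0// ltW.
  by rewrite /e [G / _]mulrC !powRM ?powR_ge0 ?(ltW GG)// -mulrDl.
have J : \int[area]_(w in box c d l) g w <=
    e * (2 * l) ^+ 2 + k * G `^ (1 - p) * \int[area]_(w in box c d l) (g w `^ p).
  have mb := @measurable_box R c d l.
  have -> : e * (2 * l) ^+ 2 = \int[area]_(w in box c d l) e.
    rewrite Rintegral_cst//.
    by rewrite [X in fine X](area_box c d (ltW l0)).
  have ie : area.-integrable (box c d l) (EFin \o (fun=> e)).
    by apply: integrable_box (ltW l0) _ => w; exact: cvg_cst.
  have ig := integrable_box c d (ltW l0) cg.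
  have cK : continuous (fun w => k * G `^ (1 - p) * g w `^ p).
    by move=> w; apply: cvgM; [exact: cvg_cst|exact: cgp].
  rewrite -RintegralZl//; last exact: integrable_box (ltW l0) cgp.
  rewrite -RintegralD//; last exact: integrable_box (ltW l0) cK.
  apply: le_Rintegral => //.
    apply: integrable_box (ltW l0) _ => w.
    by apply: cvgD; [exact: cvg_cst|exact: cK].
  move=> w bw; rewrite -KE; apply: le_eps_powR => //.
  by rewrite g0 gL.
have JJ : \int[area]_(w in box c d l) (g w `^ p) <=
    \int[area]_(w in box a b s) (g w `^ p).
  apply: le_Rintegral_box => //; try exact: ltW.
  by move=> w _; exact: powR_ge0.
have := H c d l l0 ls; rewrite -/G => HG.
have {}HG := le_trans HG (ler_wpM2l (ltW C0) J).
move: HG JJ I0; set X := \int[area]_(w in box c d l) _.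
set Y := \int[area]_(w in box a b s) _ => HG JJ I0.
have {}HG : G * l ^+ 2 <= 2 * C * k * G `^ (1 - p) * X.
  have E : C * (e * (2 * l) ^+ 2) = G * l ^+ 2 / 2.
    by rewrite /e; field; rewrite gt_eqF.
  by clear J; move: HG; rewrite mulrDr E; lra.
have GE : G = G `^ (1 - p) * G `^ p.
  by rewrite -powRD ?subrK ?powRr1 ?(ltW GG)// gt_eqF ?implybT.
have {}HG : G `^ p * l ^+ 2 <= 2 * C * k * X.
  rewrite -(ler_pM2l (powR_gt0 (1 - p) GG)) mulrA -GE (le_trans HG)//.
  by rewrite le_eqVlt; apply/orP; left; apply/eqP; ring.
have -> : phi (c, d) = 4 * (G `^ p * l ^+ 2) by rewrite /phi -/D0 -/G /l; field.
apply: (@le_trans _ _ (4 * (2 * C * k * X))); first by rewrite ler_pM2l.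
rewrite (_ : 4 * _ = 8 * C * k * X); last by ring.
by rewrite ler_pM2l// !mulr_gt0.
Qed.

End submean_powers.

(** * Quaternions and slices *)

Section quaternion_algebra.
Context {R : realType}.
Implicit Types (a b z w I J : quat R) (t : R * R).

Definition qdot a b : R :=
  let: (a1, a2, a3, a4) := a in let: (b1, b2, b3, b4) := b in
  a1 * b1 + a2 * b2 + a3 * b3 + a4 * b4.

Lemma qnorm_ge0 z : 0 <= qnorm z.
Proof. by case: z => [[[? ?] ?] ?]; exact: sqrtr_ge0. Qed.

Lemma qnorm_sqr z : qnorm z ^+ 2 = qdot z z.
Proof.
case: z => [[[z1 z2] z3] z4]; rewrite /qnorm sqr_sqrtr ?addr_ge0 ?sqr_ge0//.
Qed.

Lemma qnorm_eq0 z : qnorm z = 0 -> z = 0.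
Proof.
move=> /(congr1 (fun x => x ^+ 2)); rewrite qnorm_sqr expr0n /=.
case: z => [[[z1 z2] z3] z4] /=; rewrite -!expr2 => /eqP.
rewrite !paddr_eq0 ?addr_ge0 ?sqr_ge0// !sqrf_eq0 -!andbA.
by move=> /and4P[/eqP -> /eqP -> /eqP -> /eqP ->].
Qed.

Lemma qnormM a b : qnorm (qmul a b) = qnorm a * qnorm b.
Proof.
apply/eqP; rewrite -(@eqrXn2 _ 2) ?mulr_ge0 ?qnorm_ge0//.
rewrite exprMn !qnorm_sqr; apply/eqP.
case: a => [[[a1 a2] a3] a4]; case: b => [[[b1 b2] b3] b4] /=; ring.
Qed.

Lemma qnormZ (c : R) z : qnorm (c *: z) = `|c| * qnorm z.
Proof.
apply/eqP; rewrite -(@eqrXn2 _ 2) ?mulr_ge0 ?qnorm_ge0//.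
rewrite exprMn !qnorm_sqr real_normK ?num_real//; apply/eqP.
have e (u v : R) : u *: v = u * v by [].
case: z => [[[z1 z2] z3] z4]; rewrite /= !e; ring.
Qed.

Lemma qnormN z : qnorm (- z) = qnorm z.
Proof. by rewrite -scaleN1r qnormZ normrN normr1 mul1r. Qed.

Lemma qdot_le a b : `|qdot a b| <= qnorm a * qnorm b.
Proof.
rewrite -(@ler_pXn2r _ 2)// ?nnegrE ?mulr_ge0 ?qnorm_ge0//.
rewrite real_normK ?num_real// exprMn !qnorm_sqr.
case: a => [[[a1 a2] a3] a4]; case: b => [[[b1 b2] b3] b4].
rewrite /qdot -subr_ge0 [leRHS](_ : _ =
  (a1 * b2 - a2 * b1) ^+ 2 + (a1 * b3 - a3 * b1) ^+ 2 +
  (a1 * b4 - a4 * b1) ^+ 2 + (a2 * b3 - a3 * b2) ^+ 2 +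
  (a2 * b4 - a4 * b2) ^+ 2 + (a3 * b4 - a4 * b3) ^+ 2); last by ring.
by rewrite !addr_ge0 ?sqr_ge0.
Qed.

Lemma qnormD a b : qnorm (a + b) <= qnorm a + qnorm b.
Proof.
rewrite -(@ler_pXn2r _ 2)// ?nnegrE ?addr_ge0 ?qnorm_ge0//.
have := le_trans (ler_norm _) (qdot_le a b); rewrite sqrrD !qnorm_sqr -mulr_natr.
have -> : qdot (a + b) (a + b) = qdot a a + qdot a b * 2 + qdot b b.
  case: a => [[[a1 a2] a3] a4]; case: b => [[[b1 b2] b3] b4].
  by rewrite /qdot /=; ring.
by move=> ab; rewrite lerD2r lerD2l ler_pM2r.
Qed.

Lemma qmulDr a b w : qmul a (b + w) = qmul a b + qmul a w.
Proof.
case: a => [[[a1 a2] a3] a4]; case: b => [[[b1 b2] b3] b4].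
case: w => [[[w1 w2] w3] w4].
congr (_, _, _, _); rewrite /=; ring.
Qed.

Lemma qmulDl a b w : qmul (a + b) w = qmul a w + qmul b w.
Proof.
case: a => [[[a1 a2] a3] a4]; case: b => [[[b1 b2] b3] b4].
case: w => [[[w1 w2] w3] w4].
congr (_, _, _, _); rewrite /=; ring.
Qed.

Lemma qmulNl a w : qmul (- a) w = - qmul a w.
Proof.
case: a => [[[a1 a2] a3] a4]; case: w => [[[w1 w2] w3] w4].
congr (_, _, _, _); rewrite /=; ring.
Qed.

Lemma qmulA a b w : qmul a (qmul b w) = qmul (qmul a b) w.
Proof.
case: a => [[[a1 a2] a3] a4]; case: b => [[[b1 b2] b3] b4].
case: w => [[[w1 w2] w3] w4].
congr (_, _, _, _); rewrite /=; ring.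
Qed.

Lemma qmul1l w : qmul qone w = w.
Proof. case: w => [[[w1 w2] w3] w4]; congr (_, _, _, _); rewrite /=; ring. Qed.

Lemma imag_units_norm I : imag_units I -> qnorm I = 1.
Proof.
case: I => [[[a b] c] d] /imag_unitsP[-> h].
by rewrite /qnorm expr0n /= add0r h sqrtr1.
Qed.

Lemma imag_unitsN I : imag_units I -> imag_units (- I).
Proof.
case: I => [[[a b] c] d] /imag_unitsP[-> h].
by apply/imag_unitsP; rewrite oppr0 !sqrrN.
Qed.

Lemma slice_ptN I (x y : R) : slice_pt I (x, - y) = slice_pt (- I) (x, y).
Proof. by rewrite /slice_pt /= scaleNr scalerN. Qed.

Lemma qnorm_slice_pt I t : imag_units I ->
  qnorm (slice_pt I t) ^+ 2 = t.1 ^+ 2 + t.2 ^+ 2.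
Proof.
case: I => [[[a b] c] d] /imag_unitsP[-> h]; case: t => x y.
rewrite qnorm_sqr /slice_pt /=.
have e (u v : R) : u *: v = u * v by [].
rewrite !e !mulr0 !mulr1 !add0r addr0.
transitivity (x ^+ 2 + y ^+ 2 * (b ^+ 2 + c ^+ 2 + d ^+ 2)); first ring.
by rewrite h mulr1.
Qed.

(* Junk value: it is 0 on the real axis *)
Definition qdir z : quat R := (qIm_norm z)^-1 *: (z - qRe z *: qone).

Lemma qIm_norm_ge0 z : 0 <= qIm_norm z. Proof. exact: qnorm_ge0. Qed.

Lemma qdir_unit z : qIm_norm z != 0 -> imag_units (qdir z).
Proof.
rewrite /qdir; move: (qnorm_sqr (z - qRe z *: qone)); rewrite -/(qIm_norm z).
move: (qIm_norm z) => y; case: z => [[[a b] c] d] + y0.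
have e (u v : R) : u *: v = u * v by [].
rewrite /qRe /qone /= !e mulr1 !mulr0 !subr0 subrr => h.
have -> : y^-1 *: ((a, b, c, d) - a *: (1, 0, 0, 0)) =
    (0, y^-1 * b, y^-1 * c, y^-1 * d) :> quat R.
  by congr (_, _, _, _); rewrite /= !e; ring.
apply/imag_unitsP; split=> //.
rewrite !exprMn -!mulrDr (_ : b ^+ 2 + c ^+ 2 + d ^+ 2 = y ^+ 2).
  by rewrite exprVn mulVf// sqrf_eq0.
by rewrite h; ring.
Qed.

Lemma qdirE z : slice_pt (qdir z) (qRe z, qIm_norm z) = z.
Proof.
rewrite /slice_pt /qdir /=; have [y0|y0] := eqVneq (qIm_norm z) 0.
  by rewrite y0 scale0r addr0; have /subr0_eq := qnorm_eq0 y0.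
by rewrite scalerA divff// scale1r addrC subrK.
Qed.

Definition qi : quat R := (0, 1, 0, 0).

Lemma imag_units_qi : imag_units qi.
Proof. by apply/imag_unitsP; rewrite expr1n expr0n /= !addr0. Qed.

Lemma slice_ptP z : exists2 I, imag_units I &
  z = slice_pt I (qRe z, qIm_norm z).
Proof.
have [y0|y0] := eqVneq (qIm_norm z) 0.
  by exists qi; [exact: imag_units_qi|rewrite -{1}(qdirE z) y0 /slice_pt !scale0r].
by exists (qdir z); rewrite ?qdirE//; exact: qdir_unit.
Qed.

Lemma slice_pt_real I J (x : R) : slice_pt I (x, 0) = slice_pt J (x, 0).
Proof. by rewrite /slice_pt /= !scale0r. Qed.

Lemma slice_pt_re_im I t : imag_units I ->
  qRe (slice_pt I t) = t.1 /\ qIm_norm (slice_pt I t) = `|t.2|.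
Proof.
move=> uI; case: t => x y /=; have [y0|y0] := leP 0 y.
  by rewrite ger0_norm//; have [] := @slice_ptE _ I (x, y) uI y0.
have y1 : 0 <= (x, - y).2 by rewrite /= oppr_ge0 ltW.
have := slice_ptE (imag_unitsN uI) y1.
by rewrite slice_ptN opprK ltr0_norm.
Qed.

Lemma slice_ptB I t t' :
  slice_pt I t - slice_pt I t' = slice_pt I (t.1 - t'.1, t.2 - t'.2).
Proof. by rewrite /slice_pt opprD addrACA -!scalerBl. Qed.

(** A point of C_I below the real axis is a point of C_{-I} above it, and there it is no farther
    from the center because [qIm_norm z] >= 0. Hence membership depends on [qRe w] and [qIm_norm w]
    only. *)
Lemma symmetric_boxE z (r : R) : 0 < r -> symmetric_box z r =
  [set w | (qRe w - qRe z) ^+ 2 + (qIm_norm w - qIm_norm z) ^+ 2 < r ^+ 2].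
Proof.
move=> r0.
have nE I t t' : imag_units I -> (qnorm (slice_pt I t - slice_pt I t') < r) =
    ((t.1 - t'.1) ^+ 2 + (t.2 - t'.2) ^+ 2 < r ^+ 2).
  move=> uI; rewrite -(@ltr_pXn2r _ 2)// ?nnegrE ?qnorm_ge0 ?ltW//.
  by rewrite slice_ptB qnorm_slice_pt.
apply/seteqP; split=> [w [I uI [[t _ <-]]]|w /= h].
  rewrite (nE I t _ uI) => h; have [e1 e2] := slice_pt_re_im t uI.
  rewrite /mkset e1 e2.
  apply: le_lt_trans h; rewrite lerD2l -subr_ge0.
  have -> : (t.2 - qIm_norm z) ^+ 2 - (`|t.2| - qIm_norm z) ^+ 2 =
    2 * (qIm_norm z * (`|t.2| - t.2)).
    have := real_normK (num_real t.2); move: `|_| => u u2.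
    by apply/eqP; rewrite -subr_eq0; apply/eqP; ring: u2.
  by rewrite !mulr_ge0 ?qIm_norm_ge0// subr_ge0 ler_norm.
have [I uI wE] := slice_ptP w; exists I => //; split.
  by exists (qRe w, qIm_norm w).
by rewrite {1}wE (nE I _ _ uI).
Qed.

Lemma symmetric_boxP z w (r : R) : 0 < r -> symmetric_box z r w <->
  (qRe w - qRe z) ^+ 2 + (qIm_norm w - qIm_norm z) ^+ 2 < r ^+ 2.
Proof. by move=> r0; rewrite symmetric_boxE. Qed.

Lemma continuous_coords : [/\ continuous (fun z : quat R => z.1.1.1),
  continuous (fun z : quat R => z.1.1.2), continuous (fun z : quat R => z.1.2) &
  continuous (fun z : quat R => z.2)].
Proof.
have f1 (T U : topologicalType) : continuous (@fst T U).
  by move=> ?; exact: cvg_fst.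
have f2 (T U : topologicalType) : continuous (@snd T U).
  by move=> ?; exact: cvg_snd.
have c1 : continuous (fun z : quat R => z.1) := f1 _ _.
have c11 : continuous (fun z : quat R => z.1.1).
  by move=> z; exact: (continuous_comp (c1 z) (f1 _ _ _)).
split=> z.
- exact: (continuous_comp (c11 z) (f1 _ _ _)).
- exact: (continuous_comp (c11 z) (f2 _ _ _)).
- exact: (continuous_comp (c1 z) (f2 _ _ _)).
- exact: f2.
Qed.

Lemma continuous_qdot a : continuous (qdot a).
Proof.
have [k1 k2 k3 k4] := continuous_coords; case: a => [[[a1 a2] a3] a4].
rewrite (_ : qdot _ = fun z => a1 * z.1.1.1 + a2 * z.1.1.2 + a3 * z.1.2 + a4 * z.2).
  move=> z; apply: cvgD; last by apply: cvgM; [exact: cvg_cst|exact: k4].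
  apply: cvgD; last by apply: cvgM; [exact: cvg_cst|exact: k3].
  apply: cvgD; last by apply: cvgM; [exact: cvg_cst|exact: k2].
  by apply: cvgM; [exact: cvg_cst|exact: k1].
by apply/funext => -[[[? ?] ?] ?].
Qed.

Lemma continuous_sqrt_comp (T : topologicalType) (g : T -> R) :
  continuous g -> continuous (fun x => Num.sqrt (g x)).
Proof. by move=> cg x; exact: (continuous_comp (cg x) (@sqrt_continuous R _)). Qed.

Lemma continuous_qRe : continuous (@qRe R).
Proof. by have [] := continuous_coords. Qed.

Lemma continuous_qnorm : continuous (@qnorm R).
Proof.
have [k1 k2 k3 k4] := continuous_coords.
rewrite (_ : @qnorm R = fun z => Num.sqrt (z.1.1.1 * z.1.1.1 +
  z.1.1.2 * z.1.1.2 + z.1.2 * z.1.2 + z.2 * z.2)).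
  apply: continuous_sqrt_comp => z.
  apply: cvgD; last by apply: cvgM; exact: k4.
  apply: cvgD; last by apply: cvgM; exact: k3.
  by apply: cvgD; apply: cvgM; [exact: k1|exact: k1|exact: k2|exact: k2].
by apply/funext => -[[[? ?] ?] ?].
Qed.

Lemma qIm_normE z :
  qIm_norm z = Num.sqrt (z.1.1.2 * z.1.1.2 + z.1.2 * z.1.2 + z.2 * z.2).
Proof.
case: z => [[[a b] c] d]; rewrite /qIm_norm /qRe /qone /=.
have e (u v : R) : u *: v = u * v by [].
rewrite !e mulr1 !mulr0 !subr0 subrr; congr Num.sqrt; ring.
Qed.

Lemma continuous_qIm_norm : continuous (@qIm_norm R).
Proof.
have [_ k2 k3 k4] := continuous_coords.
rewrite (_ : @qIm_norm R = fun z => Num.sqrt (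
  z.1.1.2 * z.1.1.2 + z.1.2 * z.1.2 + z.2 * z.2)).
  apply: continuous_sqrt_comp => z.
  apply: cvgD; last by apply: cvgM; exact: k4.
  by apply: cvgD; apply: cvgM; [exact: k2|exact: k2|exact: k3|exact: k3].
by apply/funext => z; exact: qIm_normE.
Qed.

Lemma measurable_symmetric_box z (r : R) : 0 < r -> measurable (symmetric_box z r).
Proof.
move=> r0; rewrite symmetric_boxE//; apply: open_quat_measurable.
have h : continuous (fun w : quat R =>
    (qRe w - qRe z) * (qRe w - qRe z) +
    (qIm_norm w - qIm_norm z) * (qIm_norm w - qIm_norm z)).
  move=> w; apply: cvgD; apply: cvgM; (apply: cvgB; last exact: cvg_cst);
    try exact: continuous_qRe; exact: continuous_qIm_norm.
by move/continuousP : h => /(_ _ (@open_lt _ (r ^+ 2))).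
Qed.

End quaternion_algebra.

(** * Slice regular functions on a slice *)

Section slice_regular_functions.
Context {R : realType}.
Local Notation area := (@area R).
Implicit Types (a b z I J : quat R) (t w : R * R).

Lemma qdotDr a z (w : quat R) : qdot a (z + w) = qdot a z + qdot a w.
Proof.
case: a => [[[a1 a2] a3] a4]; case: z => [[[z1 z2] z3] z4].
case: w => [[[w1 w2] w3] w4]; rewrite /qdot /=; ring.
Qed.

Lemma qdotZr a (c : R) z : qdot a (c *: z) = c * qdot a z.
Proof.
have e (u v : R) : u *: v = u * v by [].
case: a => [[[a1 a2] a3] a4]; case: z => [[[z1 z2] z3] z4].
rewrite /= !e; ring.
Qed.

Lemma qdotNr a z : qdot a (- z) = - qdot a z.
Proof. by rewrite -scaleN1r qdotZr mulN1r. Qed.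

Lemma qdotBr a z (w : quat R) : qdot a (z - w) = qdot a z - qdot a w.
Proof. by rewrite qdotDr qdotNr. Qed.

Lemma qdotC a z : qdot a z = qdot z a.
Proof.
case: a => [[[a1 a2] a3] a4]; case: z => [[[z1 z2] z3] z4].
rewrite /qdot; ring.
Qed.

Lemma qdot_mull J a z : imag_units J -> qdot a (qmul J z) = - qdot (qmul J a) z.
Proof.
case: J => [[[x b] c] d] /imag_unitsP[-> _].
case: a => [[[a1 a2] a3] a4]; case: z => [[[z1 z2] z3] z4].
rewrite /qdot /=; ring.
Qed.

Lemma qmul_slice_pt J t (w : quat R) : qmul (slice_pt J t) w = t.1 *: w + t.2 *: qmul J w.
Proof.
have e (u v : R) : u *: v = u * v by [].
case: J => [[[x b] c] d]; case: w => [[[w1 w2] w3] w4]; case: t => t1 t2.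
rewrite /slice_pt /qone /=; congr (_, _, _, _); rewrite /= !e; ring.
Qed.

Lemma qdot_slice_ptl J t a z : qdot (qmul (slice_pt J t) a) z =
  t.1 * qdot a z + t.2 * qdot (qmul J a) z.
Proof. by rewrite qmul_slice_pt qdotC qdotDr !qdotZr !(qdotC z). Qed.

Lemma qdotNl a z : qdot (- a) z = - qdot a z.
Proof. by rewrite qdotC qdotNr qdotC. Qed.

Lemma qmulJJ J z : imag_units J -> qmul J (qmul J z) = - z.
Proof. by move=> uJ; rewrite qmulA uJ qmulNl qmul1l. Qed.

Lemma continuous_qdotP (T : topologicalType) (g : T -> quat R) :
  (forall a, continuous (fun x => qdot a (g x))) -> continuous g.
Proof.
move=> H.
rewrite (_ : g = fun x => (qdot (1, 0, 0, 0) (g x), qdot (0, 1, 0, 0) (g x),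
    qdot (0, 0, 1, 0) (g x), qdot (0, 0, 0, 1) (g x))).
  by do 3 (apply: continuous_pair; last exact: H); exact: H.
apply/funext => x; case: (g x) => [[[z1 z2] z3] z4].
rewrite /qdot; congr (_, _, _, _); ring.
Qed.

Lemma C1_partials_qdot a (g : R * R -> quat R) : C1 g ->
  C1_partials (fun t => qdot a (g t))
    (fun t => qdot a ('D_((1, 0) : R * R) g t))
    (fun t => qdot a ('D_((0, 1) : R * R) g t)).
Proof.
move=> H; have [d1 c1] := H _ (or_introl erefl).
have [d2 c2] := H _ (or_intror erefl).
have e (u v : R) : u *: v = u * v by [].
have key t v (F : R -> R) (x : R) : F x = qdot a (g t) ->
    (forall h : R, F (h *: (1 : R) + x) = qdot a (g (h *: v + t))) ->
    derivable g t v -> is_derive x (1 : R) F (qdot a ('D_v g t)).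
  move=> F0 Fh dg; apply: is_derive_cvg.
  have E : (fun h : R => h^-1 *: (F (h *: (1 : R) + x) - F x)) =
     qdot a \o (fun h : R => h^-1 *: ((g \o shift t) (h *: v) - g t)).
    by apply/funext => h; rewrite /= qdotZr qdotBr Fh F0.
  by rewrite E; apply: (cvg_comp _ _ dg); exact: continuous_qdot.
split.
- move=> x y; apply: (key (x, y)) => // h.
  by congr (qdot a (g (_, _))); rewrite /= scaler0 add0r.
- move=> x y; apply: (key (x, y)) => // h.
  by congr (qdot a (g (_, _))); rewrite /= scaler0 add0r.
- by move=> t; exact: (continuous_comp (c1 t) (@continuous_qdot R a _)).
- by move=> t; exact: (continuous_comp (c2 t) (@continuous_qdot R a _)).
Qed.

(** For b = J a these are the components of f on C_J along a and along J a: left multiplication by J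
    is skew, and J^2 = -1. *)
Lemma qdot_conjugate_pair a b (f0 f0x f0y f1 f1x f1y : R * R -> quat R) :
  (forall a, C1_partials (fun t => qdot a (f0 t)) (fun t => qdot a (f0x t))
    (fun t => qdot a (f0y t))) ->
  (forall a, C1_partials (fun t => qdot a (f1 t)) (fun t => qdot a (f1x t))
    (fun t => qdot a (f1y t))) ->
  (forall t, f0x t - f1y t = 0 /\ f0y t + f1x t = 0) ->
  conjugate_pair (fun t => qdot a (f0 t) - qdot b (f1 t))
    (fun t => qdot b (f0 t) + qdot a (f1 t)).
Proof.
move=> H0 H1 CR.
have e1 t : f1y t = f0x t.
  by have [h _] := CR t; rewrite -(subrK (f1y t) (f0x t)) h add0r.
have e2 t : f1x t = - f0y t.
  by have [_ h] := CR t; rewrite -(addKr (f0y t) (f1x t)) h addr0.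
exists (fun t => qdot a (f0x t) - qdot b (f1x t)).
exists (fun t => qdot a (f0y t) - qdot b (f1y t)).
split; first exact: C1_partialsD (H0 a) (C1_partialsN (H1 b)).
apply: eq_C1_partials (C1_partialsD (H0 b) (H1 a)) _ _ _ => t //.
  by rewrite e1 e2 qdotNr opprB.
by rewrite e1 e2 qdotNr opprK addrC.
Qed.

Lemma continuous_gaussian (c : R) :
  continuous (fun t => expR (c * (t.1 ^+ 2 + t.2 ^+ 2))).
Proof.
have H1 := C1_partials_affine (R:=R) 1 0 0; have H2 := C1_partials_affine (R:=R) 0 1 0.
have H := C1_partials_comp (@is_derive_expR R) (@continuous_expR R)
  (C1_partialsZ c (C1_partialsD (C1_partialsM H1 H1) (C1_partialsM H2 H2))).
apply: C1_partials_continuous (eq_C1_partials H _ (frefl _) (frefl _)) => w.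
by congr expR; ring.
Qed.

Definition slice_weight (alpha : R) (f : quat R -> quat R) J t : R :=
  expR (- (alpha / 2) * (t.1 ^+ 2 + t.2 ^+ 2)) * qnorm (f (slice_pt J t)).

Lemma slice_weight_ge0 alpha f J t : 0 <= slice_weight alpha f J t.
Proof. by rewrite mulr_ge0 ?expR_ge0 ?qnorm_ge0. Qed.

Lemma gauss_pow_slice alpha p f J t : imag_units J ->
  gauss_pow alpha p f (slice_pt J t) = slice_weight alpha f J t `^ p.
Proof.
move=> uJ; rewrite /gauss_pow qnormZ qnorm_slice_pt//.
by rewrite ger0_norm ?expR_ge0.
Qed.

Section slice_regular.
Variables (f : quat R -> quat R) (f0 f1 : R * R -> quat R).
Hypotheses (ff : slice_components f f0 f1) (C0 : C1 f0) (C1' : C1 f1).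
Hypothesis CR : forall t,
  'D_((1, 0) : R * R) f0 t - 'D_((0, 1) : R * R) f1 t = 0 /\
  'D_((0, 1) : R * R) f0 t + 'D_((1, 0) : R * R) f1 t = 0.

Lemma slice_conjugate_pair a b :
  conjugate_pair (fun t => qdot a (f0 t) - qdot b (f1 t))
    (fun t => qdot b (f0 t) + qdot a (f1 t)).
Proof.
exact: (qdot_conjugate_pair _ _ (fun a => C1_partials_qdot a C0)
  (fun a => C1_partials_qdot a C1') CR).
Qed.

Lemma qdot_slice a J t : imag_units J ->
  qdot a (f (slice_pt J t)) = qdot a (f0 t) - qdot (qmul J a) (f1 t).
Proof. by case: ff => _ _ fE uJ; rewrite fE// qdotDr qdot_mull. Qed.

Lemma continuous_slice J : imag_units J -> continuous (fun t => f (slice_pt J t)).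
Proof.
move=> uJ; apply: continuous_qdotP => a.
have [u [v [H _]]] := slice_conjugate_pair a (qmul J a).
rewrite (_ : (fun t => _) = (fun t => qdot a (f0 t) - qdot (qmul J a) (f1 t))).
  exact: C1_partials_continuous H.
by apply/funext => t; exact: qdot_slice.
Qed.

Lemma continuous_slice_weight alpha J : imag_units J ->
  continuous (slice_weight alpha f J).
Proof.
move=> uJ t; apply: cvgM; last first.
  exact: (continuous_comp (continuous_slice uJ (x:=t)) (@continuous_qnorm R _)).
exact: continuous_gaussian.
Qed.

Lemma slice_weight_submean alpha J (c d l : R) : 0 < alpha -> imag_units J ->
  0 < l -> l <= 1 ->
  slice_weight alpha f J (c, d) * l ^+ 2 <=
    4 * expR alpha * \int[area]_(w in box c d l) slice_weight alpha f J w.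
Proof.
move=> alpha0 uJ l0 l1.
have I0 : 0 <= \int[area]_(w in box c d l) slice_weight alpha f J w.
  by apply: Rintegral_ge0 => w _; exact: slice_weight_ge0.
have e4 : 0 <= 4 * expR alpha by rewrite mulr_ge0 ?expR_ge0.
set F0 := f (slice_pt J (c, d)).
have [F00|F0n] := eqVneq (qnorm F0) 0.
  by rewrite /slice_weight -/F0 F00 mulr0 mul0r mulr_ge0.
(* The component of f along its own direction at the center equals |f| there and is at most |f|
   elsewhere. *)
pose a := (qnorm F0)^-1 *: F0.
have na : qnorm a = 1.
  by rewrite qnormZ ger0_norm ?invr_ge0 ?qnorm_ge0// mulVf.
have aF0 : qdot a F0 = qnorm F0.
  by rewrite qdotC qdotZr -qnorm_sqr expr2 mulKf.
have uF := slice_conjugate_pair a (qmul J a).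
(* With center c = (c, d), s(w) - alpha |c|^2 / 2 = - alpha |w|^2 / 2 + alpha |w - c|^2 / 2. So e^s
   carries the Gaussian from c to w up to e^(alpha |w - c|^2 / 2) <= e^alpha, as |w - c|^2 <= 2.
   [tau] is the conjugate of s, and both vanish at c. *)
pose s (w : R * R) := - (alpha * c) * w.1 + - (alpha * d) * w.2 + alpha * (c ^+ 2 + d ^+ 2).
pose tau (w : R * R) := - - (alpha * d) * w.1 + - (alpha * c) * w.2 + 0.
have H := conjugate_pairM uF (conjugate_pair_exp (- (alpha * c)) (- (alpha * d))
  (alpha * (c ^+ 2 + d ^+ 2)) 0).
pose U (w : R * R) := (qdot a (f0 w) - qdot (qmul J a) (f1 w)) * (expR (s w) * cos (tau w)) -
  (qdot (qmul J a) (f0 w) + qdot a (f1 w)) * (expR (s w) * sin (tau w)).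
have HU : U (c, d) * l ^+ 2 <= 4 * \int[area]_(w in box c d l) `|U w|.
  exact: (@conjugate_pair_submean _ U _ c d l l0 H).
(* The phase of the exponential only rotates a inside the plane of a and J a, so it does not enlarge
   |U|. *)
have UE (w : R * R) : U w = expR (s w) * qdot (qmul (slice_pt J (cos (tau w), - sin (tau w))) a)
    (f (slice_pt J w)).
  by rewrite qdot_slice_ptl !qdot_slice// qmulJJ// qdotNl /U /=; ring.
have nU (w : R * R) : `|U w| <= expR (s w) * qnorm (f (slice_pt J w)).
  rewrite UE normrM ger0_norm ?expR_ge0// ler_wpM2l ?expR_ge0//.
  apply: le_trans (qdot_le _ _) _; rewrite qnormM na mulr1.
  suff -> : qnorm (slice_pt J (cos (tau w), - sin (tau w))) = 1 by rewrite mul1r.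
  apply/eqP; rewrite -(@eqrXn2 _ 2) ?qnorm_ge0// qnorm_slice_pt//= sqrrN expr1n.
  by rewrite cos2Dsin2.
have U0 : U (c, d) = qnorm F0.
  rewrite UE -/F0.
  have -> : s (c, d) = 0 by rewrite /s /=; ring.
  have -> : tau (c, d) = 0 by rewrite /tau /=; ring.
  by rewrite expR0 cos0 sin0 oppr0 mul1r qdot_slice_ptl mul1r mul0r addr0.
have cU : continuous (fun w => `|U w|).
  move=> w; apply: cvg_norm; move: H => [? [? [H _]]].
  exact: C1_partials_continuous H w.
have cw := continuous_slice_weight (alpha:=alpha) uJ.
rewrite {1}/slice_weight -/F0 -U0 -mulrA.
apply: le_trans (ler_wpM2l (expR_ge0 _) HU) _.
rewrite mulrCA -mulrA ler_pM2l//.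
rewrite -!RintegralZl//; try exact: measurable_box.
- apply: le_Rintegral; first exact: measurable_box.
  + apply: integrable_box (ltW l0) _ => w.
    by apply: cvgM; [exact: cvg_cst|exact: cU].
  + apply: integrable_box (ltW l0) _ => w.
    by apply: cvgM; [exact: cvg_cst|exact: cw].
  + move=> w /boxP[w1 w2]; apply: le_trans (ler_wpM2l (expR_ge0 _) (nU w)) _.
    rewrite /slice_weight !mulrA -!expRD ler_wpM2r ?qnorm_ge0// ler_expR /s /=.
    have sq (x : R) : `|x| <= l -> x ^+ 2 <= 1.
      move=> xl; rewrite -[x ^+ 2]real_normK ?num_real//.
      by rewrite exprn_ile1 ?(le_trans xl).
    have h : alpha / 2 * ((w.1 - c) ^+ 2 + (w.2 - d) ^+ 2) <= alpha / 2 * 2.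
      rewrite ler_pM2l ?divr_gt0//; move: (sq _ w1) (sq _ w2); lra.
    rewrite -subr_ge0 (_ : _ - _ = alpha / 2 * 2 -
      alpha / 2 * ((w.1 - c) ^+ 2 + (w.2 - d) ^+ 2)) ?subr_ge0//.
    by field.
- exact: integrable_box (ltW l0) cU.
- exact: integrable_box (ltW l0) cw.
Qed.

(** Subtracting two slices eliminates f0: (J - J') f1 = f(x + yJ) - f(x + yJ'), and |J - J'| >= 2k
    by the last coordinates. Then f0 = f(x + yJ) - J f1 is bounded too, and with it every other
    slice. *)
Lemma slice_weight_cap alpha (k : R) I J J' t : 0 < k ->
  imag_units I -> imag_units J -> imag_units J' -> k <= J.2 -> J'.2 <= - k ->
  slice_weight alpha f I t <=
    (1 + k^-1) * (slice_weight alpha f J t + slice_weight alpha f J' t).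
Proof.
move=> k0 uI uJ uJ' kJ kJ'; rewrite /slice_weight -mulrDr mulrCA.
rewrite ler_wpM2l ?expR_ge0//; case: ff => _ _ fE.
set A := qnorm (f (slice_pt J t)); set A' := qnorm (f (slice_pt J' t)).
have f1A : qnorm (f1 t) * (2 * k) <= A + A'.
  apply: (@le_trans _ _ (qnorm (qmul (J - J') (f1 t)))).
    rewrite qnormM mulrC ler_wpM2r ?qnorm_ge0//.
    apply: (@le_trans _ _ (qdot (0, 0, 0, 1) (J - J'))).
      have -> : qdot (0, 0, 0, 1) (J - J') = J.2 - J'.2.
        by case: (J) => [[[? ?] ?] ?]; case: (J') => [[[? ?] ?] ?] /=; ring.
      by move: kJ kJ'; lra.
    apply: le_trans (ler_norm _) _; apply: le_trans (qdot_le _ _) _.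
    by rewrite /qnorm !expr0n expr1n /= !add0r sqrtr1 mul1r.
  have -> : qmul (J - J') (f1 t) = f (slice_pt J t) - f (slice_pt J' t).
    by rewrite !fE// qmulDl qmulNl opprD addrACA subrr add0r.
  by apply: le_trans (qnormD _ _) _; rewrite qnormN.
have f0A : qnorm (f0 t) <= A + qnorm (f1 t).
  have -> : f0 t = f (slice_pt J t) - qmul J (f1 t) by rewrite fE// addrK.
  by apply: le_trans (qnormD _ _) _; rewrite qnormN qnormM (imag_units_norm uJ) mul1r.
have fIA : qnorm (f (slice_pt I t)) <= A + 2 * qnorm (f1 t).
  rewrite fE//; apply: le_trans (qnormD _ _) _.
  by rewrite qnormM (imag_units_norm uI) mul1r; move: f0A; lra.
apply: (le_trans fIA).
have f1k : 2 * qnorm (f1 t) <= k^-1 * (A + A').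
  by rewrite ler_pdivlMl// (le_trans _ f1A)// le_eqVlt; apply/orP; left; apply/eqP; ring.
by rewrite mulrDl mul1r; move: f1k (qnorm_ge0 (f (slice_pt J' t))); rewrite -/A'; lra.
Qed.

(** On the real axis [qdir] is 0 and not a unit, but f1 vanishes there by oddness. One formula thus
    covers all of H, and the measurability of f is read off from it. *)
Lemma slice_value z :
  f z = f0 (qRe z, qIm_norm z) + qmul (qdir z) (f1 (qRe z, qIm_norm z)).
Proof.
have [y0|y0] := eqVneq (qIm_norm z) 0; last first.
  by case: ff => _ _ fE; rewrite -{1}(qdirE z) fE//; exact: qdir_unit.
case: ff => _ f1N fE.
have f10 : f1 (qRe z, 0) = 0.
  have := f1N (qRe z) 0; rewrite oppr0.
  case: (f1 _) => [[[a1 a2] a3] a4] [e1 e2 e3 e4].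
  have h (x : R) : x = - x -> x = 0 by lra.
  by rewrite (h _ e1) (h _ e2) (h _ e3) (h _ e4).
rewrite y0 -{1}(qdirE z) y0 (slice_pt_real _ qi) fE; last exact: imag_units_qi.
rewrite f10; congr (_ + _); case: (qdir z) => [[[b1 b2] b3] b4].
by congr (_, _, _, _); rewrite /=; ring.
Qed.

Lemma measurable_gauss_pow alpha p : measurable_fun setT (gauss_pow alpha p f).
Proof.
have cRe : continuous (fun z : quat R => (qRe z, qIm_norm z)).
  by apply: continuous_pair; [exact: continuous_qRe|exact: continuous_qIm_norm].
have mf0 a : measurable_fun setT (fun z : quat R => qdot a (f0 (qRe z, qIm_norm z))).
  apply: continuous_quat_measurable => z.
  have c0 := C1_partials_continuous (C1_partials_qdot a C0).
  exact: (continuous_comp (cRe z) (c0 _)).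
have mf1 a : measurable_fun setT (fun z : quat R => qdot a (f1 (qRe z, qIm_norm z))).
  apply: continuous_quat_measurable => z.
  have c1 := C1_partials_continuous (C1_partials_qdot a C1').
  exact: (continuous_comp (cRe z) (c1 _)).
have [k1 k2 k3 k4] := @continuous_coords R.
have mdir (F : quat R -> R) : continuous F ->
    measurable_fun setT (fun z => (qIm_norm z)^-1 * F z).
  move=> cF; apply: measurable_funM; last exact: continuous_quat_measurable.
  (* The power and the inverse also agree at 0, where both are 0. *)
  rewrite (_ : (fun z => _) = (fun y : R => y `^ (-1)) \o @qIm_norm R).
    apply: measurableT_comp; first exact: measurable_powR.
    exact: continuous_quat_measurable (@continuous_qIm_norm R).
  by apply/funext => z /=; rewrite powR_inv1 ?qIm_norm_ge0.
have mf a : measurable_fun setT (fun z => qdot a (f z)).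
  rewrite (_ : (fun z => _) = (fun z => qdot a (f0 (qRe z, qIm_norm z)) -
    ((qIm_norm z)^-1 * z.1.1.2 * qdot (qmul qi a) (f1 (qRe z, qIm_norm z)) +
     (qIm_norm z)^-1 * z.1.2 * qdot (qmul (0, 0, 1, 0) a) (f1 (qRe z, qIm_norm z)) +
     (qIm_norm z)^-1 * z.2 * qdot (qmul (0, 0, 0, 1) a) (f1 (qRe z, qIm_norm z))))).
    apply: measurable_funB; first exact: mf0.
    by do 2?apply: measurable_funD; apply: measurable_funM; (try exact: mf1); exact: mdir.
  apply/funext => z; rewrite slice_value qdotDr; congr (_ + _).
  rewrite /qdir; move: (qIm_norm z)^-1 (f1 _) => c.
  have e (u v : R) : u *: v = u * v by [].
  case: z => [[[z1 z2] z3] z4] [[[w1 w2] w3] w4]; case: a => [[[a1 a2] a3] a4].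
  rewrite /qRe /qone /qi /= !e; ring.
have mff : measurable_fun setT f.
  rewrite (_ : f = fun x => (qdot (1, 0, 0, 0) (f x), qdot (0, 1, 0, 0) (f x),
    qdot (0, 0, 1, 0) (f x), qdot (0, 0, 0, 1) (f x))).
    by do 3 (apply: measurable_fun_pair; last exact: mf); exact: mf.
  apply/funext => x; case: (f x) => [[[z1 z2] z3] z4].
  rewrite /qdot; congr (_, _, _, _); ring.
rewrite (_ : gauss_pow alpha p f = (fun y : R => y `^ p) \o
    (fun z => expR (- (alpha / 2) * qnorm z ^+ 2) * qnorm (f z))).
  apply: measurableT_comp; first exact: measurable_powR.
  apply: measurable_funM.
    apply: continuous_quat_measurable => z.
    apply: (@continuous_comp _ _ _ (fun z => - (alpha / 2) * qnorm z ^+ 2) expR).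
      apply: cvgM; first exact: cvg_cst.
      by apply: cvgM; exact: continuous_qnorm.
    exact: continuous_expR.
  apply: measurableT_comp mff.
  exact: continuous_quat_measurable (@continuous_qnorm R).
by apply/funext => z; rewrite /gauss_pow qnormZ ger0_norm ?expR_ge0.
Qed.

End slice_regular.
End slice_regular_functions.

(** * Integrals over the slices and over the sphere *)

Section sigma_finite_copy.
Context {R : realType} d (T : measurableType d).
Context (mu : {measure set T -> \bar R}).

(** An alias indexed by the proof, so that sigma-finiteness established in the middle of an argument
    reaches Tonelli's theorem as a structure on the measure. *)
Definition sigma_finite_copy of sigma_finite setT mu : set T -> \bar R := mu.

Context (h : sigma_finite setT mu).

HB.instance Definition _ := Measure.on (sigma_finite_copy h).

HB.instance Definition _ :=
  Measure_isSigmaFinite.Build _ _ _ (sigma_finite_copy h) h.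

End sigma_finite_copy.

(** * Local bounds by two slices, and their integration against mu *)

Section carleson_of_boxes.
Context {R : realType}.
Local Notation area := (@area R).
Local Notation mR := (measurableTypeR R).
Implicit Types (alpha p : R) (I J z : quat R) (t w : R * R).

Lemma powR_addr_le (p x y : R) : 0 < p -> 0 <= x -> 0 <= y ->
  (x + y) `^ p <= 2 `^ p * (x `^ p + y `^ p).
Proof.
move=> p0 x0 y0; wlog xy : x y x0 y0 / x <= y => [wlg|].
  have [xy|/ltW yx] := leP x y; first exact: wlg.
  by rewrite addrC [_ `^ p + _]addrC; exact: wlg.
apply: (@le_trans _ _ ((2 * y) `^ p)).
  by apply: ge0_ler_powR; rewrite ?nnegrE ?addr_ge0 ?mulr_ge0 ?(ltW p0)//; lra.
by rewrite powRM// ler_wpM2l ?powR_ge0// lerDr powR_ge0.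
Qed.

Lemma EFin_Rintegral_box (a b l : R) (h : R * R -> R) : 0 <= l -> continuous h ->
  (\int[area]_(w in box a b l) h w)%:E = (\int[area]_(w in box a b l) (h w)%:E)%E.
Proof.
move=> l0 ch; rewrite /Rintegral fineK//.
apply: integrable_fin_num; first exact: measurable_box.
exact: (integrable_box a b l0 ch).
Qed.

(** The absolute value keeps both slices in the half y >= 0, the one that the volume integrates
    over, even when w lies below the axis. *)
Definition two_slices alpha p f J J' w : R :=
  slice_weight alpha f J (w.1, `|w.2|) `^ p +
  slice_weight alpha f J' (w.1, `|w.2|) `^ p.

Lemma continuous_two_slices alpha p f J J' : 0 < p -> slice_regular f ->
  imag_units J -> imag_units J' -> continuous (two_slices alpha p f J J').
Proof.
move=> p0 [f0 [f1 [ff C0 C1' CR]]] uJ uJ'.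
have cn : continuous (fun w : R * R => (w.1, `|w.2|)).
  apply: continuous_pair; first by move=> w; exact: cvg_fst.
  by move=> w; apply: cvg_norm; exact: cvg_snd.
have key J0 : imag_units J0 ->
    continuous (fun w : R * R => slice_weight alpha f J0 (w.1, `|w.2|) `^ p).
  move=> u0; apply: continuous_powR_comp => // [w|w]; last exact: slice_weight_ge0.
  have cw := continuous_slice_weight ff C0 C1' CR (alpha:=alpha) u0.
  exact: (continuous_comp (cn w) (cw _)).
by move=> w; apply: cvgD; exact: key.
Qed.

Lemma two_slices_ge0 alpha p f J J' w : 0 <= two_slices alpha p f J J' w.
Proof. by rewrite addr_ge0 ?powR_ge0. Qed.

Lemma gauss_pow_box alpha p (k s : R) : 0 < alpha -> 0 < p -> 0 < k ->
  0 < s -> s <= 1 -> exists2 C : R, 0 < C &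
  forall f J J' z, slice_regular f -> imag_units J -> imag_units J' ->
  k <= J.2 -> J'.2 <= - k ->
  gauss_pow alpha p f z <= C *
    \int[area]_(w in box (qRe z) (qIm_norm z) s) two_slices alpha p f J J' w.
Proof.
move=> alpha0 p0 k0 s0 s1.
have C40 : 0 < 4 * expR alpha by rewrite mulr_gt0// expR_gt0.
have [C C0 HC] := submean_powR p0 C40.
pose K := (1 + k^-1) `^ p * 2 `^ p.
have K0 : 0 < K by rewrite mulr_gt0 ?powR_gt0// addr_gt0// invr_gt0.
have s20 : 0 < s ^+ 2 by exact: exprn_gt0.
exists (C * K / s ^+ 2); first by apply: divr_gt0 => //; exact: mulr_gt0.
move=> f J J' z rf uJ uJ' kJ kJ'.
have [f0 [f1 [ff C0' C1' CR]]] := rf.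
have [I uI zE] := slice_ptP z.
have cI := continuous_slice_weight ff C0' C1' CR (alpha:=alpha) uI.
rewrite {1}zE gauss_pow_slice//.
rewrite mulrAC ler_pdivlMr//.
apply: le_trans (HC _ _ _ _ s0 cI _ _) _.
- by move=> w; exact: slice_weight_ge0.
- move=> c d l l0 ls.
  exact: (slice_weight_submean ff C0' C1' CR) (le_trans ls s1).
rewrite -mulrA ler_pM2l//.
have mb := @measurable_box R (qRe z) (qIm_norm z) s.
have ch := continuous_two_slices (alpha:=alpha) p0 rf uJ uJ'.
have cp : continuous (fun w => slice_weight alpha f I w `^ p).
  apply: continuous_powR_comp => // w; exact: slice_weight_ge0.
rewrite -RintegralZl//; last exact: integrable_box (ltW s0) ch.
apply: le_Rintegral => //.
- exact: integrable_box (ltW s0) cp.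
- apply: integrable_box (ltW s0) _ => w.
  by apply: cvgM; [exact: cvg_cst|exact: ch].
move=> [x y] _.
(* Below the real axis, x + yI = x + |y|(-I). *)
have [I' uI' IE] : exists2 I', imag_units I' &
    slice_weight alpha f I (x, y) = slice_weight alpha f I' (x, `|y|).
  have [y0|y0] := leP 0 y.
    by exists I => //; rewrite ger0_norm.
  exists (- I); first exact: imag_unitsN.
  by rewrite /slice_weight /= ltr0_norm// slice_ptN opprK sqrrN.
have := slice_weight_cap ff alpha (x, `|y|) k0 uI' uJ uJ' kJ kJ'.
rewrite IE; set A := slice_weight _ _ J _; set A' := slice_weight _ _ J' _ => h.
have A0 : 0 <= A by exact: slice_weight_ge0.
have A0' : 0 <= A' by exact: slice_weight_ge0.
have k1 : 0 <= 1 + k^-1 by rewrite addr_ge0// invr_ge0 ltW.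
apply: (@le_trans _ _ (((1 + k^-1) * (A + A')) `^ p)).
  apply: ge0_ler_powR => //; rewrite ?nnegrE ?slice_weight_ge0 ?(ltW p0)//.
  by rewrite mulr_ge0// addr_ge0.
have -> : K * two_slices alpha p f J J' (x, y) =
  (1 + k^-1) `^ p * (2 `^ p * (A `^ p + A' `^ p)) by rewrite /K -mulrA.
rewrite (powRM _ k1 (addr_ge0 A0 A0')) ler_wpM2l ?powR_ge0//.
exact: powR_addr_le.
Qed.

(* Tonelli against mu x area: a point w of the plane is counted by
   mu {z | w in box z s}, and that set lies in a symmetric box. *)
Lemma integral_box_le (mu : {measure set (quat R) -> \bar R}) (r s C : R)
    (h : R * R -> R) : 0 < r -> 0 < s -> s <= r / 2 -> 0 < C ->
  continuous h -> (forall w, 0 <= h w) ->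
  (forall z, (mu (symmetric_box z r) <= C%:E)%E) ->
  (measurable_fun setT (fun z : quat R =>
     \int[area]_(w in box (qRe z) (qIm_norm z) s) (h w)%:E) /\
   \int[mu]_z \int[area]_(w in box (qRe z) (qIm_norm z) s) (h w)%:E <=
   C%:E * \int[area]_w (h w)%:E)%E.
Proof.
move=> r0 s0 sr C0 ch h0 muC.
have sfmu : sigma_finite setT mu.
  pose F (n : nat) : set (quat R) := if @unpickle (rat * rat)%type n is Some q
    then symmetric_box (slice_pt qi (ratr q.1, ratr q.2)) r else set0.
  exists F.
    apply/seteqP; split=> // z _.
    have [q1] := @rat_in_itvoo R (qRe z - r / 2) (qRe z + r / 2) ltac:(lra).
    rewrite in_itv /= => /andP[q1l q1u].
    (* Taken above [qIm_norm z], this rational is nonnegative and so is the [qIm_norm] of the center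
       it defines. *)
    have [q2] := @rat_in_itvoo R (qIm_norm z) (qIm_norm z + r / 2) ltac:(lra).
    rewrite in_itv /= => /andP[q2l q2u].
    have q20 : 0 <= (ratr q2 : R) := le_trans (qIm_norm_ge0 z) (ltW q2l).
    exists (pickle (q1, q2)); first by [].
    rewrite /F pickleK; apply/(symmetric_boxP _ _ r0).
    have [-> ->] := slice_pt_re_im (ratr q1, ratr q2) (@imag_units_qi R).
    rewrite [(_, _).2]/= [(_, _).1]/= ger0_norm//; clear -r0 q1l q1u q2l q2u.
    move: q1l q1u q2l q2u; move: (qRe z) (qIm_norm z) (ratr q1) (ratr q2).
    clear z q1 q2; move=> a b q1 q2 h1 h2 h3 h4; nra.
  move=> n; rewrite /F; case: (unpickle n) => [q|]; last by rewrite measure0.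
  split; first exact: measurable_symmetric_box.
  by apply: le_lt_trans (muC _) _; exact: ltry.
pose E := [set q : quat R * (mR * mR) |
  `|q.2.1 - qRe q.1| <= s /\ `|q.2.2 - qIm_norm q.1| <= s].
have mE : measurable E.
  have mm (F : quat R * (mR * mR) -> R) :
      measurable_fun setT F -> measurable [set q | `|F q| <= s].
    move=> mF; have mnF : measurable_fun setT (fun q => `|F q|).
      exact: measurableT_comp.
    have := mnF measurableT `]-oo, s]%classic (measurable_itv _).
    by rewrite setTI; congr measurable; apply/seteqP; split=> q; rewrite /= in_itv.
  have mRe := continuous_quat_measurable (@continuous_qRe R).
  have mIm := continuous_quat_measurable (@continuous_qIm_norm R).
  apply: (@measurableI _ _ [set q | `|q.2.1 - qRe q.1| <= s]
    [set q | `|q.2.2 - qIm_norm q.1| <= s]); apply: mm; apply: measurable_funB.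
  - exact: (measurableT_comp measurable_fst measurable_snd).
  - exact: (measurableT_comp mRe measurable_fst).
  - exact: (measurableT_comp measurable_snd measurable_snd).
  - exact: (measurableT_comp mIm measurable_fst).
pose k (q : quat R * (mR * mR)) : \bar R := (h q.2 * \1_E q)%:E.
have mk : measurable_fun setT k.
  apply/measurable_EFinP; apply: measurable_funM; last exact: measurable_indic.
  exact: (measurableT_comp (continuous_plane_measurable ch) measurable_snd).
have k0 q : (0 <= k q)%E by rewrite lee_fin mulr_ge0.
have := @fubini_tonelli _ _ _ _ R (sigma_finite_copy sfmu) area k mk k0.
have kE : (fun z => \int[area]_w k (z, w))%E =
    (fun z => \int[area]_(w in box (qRe z) (qIm_norm z) s) (h w)%:E)%E.
  apply/funext => z; rewrite [RHS]integral_mkcond; apply: eq_integral => w _.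
  rewrite patchE /k /= indicE.
  have -> : ((z, w) \in E) = (w \in box (qRe z) (qIm_norm z) s).
    by apply/idP/idP; rewrite !inE => /boxP.
  by case: ifP => _; rewrite ?mulr1 ?mulr0.
rewrite kE => fE; split.
  rewrite -kE.
  exact: (@measurable_fun_fubini_tonelli_F _ _ _ _ R area k mk k0).
rewrite fE.
have mh : measurable_fun setT (h : mR * mR -> R) := continuous_plane_measurable ch.
have mhE : measurable_fun setT (fun w : mR * mR => (h w)%:E).
  exact/measurable_EFinP.
have hE0 w : setT w -> (0 <= (h w)%:E)%E by rewrite lee_fin.
have CE0 : (0 <= C%:E)%E by rewrite lee_fin ltW.
rewrite -(ge0_integralZl area measurableT mhE hE0 CE0).
apply: ge0_le_integral => //.
- by move=> w _; apply: integral_ge0.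
- exact: (@measurable_fun_fubini_tonelli_G _ _ _ _ R (sigma_finite_copy sfmu) k mk k0).
- by apply: measurable_funeM.
move=> [x y] _.
have mEy : measurable (ysection E (x, y)) by exact: measurable_ysection.
rewrite (_ : (fun z => k (z, (x, y))) =
    (fun z => (h (x, y))%:E * (\1_(ysection E (x, y)) z)%:E)%E); last first.
  apply/funext => z; rewrite /k -EFinM !indicE /=; congr (_ * _%:R)%:E.
  by rewrite mem_ysection.
have mi : measurable_fun setT (fun z => (\1_(ysection E (x, y)) z)%:E : \bar R).
  by apply/measurable_EFinP; exact: measurable_indic.
rewrite ge0_integralZl ?lee_fin//.
rewrite integral_indic// setIT muleC lee_wpmul2r ?lee_fin//.
(* Replacing y by |y| brings it no farther from [qIm_norm z] >= 0; the squared distance is then at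
   most 2 s^2 <= r^2 / 2 < r^2. *)
apply: le_trans (muC (slice_pt qi (x, `|y|))).
apply: le_measure; rewrite ?inE//; first exact: measurable_symmetric_box.
move=> z; rewrite /ysection /= inE => -[/= zx zy]; apply/(symmetric_boxP _ _ r0).
have [-> ->] := slice_pt_re_im (x, `|y|) (@imag_units_qi R).
rewrite [(_, _).2]/= [(_, _).1]/= normr_id.
have zy' : `|qIm_norm z - `|y| | <= s.
  apply: le_trans zy; rewrite -{1}[qIm_norm z]ger0_norm ?qIm_norm_ge0// distrC.
  exact: ler_dist_dist.
have sq (u : R) : `|u| <= s -> u ^+ 2 <= s ^+ 2.
  by move=> us; rewrite -[u ^+ 2]real_normK ?num_real// lerXn2r ?nnegrE ?(ltW s0).
have := sq _ zy'; have := sq (qRe z - x); rewrite distrC => /(_ zx) h1 h2.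
apply: le_lt_trans (lerD h1 h2) _; clear -r0 s0 sr; nra.
Qed.

End carleson_of_boxes.

(** * Integration over the volume in slice coordinates, and the spherical caps *)

Section volume_integrals.
Context {R : realType}.
Local Notation area := (@area R).
Local Notation mR := (measurableTypeR R).
Local Notation sigma := (@sphere_measure R).
Implicit Types (I J z : quat R) (t w : R * R).
Local Open Scope ereal_scope.

Lemma area_rectangle (a b c d : R) : (a <= b)%R -> (c <= d)%R ->
  area (`[a, b] `*` `[c, d]) = ((b - a) * (d - c))%:E.
Proof.
move=> ab cd; rewrite /area product_measure1E; [|exact: measurable_itv..].
have E (u v : R) : (u <= v)%R -> @lebesgue_measure R `[u, v] = (v - u)%:E.
  move=> uv; rewrite lebesgue_measure_itv /= lte_fin.
  by case: ltP => [_|vu]; rewrite ?EFinB//; congr (_%:E); move: uv vu; lra.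
by rewrite EFinM; congr (_ * _); exact: E.
Qed.

Lemma sphere_measure_fin_num : fin_num_fun sigma.
Proof.
move=> A mA; rewrite ge0_fin_numE ?measure_ge0//.
have pi0 : (0 <= pi :> R)%R := pi_ge0 R.
have md : measurable (sph_dom `&` @sph_param R @^-1` A).
  exact: (measurable_funTS (@measurable_sph_param R)) (@measurable_sph_dom R) _ mA.
rewrite /sphere_measure.
apply: (@le_lt_trans _ _ (((4 * pi)^-1 : R)%:E * area (@sph_dom R))).
  apply: lee_wpmul2l; first by rewrite lee_fin invr_ge0 mulr_ge0.
  apply: (@le_trans _ _ (\int[area]_(t in sph_dom `&` @sph_param R @^-1` A) 1)).
    apply: ge0_le_integral => //.
    - by move=> t [[/= t1 _] _]; rewrite lee_fin sin_ge0_pi.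
    - apply/measurable_EFinP/measurable_funTS.
      apply: continuous_plane_measurable => t.
      exact: (continuous_comp (@cvg_fst _ _ _ _ _) (@continuous_sin R _)).
    - by move=> t _; rewrite lee_fin sin_le1.
  rewrite integral_cst// mul1e le_measure// ?inE//.
  exact: measurable_sph_dom.
rewrite /sph_dom [X in _ * X]area_rectangle ?mulr_ge0//.
by rewrite -EFinM ltry.
Qed.

HB.instance Definition _ :=
  Measure_isFinite.Build _ _ _ sigma sphere_measure_fin_num.

Definition upper_half : set (R * R) := [set w | (0 < w.2)%R].

Lemma measurable_upper_half : measurable (upper_half : set (mR * mR)).
Proof.
have := @measurable_snd _ _ mR mR measurableT `]0%R, +oo[%classic (measurable_itv _).
rewrite setTI; congr measurable; apply/seteqP; split=> w;
  by rewrite /upper_half /= in_itv /= andbT.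
Qed.

(** On each vertical line the integrand is even, which gives twice the half line; the endpoint y = 0
    is negligible. *)
Lemma integral_abs_snd (h : R * R -> R) : continuous h -> (forall w, (0 <= h w)%R) ->
  \int[area]_w (h (w.1, `|w.2|)%R)%:E = 2%:E * \int[area]_(w in upper_half) (h w)%:E.
Proof.
move=> ch h0.
have cn : continuous (fun w : R * R => (w.1, `|w.2|)%R).
  apply: continuous_pair; first by move=> w; exact: cvg_fst.
  by move=> w; apply: cvg_norm; exact: cvg_snd.
have ch' : continuous (fun w : R * R => h (w.1, `|w.2|)%R).
  by move=> w; exact: (continuous_comp (cn w) (ch _)).
have m1 : measurable_fun setT (fun w : mR * mR => (h (w.1, `|w.2|)%R)%:E).
  by apply/measurable_EFinP; exact: (continuous_plane_measurable ch').
have m2 : measurable_fun [set: (mR * mR)%type] ((fun w : mR * mR => (h w)%:E) \_ upper_half).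
  apply/(measurable_restrictT _ measurable_upper_half)/measurable_funTS.
  by apply/measurable_EFinP; exact: (continuous_plane_measurable ch).
have p2 w : 0 <= ((fun w : mR * mR => (h w)%:E) \_ upper_half) w.
  by apply: erestrict_ge0 => ? _; rewrite lee_fin.
have p1 w : 0 <= (h (w.1, `|w.2|)%R)%:E by rewrite lee_fin.
rewrite [in RHS]integral_mkcond.
transitivity (\int[lebesgue_measure]_(x in [set: mR])
    (2%:E * fubini_F lebesgue_measure ((fun w : mR * mR => (h w)%:E) \_ upper_half) x)).
  rewrite [LHS](fubini_tonelli1 _ m1 p1).
  apply: eq_integral => x _; rewrite /fubini_F.
  rewrite (@ge0_symfun_integralT _ (fun y => h (x, `|y|)%R))//; last 2 first.
  - exact: (@continuous_slice2 _ (fun w => h (w.1, `|w.2|)%R) x ch').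
  - by move=> y /=; rewrite normrN.
  congr (_ * _); rewrite -set_itvcy.
  transitivity (\int[lebesgue_measure]_(y in `[0%R, +oo[) (h (x, y))%:E).
    by apply: eq_integral => y; rewrite inE /= in_itv /= andbT => y0; rewrite ger0_norm.
  have my : measurable_fun [set: mR] (fun y : mR => (h (x, y))%:E).
    apply/measurable_EFinP; apply: (measurableT_comp (continuous_plane_measurable ch)).
    exact: (measurable_fun_pair (@measurable_cst _ _ mR mR setT x) (@measurable_id _ mR setT)).
  rewrite -integral_itv_obnd_cbnd; last exact: measurable_funTS my.
  rewrite [LHS]integral_mkcond; congr (integral _ _ _); apply/funext => y.
  rewrite !patchE.
  suff -> : ((x, y) \in upper_half) = (y \in `]0%R, +oo[%classic) by [].
  by apply/idP/idP; rewrite !inE /upper_half /= in_itv /= andbT.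
rewrite ge0_integralZl//; last 2 first.
- exact: measurable_fun_fubini_tonelli_F.
- by move=> x _; apply: integral_ge0.
by apply: congr1; exact: esym (fubini_tonelli1 _ m2 p2).
Qed.

(** [qvolume] is the image under [slice_pt] of the product measure restricted to y > 0, so a change
    of variables followed by Tonelli applies. *)
Lemma integral_qvolume (F : quat R -> \bar R) :
  measurable_fun setT F -> (forall z, 0 <= F z) ->
  measurable_fun setT (fun I => \int[area]_(w in upper_half) F (slice_pt I w)) /\
  \int[qvolume]_z F z =
  \int[sigma]_I \int[area]_(w in upper_half) F (slice_pt I w).
Proof.
move=> mF F0.
pose phi (p : quat R * (mR * mR)) := slice_pt p.1 p.2.
have mphi : measurable_fun setT phi := measurable_slice_pt.
pose phi' : {mfun _ >-> _} := HB.pack phi (isMeasurableFun.Build _ _ _ _ _ mphi).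
pose D := [set p : quat R * (mR * mR) | upper_half p.2].
have mD : measurable D.
  rewrite -[D]setTI; exact: (@measurable_snd _ _ (quat R) (mR * mR)%type)
    measurableT _ measurable_upper_half.
pose m := mrestr (sigma \x area) mD.
have mFphi : measurable_fun setT (F \o phi) by exact: measurableT_comp.
have mG : measurable_fun setT ((F \o phi) \_ D).
  exact/(measurable_restrictT _ mD)/measurable_funTS.
have G0 p : 0 <= ((F \o phi) \_ D) p.
  by apply: erestrict_ge0 => ? _; exact: F0.
have GE : fubini_F area ((F \o phi) \_ D) =
    fun I => \int[area]_(w in upper_half) F (slice_pt I w).
  apply/funext => I; rewrite /fubini_F [RHS]integral_mkcond.
  apply: eq_integral => w _; rewrite !patchE.
  suff -> : ((I, w) \in D) = (w \in upper_half) by [].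
  by apply/idP/idP; rewrite !inE.
split; first by rewrite -GE; exact: measurable_fun_fubini_tonelli_F.
transitivity (\int[pushforward m phi']_z F z).
  apply: eq_measure_integral => A mA _.
  have hE : half_slices A = phi @^-1` A `&` D by apply/seteqP; split=> p [].
  exact: (congr1 (sigma \x area) hE).
rewrite ge0_integral_pushforward// preimage_setT.
transitivity (\int[m]_(p in setT `\` ~` D) (F \o phi) p).
  apply: ge0_negligible_integral => //; first exact: measurableC.
    by move=> p _; exact: F0.
  transitivity ((sigma \x area) (~` D `&` D)); first by [].
  by rewrite setICl measure0.
rewrite setTD setCK.
transitivity (\int[sigma \x area]_(p in D) (F \o phi) p).
  apply: eq_measure_integral => A mA AD.
  by transitivity ((sigma \x area) (A `&` D)); [by []|rewrite setIidl].
rewrite integral_mkcond -GE.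
exact: (@fubini_tonelli1 _ _ _ _ R sigma area _ mG G0).
Qed.

(** A contains the band of polar angles in [a, b], whose parameter rectangle has area 2 pi (b - a),
    and the Jacobian is at least c there. *)
Lemma sphere_measure_gt0 (A : set (quat R)) (a b c : R) : measurable A ->
  (0 <= a -> a < b -> b <= pi -> 0 < c ->
   (forall x, a <= x <= b -> c <= sin x) ->
   (forall x y, a <= x <= b -> A (sph_param (x, y))) -> (0 < sigma A)%E)%R.
Proof.
move=> mA a0 ab bpi c0 csin Asph.
have pi0 : (0 < pi :> R)%R := pi_gt0 R.
have md : measurable (sph_dom `&` @sph_param R @^-1` A).
  exact: (measurable_funTS (@measurable_sph_param R)) (@measurable_sph_dom R) _ mA.
pose Q : set (mR * mR) := `[a, b] `*` `[0%R, (2 * pi)%R].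
have mQ : measurable Q by apply: measurableX; exact: measurable_itv.
rewrite /sphere_measure mule_gt0// ?lte_fin ?invr_gt0 ?mulr_gt0//.
apply: (@lt_le_trans _ _ (\int[area]_(t in Q) c%:E)).
  rewrite integral_cst// mule_gt0 ?lte_fin//.
  rewrite /Q [X in _ < X]area_rectangle ?(ltW ab) ?mulr_ge0 ?(ltW pi0)//.
  by rewrite lte_fin subr0; apply: mulr_gt0; rewrite ?subr_gt0// mulr_gt0.
have msin : measurable_fun setT (fun t : mR * mR => (sin t.1)%:E).
  apply/measurable_EFinP; apply: continuous_plane_measurable => t.
  exact: (continuous_comp (@cvg_fst _ _ _ _ _) (@continuous_sin R _)).
apply: (@le_trans _ _ (\int[area]_(t in Q) (sin t.1)%:E)).
  apply: ge0_le_integral => //.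
  - by move=> t _; rewrite lee_fin ltW.
  - exact: measurable_funTS.
  - by move=> t [/= t1 _]; rewrite lee_fin csin.
apply: ge0_subset_integral => //.
- exact: measurable_funTS.
- by move=> t [[/= t1 _] _]; rewrite lee_fin sin_ge0_pi.
move=> [x y] [/= xab y2]; rewrite in_itv /= in xab; split; last exact: Asph.
split=> //=; rewrite in_itv /=; case/andP: xab => ax xb.
by rewrite (le_trans a0)//= (le_trans xb).
Qed.

Definition upper_cap (k : R) : set (quat R) := [set I | imag_units I /\ (k <= I.2)%R].

Definition lower_cap (k : R) : set (quat R) := [set I | imag_units I /\ (I.2 <= - k)%R].

Lemma measurable_imag_units : measurable (@imag_units R).
Proof.
have [k1 k2 k3 k4] := @continuous_coords R.
have mn : measurable_fun setT (fun z : quat R => (z.1.1.2 ^+ 2 + z.1.2 ^+ 2 + z.2 ^+ 2)%R).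
  by do 2?apply: measurable_funD; apply: measurable_funX; exact: continuous_quat_measurable.
have m1 := continuous_quat_measurable k1.
have h1 := m1 measurableT [set 0%R] (measurable_set1 _).
have h2 := mn measurableT [set 1%R] (measurable_set1 _).
rewrite !setTI in h1 h2.
have := measurableI _ _ h1 h2; congr measurable.
by apply/seteqP; split=> -[[[a b] c] d]; rewrite imag_unitsP.
Qed.

Lemma measurable_caps k : measurable (upper_cap k) /\ measurable (lower_cap k).
Proof.
have [_ _ _ k4] := @continuous_coords R; have m4 := continuous_quat_measurable k4.
split; apply: measurableI measurable_imag_units _.
  have := m4 measurableT `[k, +oo[%classic (measurable_itv _).
  by rewrite setTI; congr measurable; apply/seteqP; split=> z; rewrite /= in_itv /= andbT.
have := m4 measurableT `]-oo, (- k)%R]%classic (measurable_itv _).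
by rewrite setTI; congr measurable; apply/seteqP; split=> z; rewrite /= in_itv.
Qed.

Lemma caps_gt0 : exists2 k : R, (0 < k)%R &
  0 < sigma (upper_cap k) /\ 0 < sigma (lower_cap k).
Proof.
have pi0 : (0 < pi :> R)%R := pi_gt0 R.
(* The band of polar angles [pi/8, pi/4] lies in the cap and stays off the pole, where the Jacobian
   sin vanishes; the lower cap is treated through x -> pi - x. *)
exists (cos (pi / 4)); first by rewrite cos_gt0_pihalf//; apply/andP; split; lra.
have k x : (pi / 8 <= x <= pi / 4 -> cos (pi / 4) <= cos x /\ sin (pi / 8) <= sin x :> R)%R.
  move=> /andP[x1 x2]; split; rewrite leNgt; apply/negP.
    by rewrite ltr_cos ?in_itv /=; [lra|apply/andP; split; lra..].
  by rewrite ltr_sin ?in_itv /=; [lra|apply/andP; split; lra..].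
have s8 : (0 < sin (pi / 8) :> R)%R by rewrite sin_gt0_pi//; apply/andP; split; lra.
have [mu1 ml1] := measurable_caps (cos (pi / 4)).
have flip (x : R) : (cos x = - cos (pi - x) /\ sin x = sin (pi - x))%R.
  by rewrite [(pi - x)%R]addrC cosDpi sinDpi cosN sinN !opprK.
split.
  apply: (@sphere_measure_gt0 _ (pi / 8) (pi / 4) (sin (pi / 8))) => //; try lra.
    by move=> x /k[].
  by move=> x y /k[? _]; split; first exact: imag_units_sph_param.
have k' x : ((pi - pi / 4) <= x <= (pi - pi / 8) ->
    cos x <= - cos (pi / 4) /\ sin (pi / 8) <= sin x :> R)%R.
  move=> /andP[x1 x2]; have [-> ->] := flip x.
  have [|? ?] := k (pi - x)%R; first by apply/andP; split; lra.
  by split; rewrite ?lerN2.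
apply: (@sphere_measure_gt0 _ (pi - pi / 4) (pi - pi / 8) (sin (pi / 8))) => //; try lra.
  by move=> x /k'[].
by move=> x y /k'[? _]; split; first exact: imag_units_sph_param.
Qed.

Lemma sphere_measure_units : sigma (~` @imag_units R) = 0.
Proof.
rewrite /sphere_measure (_ : _ `&` _ = set0) ?integral_set0 ?mule0//.
apply/seteqP; split=> // t [_]; apply; exact: imag_units_sph_param.
Qed.

End volume_integrals.

(** * The box condition implies the Carleson condition *)

Section box_condition_implies_carleson.
Context {R : realType}.
Local Notation area := (@area R).
Local Notation mR := (measurableTypeR R).
Local Notation sigma := (@sphere_measure R).
Implicit Types (alpha p r : R) (I J z : quat R) (w : R * R).
Local Open Scope ereal_scope.

(** If both alternatives failed, at I and at J, then T would exceed 2K max(G I, G J) >= K (G I + G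
    J). This decouples the slices: an average over a single cap is enough. *)
Lemma le_of_caps (T : \bar R) (K : R) (A B : set (quat R)) (G : quat R -> \bar R) :
  (forall I, 0 <= G I) -> (forall I J, A I -> B J -> T <= K%:E * (G I + G J)) ->
  (0 < K)%R ->
  (forall I, A I -> T <= (2 * K)%:E * G I) \/
  (forall J, B J -> T <= (2 * K)%:E * G J).
Proof.
move=> G0 H K0.
have [hA|/existsNP[I /not_implyP[AI /negP]]] :=
  pselect (forall I, A I -> T <= (2 * K)%:E * G I); first by left.
rewrite -ltNge => TI; right => J BJ; rewrite leNgt; apply/negP => TJ.
have := H _ _ AI BJ; apply/negP; rewrite -ltNge.
have dbl (x : \bar R) : K%:E * (x + x) = (2 * K)%:E * x.
  by rewrite -mule2n -mule_natl muleA -EFinM mulrC.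
have K0' : 0 <= K%:E by rewrite lee_fin ltW.
have [IJ|/ltW JI] := leP (G I) (G J).
  by apply: le_lt_trans TJ; rewrite -dbl lee_wpmul2l// leeD2r.
by apply: le_lt_trans TI; rewrite -dbl lee_wpmul2l// leeD2l.
Qed.

(** T does not depend on I, so integrating the bound over A multiplies T by sigma(A); since G >= 0,
    the right-hand side may be extended to all I. *)
Lemma le_integral_sphere (T : \bar R) (K : R) (A : set (quat R)) (G : quat R -> \bar R) :
  measurable A -> 0 < sigma A -> measurable_fun setT G -> (forall I, 0 <= G I) ->
  (0 < K)%R -> 0 <= T -> (forall I, A I -> T <= K%:E * G I) ->
  T <= (K / fine (sigma A))%:E * \int[sigma]_I G I.
Proof.
move=> mA A0 mG G0 K0 T0 H.
have sA : sigma A \is a fin_num := fin_num_measure _ _ mA.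
have f0 : (0 < fine (sigma A))%R by rewrite fine_gt0// A0 ltey_eq sA.
have K0' : 0 <= K%:E by rewrite lee_fin ltW.
have h : T * sigma A <= K%:E * \int[sigma]_I G I.
  rewrite -integral_cst// -ge0_integralZl//.
  apply: (@le_trans _ _ (\int[sigma]_(I in A) (K%:E * G I))).
    apply: ge0_le_integral => //.
    by apply: measurable_funTS; exact: measurable_funeM.
  apply: ge0_subset_integral => //; first exact: measurable_funeM.
  by move=> I _; exact: mule_ge0.
rewrite -[T]mule1 (_ : 1 = sigma A * (fine (sigma A))^-1%:E).
  rewrite muleA EFinM [K%:E * _]muleC -[leRHS]muleA [leLHS]muleC.
  by rewrite lee_wpmul2l// lee_fin invr_ge0 ltW.
by rewrite -[sigma A in RHS]fineK// -EFinM divff// gt_eqF.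
Qed.

Lemma fock_carleson_of_boxes alpha p r (mu : {measure set (quat R) -> \bar R}) :
  (0 < alpha)%R -> (0 < p)%R -> (0 < r)%R ->
  (exists2 C : R, (0 < C)%R & forall z, mu (symmetric_box z r) <= C%:E) ->
  fock_carleson alpha p mu.
Proof.
move=> alpha0 p0 r0 [C C0 muC].
have [k k0 [kA kB]] := @caps_gt0 R; have [mA mB] := measurable_caps k.
(* At most 1 for the weighted mean value inequality, at most r / 2 for the boxes to fit in S(z,
   r). *)
pose s : R := Num.min 1%R (r / 2)%R.
have s0 : (0 < s)%R by rewrite lt_min ltr01 divr_gt0.
have s1 : (s <= 1)%R by rewrite ge_min lexx.
have sr : (s <= r / 2)%R by rewrite ge_min lexx orbT.
have [C1 C10 HC1] := gauss_pow_box alpha0 p0 k0 s0 s1.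
(* C1 comes from the local bound, C from the box condition, 2 from unfolding the plane. *)
pose K := (C1 * C * 2)%R; have K0 : (0 < K)%R by rewrite !mulr_gt0.
have K20 : (0 < 2 * K)%R by rewrite mulr_gt0.
pose a := fine (sigma (upper_cap k)); pose b := fine (sigma (lower_cap k)).
have a0 : (0 < a)%R.
  by rewrite fine_gt0// kA ltey_eq (fin_num_measure _ _ mA).
have b0 : (0 < b)%R.
  by rewrite fine_gt0// kB ltey_eq (fin_num_measure _ _ mB).
(* Which of the two caps gives the bound depends on f; the sum dominates both constants. *)
pose M := (2 * K / a + 2 * K / b)%R.
have M0 : (0 < M)%R by rewrite addr_gt0// divr_gt0.
have pa0 : (0 < p * alpha / pi)%R by rewrite divr_gt0 ?mulr_gt0 ?pi_gt0.
exists (M / (p * alpha / pi))%R; first by rewrite divr_gt0.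
move=> f [rf _]; have [f0 [f1 [ff Cf0 Cf1 CR]]] := rf.
have mg := measurable_gauss_pow ff Cf0 Cf1 alpha p.
have mgE : measurable_fun setT (fun z => (gauss_pow alpha p f z)%:E).
  exact/measurable_EFinP.
have g0 z : 0 <= (gauss_pow alpha p f z)%:E by rewrite lee_fin powR_ge0.
have [mG qE] := integral_qvolume mgE g0.
pose G I := \int[area]_(w in upper_half) (gauss_pow alpha p f (slice_pt I w))%:E.
have G0 I : 0 <= G I by apply: integral_ge0 => w _; exact: g0.
set T := \int[mu]_w _.
have T0 : 0 <= T by apply: integral_ge0.
have HT I J : upper_cap k I -> lower_cap k J -> T <= K%:E * (G I + G J).
  move=> [uI kI] [uJ kJ].
  have ch := continuous_two_slices (alpha:=alpha) p0 rf uI uJ.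
  have h0 w : (0 <= two_slices alpha p f I J w)%R := two_slices_ge0 alpha p f I J w.
  have [mh Hh] := integral_box_le r0 s0 sr C0 ch h0 muC.
  have C10' : 0 <= C1%:E by rewrite lee_fin ltW.
  apply: (@le_trans _ _ (\int[mu]_z (C1%:E *
      \int[area]_(w in box (qRe z) (qIm_norm z) s) (two_slices alpha p f I J w)%:E))).
    apply: ge0_le_integral => //; first exact: measurable_funeM.
    move=> z _; rewrite -EFin_Rintegral_box ?(ltW s0)// -EFinM lee_fin.
    exact: HC1.
  rewrite ge0_integralZl//; last by move=> z _; apply: integral_ge0 => w _; rewrite lee_fin.
  apply: le_trans (lee_wpmul2l C10' Hh) _.
  have cw J0 : imag_units J0 ->
      continuous (fun w : R * R => slice_weight alpha f J0 w `^ p)%R.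
    move=> u0; apply: continuous_powR_comp => // [|w]; last exact: slice_weight_ge0.
    by have := continuous_slice_weight ff Cf0 Cf1 CR (alpha:=alpha) u0.
  have GE J0 : imag_units J0 ->
      G J0 = \int[area]_(w in upper_half) (slice_weight alpha f J0 w `^ p)%:E.
    by move=> u0; apply: eq_integral => w _; rewrite gauss_pow_slice.
  pose h w := (slice_weight alpha f I w `^ p + slice_weight alpha f J w `^ p)%R.
  have c2 : continuous h by move=> w; apply: cvgD; exact: cw.
  have h2 w : (0 <= h w)%R by rewrite addr_ge0 ?powR_ge0.
  rewrite [X in C1%:E * (C%:E * X)](integral_abs_snd c2 h2).
  rewrite {1}/h; under eq_integral do rewrite EFinD.
  have mw J0 : imag_units J0 -> measurable_fun upper_half
      (fun w : mR * mR => (slice_weight alpha f J0 w `^ p)%:E).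
    move=> u0; apply/measurable_EFinP/measurable_funTS.
    exact: continuous_plane_measurable (cw _ u0).
  rewrite ge0_integralD//; last 5 first.
  - exact: measurable_upper_half.
  - by move=> w _; rewrite lee_fin powR_ge0.
  - exact: mw.
  - by move=> w _; rewrite lee_fin powR_ge0.
  - exact: mw.
  by rewrite -!GE// !muleA -!EFinM /K.
have TM : T <= M%:E * \int[qvolume]_z (gauss_pow alpha p f z)%:E.
  have q0 : 0 <= \int[qvolume]_z (gauss_pow alpha p f z)%:E.
    by apply: integral_ge0.
  have [HA|HB] := le_of_caps G0 HT K0.
    apply: le_trans (le_integral_sphere mA kA mG G0 K20 T0 HA) _.
    by rewrite -qE lee_wpmul2r// lee_fin lerDl ltW// divr_gt0.
  apply: le_trans (le_integral_sphere mB kB mG G0 K20 T0 HB) _.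
  by rewrite -qE lee_wpmul2r// lee_fin lerDr ltW// divr_gt0.
by rewrite /fock_norm_pow muleA -EFinM divfK// gt_eqF.
Qed.

End box_condition_implies_carleson.

(** * The reproducing kernel *)

Section complex_exponential.
Context {R : realType}.
Implicit Types (p q : R * R).

(* R * R as the complex numbers *)
Definition cmul p q : R * R := (p.1 * q.1 - p.2 * q.2, p.1 * q.2 + p.2 * q.1).

Definition cconj p : R * R := (p.1, - p.2).

Definition cpow p (n : nat) : R * R := iter n (cmul p) (1, 0).

Lemma cpowS p n : cpow p n.+1 = cmul p (cpow p n). Proof. by []. Qed.

Lemma cpow_cmul p q n : cpow (cmul p q) n = cmul (cpow p n) (cpow q n).
Proof.
elim: n => [|n IH]; first by rewrite /cpow /cmul /=; congr (_, _); ring.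
by rewrite !cpowS IH; congr (_, _); rewrite /=; ring.
Qed.

Lemma cpow_cconj p n : cpow (cconj p) n = cconj (cpow p n).
Proof.
elim: n => [|n IH]; first by rewrite /cpow /cconj /= oppr0.
by rewrite !cpowS IH; congr (_, _); rewrite /=; ring.
Qed.

Lemma cpow_scale (a : R) p n :
  cpow (a * p.1, a * p.2) n = (a ^+ n * (cpow p n).1, a ^+ n * (cpow p n).2).
Proof.
elim: n => [|n IH]; first by rewrite /cpow /= expr0 mul1r mulr0.
by rewrite !cpowS IH exprS; congr (_, _); rewrite /=; ring.
Qed.

(** The l^1 norm of complex numbers is submultiplicative; this dominates the series by a real
    exponential series. *)
Lemma cpow_norm p n :
  `|(cpow p n).1| + `|(cpow p n).2| <= (`|p.1| + `|p.2|) ^+ n.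
Proof.
elim: n => [|n IH]; first by rewrite /cpow /= normr1 normr0 addr0 expr0.
rewrite cpowS exprS /cmul /=.
apply: le_trans (ler_wpM2l (addr_ge0 (normr_ge0 _) (normr_ge0 _)) IH).
apply: le_trans (lerD (ler_normB _ _) (ler_normD _ _)) _.
rewrite !normrM le_eqVlt; apply/orP; left; apply/eqP; ring.
Qed.

Definition cexp p : R * R := (expR p.1 * cos p.2, expR p.1 * sin p.2).

Let re p n := (cpow p n).1 / n`!%:R.
Let im p n := (cpow p n).2 / n`!%:R.

Let cvg_pseries p (c : nat -> R) (t : R) :
  (forall n, `|c n| <= `|(cpow p n).1| + `|(cpow p n).2|) ->
  cvgn (pseries (fun n => c n / n`!%:R) t).
Proof.
move=> cb; apply: normed_cvg.
apply: (series_le_cvg _ _ _ (is_cvg_series_exp_coeff ((`|p.1| + `|p.2|) * `|t|))).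
- by move=> n; exact: normr_ge0.
- by move=> n; rewrite /exp_coeff divr_ge0// exprn_ge0// mulr_ge0// addr_ge0.
move=> n; rewrite /exp_coeff.
change (`|c n / n`!%:R * t ^+ n| <= ((`|p.1| + `|p.2|) * `|t|) ^+ n / n`!%:R).
rewrite !normrM normfV normr_nat normrX exprMn [leRHS]mulrAC.
rewrite ler_wpM2r ?exprn_ge0// ler_wpM2r ?invr_ge0//.
exact: le_trans (cb n) (cpow_norm p n).
Qed.

Let cvg_re p t : cvgn (pseries (re p) t).
Proof. by apply: (cvg_pseries (p := p)) => n; rewrite lerDl. Qed.

Let cvg_im p t : cvgn (pseries (im p) t).
Proof. by apply: (cvg_pseries (p := p)) => n; rewrite lerDr. Qed.

(** The derivative of e^(tp) is p e^(tp): derived series are combinations of the same two series, so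
    they all converge. *)
Let diffs_re p : pseries_diffs (re p) = fun n => p.1 * re p n + - p.2 * im p n.
Proof.
apply/funext => n; rewrite /pseries_diffs /re /im cpowS /= factS natrM.
have : n`!%:R != 0 :> R by rewrite pnatr_eq0 -lt0n fact_gt0.
have : n.+1%:R != 0 :> R by rewrite pnatr_eq0.
by move: n.+1%:R n`!%:R => N F N0 F0; field; rewrite N0 F0.
Qed.

Let diffs_im p : pseries_diffs (im p) = fun n => p.2 * re p n + p.1 * im p n.
Proof.
apply/funext => n; rewrite /pseries_diffs /re /im cpowS /= factS natrM.
have : n`!%:R != 0 :> R by rewrite pnatr_eq0 -lt0n fact_gt0.
have : n.+1%:R != 0 :> R by rewrite pnatr_eq0.
by move: n.+1%:R n`!%:R => N F N0 F0; field; rewrite N0 F0.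
Qed.

Let diffs_lin (c d : nat -> R) (a b : R) :
  pseries_diffs (fun n => a * c n + b * d n) =
  fun n => a * pseries_diffs c n + b * pseries_diffs d n.
Proof. by apply/funext => n; rewrite /pseries_diffs; ring. Qed.

Let cvg_lin (c d : nat -> R) (a b t l m : R) :
  pseries c t @ \oo --> l -> pseries d t @ \oo --> m ->
  pseries (fun n => a * c n + b * d n) t @ \oo --> a * l + b * m.
Proof.
move=> cl dm.
rewrite (_ : pseries _ t = fun n => a * pseries c t n + b * pseries d t n).
  by apply: cvgD; apply: cvgM => //; exact: cvg_cst.
apply/funext => n; rewrite /pseries /series /= !mulr_sumr -big_split /=.
by apply: eq_bigr => i _; ring.
Qed.

Let C p t := limn (pseries (re p) t).
Let S p t := limn (pseries (im p) t).

Let is_deriveC p (t : R) : is_derive t (1 : R) (C p) (p.1 * C p t + - p.2 * S p t).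
Proof.
(* Termwise differentiation at t needs the series and its first two derived series to converge at a
   point of larger modulus. *)
have K : `|t| < `| `|t| + 1|.
  by rewrite [ltRHS]ger0_norm ?addr_ge0// ltrDl.
have L (a b : R) := @cvg_lin _ _ a b _ _ _ (@cvg_re p (`|t| + 1)) (@cvg_im p (`|t| + 1)).
have [||d1 d2] := pseries_snd_diffs (@cvg_re p (`|t| + 1)) _ _ K.
- rewrite diffs_re; apply/cvg_ex; eexists; exact: L.
- rewrite diffs_re diffs_lin diffs_re diffs_im; apply/cvg_ex; eexists.
  by apply: cvg_lin; exact: L.
split=> //; rewrite d2; apply/cvg_lim => //.
by rewrite diffs_re; apply: cvg_lin; [exact: cvg_re|exact: cvg_im].
Qed.

Let is_deriveS p (t : R) : is_derive t (1 : R) (S p) (p.2 * C p t + p.1 * S p t).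
Proof.
have K : `|t| < `| `|t| + 1|.
  by rewrite [ltRHS]ger0_norm ?addr_ge0// ltrDl.
have L (a b : R) := @cvg_lin _ _ a b _ _ _ (@cvg_re p (`|t| + 1)) (@cvg_im p (`|t| + 1)).
have [||d1 d2] := pseries_snd_diffs (@cvg_im p (`|t| + 1)) _ _ K.
- rewrite diffs_im; apply/cvg_ex; eexists; exact: L.
- rewrite diffs_im diffs_lin diffs_re diffs_im; apply/cvg_ex; eexists.
  by apply: cvg_lin; exact: L.
split=> //; rewrite d2; apply/cvg_lim => //.
by rewrite diffs_im; apply: cvg_lin; [exact: cvg_re|exact: cvg_im].
Qed.

Let C0 p : C p 0 = 1 /\ S p 0 = 0.
Proof.
(* The partial sum of index 0 is empty; from index 1 on, all of them equal the constant term. *)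
split; apply/cvg_lim => //; rewrite -(cvg_shiftn 1); apply: cvg_near_cst;
  near=> n; rewrite /pseries /series /= addn1 big_nat_recl//= big1 ?addr0.
all: try by rewrite /re /im /cpow /= fact0 expr0 ?mul0r// divr1 mulr1.
all: by move=> i _; rewrite exprS mul0r mulr0.
Unshelve. all: by end_near. Qed.

(* e^(-tp) times the series is constant in t *)
Lemma cexp_series p :
  series (fun n => (cpow p n).1 / n`!%:R) @ \oo --> (cexp p).1 /\
  series (fun n => (cpow p n).2 / n`!%:R) @ \oo --> (cexp p).2.
Proof.
pose e t := expR (- p.1 * t); pose c t := cos (p.2 * t); pose s t := sin (p.2 * t).
have dlin (a t : R) : is_derive t (1 : R) (fun t => a * t) a.
  exact: (is_derive_eq (is_deriveZ a (is_derive_id t (1 : R))) (mulr1 a)).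
have de (t : R) : is_derive t (1 : R) e (e t * - p.1).
  exact: is_derive1_comp (is_derive_expR _) (dlin _ _).
have dc (t : R) : is_derive t (1 : R) c (- s t * p.2).
  exact: is_derive1_comp (is_derive_cos _) (dlin _ _).
have ds (t : R) : is_derive t (1 : R) s (c t * p.2).
  exact: is_derive1_comp (is_derive_sin _) (dlin _ _).
(* [G] and [H] are the real and imaginary parts of e^(-tp) (C + iS). *)
pose G := e * (C p * c + S p * s).
pose H := e * (S p * c - C p * s).
have m (u v : R) : u *: v = u * v by [].
have dG (t : R) : is_derive t (1 : R) G 0.
  apply: (is_derive_eq (is_deriveM (de t) (is_deriveD
    (is_deriveM (is_deriveC p t) (dc t)) (is_deriveM (is_deriveS p t) (ds t))))).
  rewrite !m !fctE; ring.
have dH (t : R) : is_derive t (1 : R) H 0.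
  apply: (is_derive_eq (is_deriveM (de t) (is_deriveB
    (is_deriveM (is_deriveS p t) (dc t)) (is_deriveM (is_deriveC p t) (ds t))))).
  rewrite !m !fctE; ring.
have [C01 S00] := C0 p.
have G1 := is_derive_0_is_cst 1 0 dG; have H1 := is_derive_0_is_cst 1 0 dH.
have e0 : e 0 = 1 by rewrite /e mulr0 expR0.
have c0 : c 0 = 1 by rewrite /c mulr0 cos0.
have s0 : s 0 = 0 by rewrite /s mulr0 sin0.
move: G1 H1; rewrite /G /H !fctE C01 S00 e0 c0 s0 !mulr1 !mulr0 subr0 addr0.
rewrite /e /c /s !mulr1.
have pe : expR (- p.1) * expR p.1 = 1 by rewrite mulrC expRxMexpNx_1.
have cs : cos p.2 ^+ 2 + sin p.2 ^+ 2 = 1 := cos2Dsin2 _.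
set E := expR (- p.1) in pe *; set F := expR p.1 in pe *.
set co := cos p.2 in cs *; set si := sin p.2 in cs * => G1 H1.
have CE : C p 1 = F * co.
  transitivity ((E * F) * (C p 1 * (co ^+ 2 + si ^+ 2))).
    by rewrite pe cs !mul1r mulr1.
  transitivity (F * (E * (C p 1 * co + S p 1 * si)) * co -
    F * (E * (S p 1 * co - C p 1 * si)) * si); first ring.
  by rewrite G1 H1; ring.
have SE : S p 1 = F * si.
  transitivity ((E * F) * (S p 1 * (co ^+ 2 + si ^+ 2))).
    by rewrite pe cs !mul1r mulr1.
  transitivity (F * (E * (C p 1 * co + S p 1 * si)) * si +
    F * (E * (S p 1 * co - C p 1 * si)) * co); first ring.
  by rewrite G1 H1; ring.
have one (d : nat -> R) : pseries d 1 = series d.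
  rewrite /pseries; congr series; apply/funext => i.
  by change (d i * (1 : R) ^+ i = d i); rewrite expr1n mulr1.
rewrite /cexp /= -CE -SE -(one (re p)) -(one (im p)).
by split; [exact: cvg_re|exact: cvg_im].
Qed.

End complex_exponential.

(** * The kernel on a pair of slices, and its norm *)

Section kernel_formula.
Context {R : realType}.
Implicit Types (I J : quat R) (s t : R * R).

Lemma qmul_slice_ptJ I s t : imag_units I ->
  qmul (slice_pt I s) (slice_pt I t) = slice_pt I (cmul s t).
Proof.
move=> uI; rewrite qmul_slice_pt; move: uI.
have e (u v : R) : u *: v = u * v by [].
case: I => [[[a b] c] d] /imag_unitsP[-> h]; case: s => s1 s2; case: t => t1 t2.
rewrite /slice_pt /cmul /qone /=; congr (_, _, _, _); rewrite /= ?e.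
- transitivity (s1 * t1 - s2 * t2 * (b ^+ 2 + c ^+ 2 + d ^+ 2)); last first.
    by rewrite h; ring.
  by ring.
all: by ring.
Qed.

Lemma qmulZr (a : R) I J : qmul I (a *: J) = a *: qmul I J.
Proof.
have e (u v : R) : u *: v = u * v by [].
case: I => [[[x b] c] d]; case: J => [[[x' b'] c'] d'].
by rewrite /=; congr (_, _, _, _); rewrite /= ?e; ring.
Qed.

Lemma qmul1r I : qmul I qone = I.
Proof. by case: I => [[[x b] c] d]; congr (_, _, _, _); rewrite /=; ring. Qed.

Lemma qpow_slice_pt I t n : imag_units I ->
  qpow (slice_pt I t) n = slice_pt I (cpow t n).
Proof.
move=> uI; elim: n => [|n IH].
  by rewrite /qpow /cpow /slice_pt /= scale1r scale0r addr0.
by rewrite /qpow iterS -/(qpow _ n) IH qmul_slice_ptJ.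
Qed.

Lemma qconj_slice_pt J t : imag_units J -> qconj (slice_pt J t) = slice_pt J (cconj t).
Proof.
have e (u v : R) : u *: v = u * v by [].
case: J => [[[a b] c] d] /imag_unitsP[-> h]; case: t => t1 t2.
by rewrite /slice_pt /cconj /qone /=; congr (_, _, _, _); rewrite /= ?e; ring.
Qed.

Lemma qmul_slice_pts I J s t : imag_units I -> imag_units J ->
  qmul (slice_pt I s) (slice_pt J t) =
  (s.1 * t.1) *: qone + (s.1 * t.2) *: J + (s.2 * t.1) *: I +
  (s.2 * t.2) *: qmul I J.
Proof.
have e (u v : R) : u *: v = u * v by [].
case: I => [[[a b] c] d] /imag_unitsP[-> _].
case: J => [[[a' b'] c'] d'] /imag_unitsP[-> _]; case: s => s1 s2; case: t => t1 t2.
by rewrite /slice_pt /qone /=; congr (_, _, _, _); rewrite /= ?e; ring.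
Qed.

(* e^(alpha z \bar w) and e^(alpha \bar z \bar w), for complex numbers z and w *)
Definition cexp1 (alpha : R) t s : R * R :=
  cexp (alpha * (t.1 * s.1 + t.2 * s.2), alpha * (t.2 * s.1 - t.1 * s.2)).

Definition cexp2 (alpha : R) t s : R * R :=
  cexp (alpha * (t.1 * s.1 - t.2 * s.2), alpha * - (t.2 * s.1 + t.1 * s.2)).

(** With F(z) = e^(alpha z \bar w) on C_J, these are (F(z) + F(\bar z)) / 2 here and - J (F(z) -
    F(\bar z)) / 2 in [kernel_snd]: the components of the slice extension of F. *)
Definition kernel_fst alpha J s t : quat R :=
  (2^-1 * ((cexp1 alpha t s).1 + (cexp2 alpha t s).1)) *: qone +
  (2^-1 * ((cexp1 alpha t s).2 + (cexp2 alpha t s).2)) *: J.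

Definition kernel_snd alpha J s t : quat R :=
  (2^-1 * ((cexp1 alpha t s).2 - (cexp2 alpha t s).2)) *: qone +
  (2^-1 * ((cexp2 alpha t s).1 - (cexp1 alpha t s).1)) *: J.

(** Each term z^n \bar w^n expands in 1, J, I, I J. The products of real and imaginary parts that
    occur as coefficients are half sums and half differences of the parts of (z \bar w)^n and (\bar
    z \bar w)^n, computed in one complex plane. *)
Lemma fock_kernel_slice alpha I J s t : imag_units I -> imag_units J ->
  fock_kernel alpha (slice_pt I t) (slice_pt J s) =
  kernel_fst alpha J s t + qmul I (kernel_snd alpha J s t).
Proof.
move=> uI uJ.
pose p : R * R := (t.1 * s.1 + t.2 * s.2, t.2 * s.1 - t.1 * s.2).
pose q : R * R := (t.1 * s.1 - t.2 * s.2, - (t.2 * s.1 + t.1 * s.2)).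
have pE : p = cmul t (cconj s) by rewrite /p /cmul /=; congr (_, _); ring.
have qE : q = cmul (cconj t) (cconj s) by rewrite /q /cmul /=; congr (_, _); ring.
have [P1 P2] := cexp_series (alpha * p.1, alpha * p.2).
have [Q1 Q2] := cexp_series (alpha * q.1, alpha * q.2).
rewrite -/(cexp1 alpha t s) in P1 P2; rewrite -/(cexp2 alpha t s) in Q1 Q2.
move: P1 P2 Q1 Q2.
set P1 := (fun n => _); set P2 := (X in _ -> series X @ _ --> _ -> _).
set Q1 := (X in _ -> _ -> series X @ _ --> _ -> _).
set Q2 := (X in _ -> _ -> _ -> series X @ _ --> _ -> _) => cP1 cP2 cQ1 cQ2.
have E n : (alpha ^+ n / n`!%:R) *: qmul (qpow (slice_pt I t) n)
    (qpow (qconj (slice_pt J s)) n) =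
    (2^-1 * (P1 n + Q1 n)) *: qone + (2^-1 * (P2 n + Q2 n)) *: J +
    (2^-1 * (P2 n - Q2 n)) *: I + (2^-1 * (Q1 n - P1 n)) *: qmul I J.
  rewrite qconj_slice_pt// !qpow_slice_pt// qmul_slice_pts// cpow_cconj.
  rewrite /P1 /P2 /Q1 /Q2 !cpow_scale pE qE !cpow_cmul !cpow_cconj.
  move: (cpow t n) (cpow s n) => [a b] [c d]; rewrite /cmul /cconj /=.
  rewrite !scalerDr !scalerA; move: (alpha ^+ n) (n`!%:R^-1) => x y.
  have lin (a1 a2 a3 a4 b1 b2 b3 b4 : R) (z1 z2 z3 z4 : quat R) :
      a1 = b1 -> a2 = b2 -> a3 = b3 -> a4 = b4 ->
      a1 *: z1 + a2 *: z2 + a3 *: z3 + a4 *: z4 =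
      b1 *: z1 + b2 *: z2 + b3 *: z3 + b4 *: z4 by move=> -> -> -> ->.
  by apply: lin; field.
rewrite /fock_kernel (_ : (fun n => _) = (fun n =>
    (2^-1 * (P1 n + Q1 n)) *: qone + (2^-1 * (P2 n + Q2 n)) *: J +
    (2^-1 * (P2 n - Q2 n)) *: I + (2^-1 * (Q1 n - P1 n)) *: qmul I J)); last first.
  by apply/funext => n; exact: E.
have lim (a b c d : nat -> R) (la lb lc ld : R) (z1 z2 z3 z4 : quat R) :
    series a @ \oo --> la -> series b @ \oo --> lb ->
    series c @ \oo --> lc -> series d @ \oo --> ld ->
    limn (series (fun n => a n *: z1 + b n *: z2 + c n *: z3 + d n *: z4)) =
    la *: z1 + lb *: z2 + lc *: z3 + ld *: z4.
  move=> ha hb hc hd; apply/cvg_lim; first exact: norm_hausdorff.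
  rewrite (_ : series _ = (fun n => series a n *: z1 + series b n *: z2 +
     series c n *: z3 + series d n *: z4)).
    by apply: cvgD; [apply: cvgD; [apply: cvgD|]|]; exact: cvgZr_tmp.
  by apply/funext => n; rewrite /series /= !scaler_suml -!big_split.
have half (u v : nat -> R) (lu lv : R) : series u @ \oo --> lu ->
    series v @ \oo --> lv ->
    series (fun n => 2^-1 * (u n + v n)) @ \oo --> 2^-1 * (lu + lv).
  move=> hu hv; rewrite (_ : series _ = (fun n => 2^-1 * (series u n + series v n))).
    by apply: cvgMr; exact: cvgD.
  by apply/funext => n; rewrite /series /= -big_split mulr_sumr.
have hN (u : nat -> R) (lu : R) : series u @ \oo --> lu ->
    series (fun n => - u n) @ \oo --> - lu.
  move=> hu; rewrite (_ : series _ = (fun n => - series u n)); first exact: cvgN.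
  by apply/funext => n; rewrite /series /= sumrN.
rewrite (lim _ _ _ _ _ _ _ _ _ _ _ _ (half _ _ _ _ cP1 cQ1) (half _ _ _ _ cP2 cQ2)
  (half _ _ _ _ cP2 (hN _ _ cQ2)) (half _ _ _ _ cQ1 (hN _ _ cP1))).
rewrite /kernel_fst /kernel_snd qmulDr addrA; congr (_ + _ + _).
  by rewrite qmulZr qmul1r.
by rewrite qmulZr.
Qed.

Lemma qnorm_fock_kernel alpha I J s t : imag_units I -> imag_units J ->
  qnorm (fock_kernel alpha (slice_pt I t) (slice_pt J s)) ^+ 2 =
  (1 + qdot I J) / 2 * expR (2 * (alpha * (t.1 * s.1 + t.2 * s.2))) +
  (1 - qdot I J) / 2 * expR (2 * (alpha * (t.1 * s.1 - t.2 * s.2))).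
Proof.
move=> uI uJ; rewrite fock_kernel_slice// qnorm_sqr /kernel_fst /kernel_snd.
have eN (p : R * R) : (cexp p).1 ^+ 2 + (cexp p).2 ^+ 2 = expR (2 * p.1).
  rewrite /cexp /= !exprMn -mulrDr cos2Dsin2 mulr1 mulr_natl mulr2n.
  by rewrite expRD expr2.
have e1 : (cexp1 alpha t s).1 ^+ 2 + (cexp1 alpha t s).2 ^+ 2 =
  expR (2 * (alpha * (t.1 * s.1 + t.2 * s.2))) by exact: eN.
have e2 : (cexp2 alpha t s).1 ^+ 2 + (cexp2 alpha t s).2 ^+ 2 =
  expR (2 * (alpha * (t.1 * s.1 - t.2 * s.2))) by exact: eN.
rewrite -e1 -e2; move: (cexp1 alpha t s) (cexp2 alpha t s) => [c1 s1] [c2 s2].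
(* The elements 1, J, I, I J are unit vectors, orthogonal except for <J, I> = k and <1, I J> = -
   k. *)
have gram (A B C D : R) : qdot (A *: qone + B *: J + qmul I (C *: qone + D *: J))
    (A *: qone + B *: J + qmul I (C *: qone + D *: J)) =
    A ^+ 2 + B ^+ 2 + C ^+ 2 + D ^+ 2 + 2 * (B * C - A * D) * qdot I J.
  rewrite qmulDr !qmulZr qmul1r; move: uI uJ.
  have e (u v : R) : u *: v = u * v by [].
  case: I => [[[a b] c] d] /imag_unitsP[-> h].
  case: J => [[[a' b'] c'] d'] /imag_unitsP[-> h'].
  rewrite (_ : _ + _ + _ = (A - D * (b * b' + c * c' + d * d'),
    B * b' + C * b + D * (c * d' - d * c'), B * c' + C * c + D * (d * b' - b * d'),
    B * d' + C * d + D * (b * c' - c * b'))); last first.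
    by congr (_, _, _, _); rewrite /= !e; ring.
  transitivity (A ^+ 2 + B ^+ 2 * (b' ^+ 2 + c' ^+ 2 + d' ^+ 2) +
    C ^+ 2 * (b ^+ 2 + c ^+ 2 + d ^+ 2) +
    D ^+ 2 * (b ^+ 2 + c ^+ 2 + d ^+ 2) * (b' ^+ 2 + c' ^+ 2 + d' ^+ 2) +
    2 * (B * C - A * D) * qdot (0, b, c, d) (0, b', c', d')).
    by rewrite /qdot; ring.
  by rewrite h h' !mulr1.
by rewrite gram /=; field.
Qed.
End kernel_formula.

(** * The kernels are slice regular *)

Section kernel_regular.
Context {R : realType}.
Implicit Types (I J : quat R) (s t : R * R).

Lemma C1_partials_cvg_x (h hx hy : R * R -> R) t : C1_partials h hx hy ->
  k^-1 * (h (k *: ((1, 0) : R * R) + t) - h t) @[k --> 0^'] --> hx t.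
Proof.
case: t => x y [/(_ x y)[dx ex] _ _ _]; rewrite -ex.
have E : (fun k => k^-1 * (h (k *: ((1, 0) : R * R) + (x, y)) - h (x, y))) =
    (fun k : R => k^-1 *: (((fun s : R => h (s, y)) \o shift x) (k *: (1 : R)) - h (x, y))).
  apply/funext => k /=.
  have -> : k *: ((1, 0) : R * R) + (x, y) = (k *: (1 : R) + x, y).
    by congr (_, _); rewrite /= -[LHS]/(k * 0 + y) mulr0 add0r.
  by [].
rewrite E; exact: dx.
Qed.

Lemma C1_partials_cvg_y (h hx hy : R * R -> R) t : C1_partials h hx hy ->
  k^-1 * (h (k *: ((0, 1) : R * R) + t) - h t) @[k --> 0^'] --> hy t.
Proof.
case: t => x y [_ /(_ x y)[dy ey] _ _]; rewrite -ey.
have E : (fun k => k^-1 * (h (k *: ((0, 1) : R * R) + (x, y)) - h (x, y))) =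
    (fun k : R => k^-1 *: (((fun s : R => h (x, s)) \o shift y) (k *: (1 : R)) - h (x, y))).
  apply/funext => k /=.
  have -> : k *: ((0, 1) : R * R) + (x, y) = (x, k *: (1 : R) + y).
    by congr (_, _); rewrite /= -[LHS]/(k * 0 + x) mulr0 add0r.
  by [].
rewrite E; exact: dy.
Qed.

Lemma is_derive_scale2 (A B : R * R -> R) (a b : quat R) (v t : R * R) (la lb : R) :
  k^-1 * (A (k *: v + t) - A t) @[k --> 0^'] --> la ->
  k^-1 * (B (k *: v + t) - B t) @[k --> 0^'] --> lb ->
  is_derive t v (fun t => A t *: a + B t *: b : quat R) (la *: a + lb *: b).
Proof.
move=> ha hb.
have H : k^-1 *: (((fun t => A t *: a + B t *: b) \o shift t) (k *: v) -
    (A t *: a + B t *: b)) @[k --> 0^'] --> la *: a + lb *: b.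
  rewrite (_ : (fun k => _) = (fun k : R => (k^-1 * (A (k *: v + t) - A t)) *: a +
     (k^-1 * (B (k *: v + t) - B t)) *: b)).
    by apply: cvgD; exact: cvgZr_tmp.
  apply/funext => k /=; move: (A _) (A _) (B _) (B _) => x1 x2 y1 y2.
  by rewrite -!scalerA -scalerDr !scalerBl opprD addrACA.
by split; [apply/cvg_ex; eexists; exact: H|apply/cvg_lim => //; exact: H].
Qed.

(** The way back from real partials to quaternion-valued derivatives; the kernel components take
    values in the span of 1 and J. *)
Lemma C1_scale2 (A Ax Ay B Bx By : R * R -> R) (a b : quat R) :
  C1_partials A Ax Ay -> C1_partials B Bx By ->
  let g t : quat R := A t *: a + B t *: b in
  [/\ C1 g, forall t, 'D_((1, 0) : R * R) g t = Ax t *: a + Bx t *: b &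
    forall t, 'D_((0, 1) : R * R) g t = Ay t *: a + By t *: b].
Proof.
move=> HA HB g.
have dx t : is_derive t ((1, 0) : R * R) g (Ax t *: a + Bx t *: b).
  have := is_derive_scale2 a b (C1_partials_cvg_x (t := t) HA) (C1_partials_cvg_x (t := t) HB).
  exact.
have dy t : is_derive t ((0, 1) : R * R) g (Ay t *: a + By t *: b).
  have := is_derive_scale2 a b (C1_partials_cvg_y (t := t) HA) (C1_partials_cvg_y (t := t) HB).
  exact.
have cont (P Q : R * R -> R) : continuous P -> continuous Q ->
    continuous (fun t => P t *: a + Q t *: b).
  by move=> cP cQ t; apply: cvgD; apply: cvgZr_tmp; [exact: cP|exact: cQ].
have ex : (fun t => 'D_((1, 0) : R * R) g t) = fun t => Ax t *: a + Bx t *: b.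
  by apply/funext => t; case: (dx t).
have ey : (fun t => 'D_((0, 1) : R * R) g t) = fun t => Ay t *: a + By t *: b.
  by apply/funext => t; case: (dy t).
case: HA HB => _ _ cAx cAy [_ _ cBx cBy].
split=> [v [->|->]|t|t]; [split|split|by case: (dx t)|by case: (dy t)].
- by move=> t; case: (dx t).
- rewrite ex; exact: cont.
- by move=> t; case: (dy t).
- rewrite ey; exact: cont.
Qed.

(** In t, the first exponential is holomorphic and the second antiholomorphic, hence the opposite
    signs. *)
Lemma cexp_conjugate_pairs alpha s : exists ux uy wx wy,
  [/\ C1_partials (fun t => (cexp1 alpha t s).1) ux uy,
    C1_partials (fun t => (cexp1 alpha t s).2) (fun t => - uy t) ux,
    C1_partials (fun t => (cexp2 alpha t s).1) wx wy &
    C1_partials (fun t => (cexp2 alpha t s).2) wy (fun t => - wx t)].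
Proof.
have [ux [uy [H1 H2]]] := conjugate_pair_exp (alpha * s.1) (alpha * s.2) 0 0.
have [wx [wy [H3 H4]]] := conjugate_pair_exp (alpha * s.1) (- (alpha * s.2)) 0 0.
exists ux, uy, wx, wy; split.
- apply: eq_C1_partials H1 _ _ _ => // t; rewrite /cexp1 /cexp /=.
  by congr (expR _ * cos _); ring.
- apply: eq_C1_partials H2 _ _ _ => // t; rewrite /cexp1 /cexp /=.
  by congr (expR _ * sin _); ring.
- apply: eq_C1_partials H3 _ _ _ => // t; rewrite /cexp2 /cexp /= -cosN.
  by congr (expR _ * cos _); ring.
- apply: eq_C1_partials (C1_partialsN H4) _ _ _ => // t; last exact: opprK.
  by rewrite /cexp2 /cexp /= -mulrN -sinN; congr (expR _ * sin _); ring.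
Qed.

Lemma normalized_kernel_regular (alpha : R) (z : quat R) :
  slice_regular (normalized_kernel alpha z).
Proof.
have [J uJ ->] := slice_ptP z; move: (qRe z, qIm_norm z) => s {z}.
set k := expR (- (alpha / 2) * qnorm (slice_pt J s) ^+ 2).
exists (fun t => k *: kernel_fst alpha J s t), (fun t => k *: kernel_snd alpha J s t).
(* Conjugating t exchanges the two exponentials, which makes the half sum even and the half
   difference odd. *)
have swap x y : cexp1 alpha (x, - y) s = cexp2 alpha (x, y) s.
  by apply: (f_equal2 (fun a b : R => cexp (a, b))) => /=; ring.
have swap' x y : cexp2 alpha (x, - y) s = cexp1 alpha (x, y) s.
  by apply: (f_equal2 (fun a b : R => cexp (a, b))) => /=; ring.
have [ux [uy [wx [wy [H1 H2 H3 H4]]]]] := cexp_conjugate_pairs alpha s.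
pose k2 := k * 2^-1.
have E0 : (fun t => k *: kernel_fst alpha J s t) = fun t =>
    (k2 * ((cexp1 alpha t s).1 + (cexp2 alpha t s).1)) *: qone +
    (k2 * ((cexp1 alpha t s).2 + (cexp2 alpha t s).2)) *: J.
  by apply/funext => t; rewrite /kernel_fst scalerDr !scalerA !mulrA.
have E1 : (fun t => k *: kernel_snd alpha J s t) = fun t =>
    (k2 * ((cexp1 alpha t s).2 + - (cexp2 alpha t s).2)) *: qone +
    (k2 * ((cexp2 alpha t s).1 + - (cexp1 alpha t s).1)) *: J.
  by apply/funext => t; rewrite /kernel_snd scalerDr !scalerA !mulrA.
have [C0 D0x D0y] := C1_scale2 qone J
  (C1_partialsZ k2 (C1_partialsD H1 H3)) (C1_partialsZ k2 (C1_partialsD H2 H4)).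
have [C1' D1x D1y] := C1_scale2 qone J
  (C1_partialsZ k2 (C1_partialsD H2 (C1_partialsN H4)))
  (C1_partialsZ k2 (C1_partialsD H3 (C1_partialsN H1))).
split.
- split=> [x y|x y|I t uI].
  + rewrite /kernel_fst swap swap'.
    move: (cexp1 _ _ _) (cexp2 _ _ _) => [a b] [c d].
    by rewrite [(c, d).1 + _]addrC [(c, d).2 + _]addrC.
  + rewrite /kernel_snd swap swap'.
    move: (cexp1 _ _ _) (cexp2 _ _ _) => [a b] [c d].
    by rewrite -[(c, d).2 - _]opprB -[(a, b).1 - _]opprB !mulrN !scaleNr -opprD scalerN.
  + by rewrite /normalized_kernel fock_kernel_slice// scalerDr qmulZr.
- by rewrite E0.
- by rewrite E1.
rewrite E0 E1 => t; rewrite D0x D0y D1x D1y; split.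
  by rewrite opprK [wy t - _]addrC subrr.
rewrite addrACA -!scalerDl -!mulrDr.
rewrite (_ : uy t + _ + _ = 0); last by ring.
by rewrite (_ : ux t + _ + _ = 0) ?mulr0 ?scale0r ?addr0//; ring.
Qed.
End kernel_regular.

(** * Gaussian integrals and upper bounds for the kernels *)

Section kernel_integrals.
Context {R : realType}.
Local Notation area := (@area R).
Local Notation mR := (measurableTypeR R).
Local Notation sigma := (@sphere_measure R).
Implicit Types (I J z : quat R) (s t w : R * R).

Lemma integral_gaussian_line (b : R) : 0 < b ->
  exists2 C : R, 0 < C & forall m : R,
    (\int[@lebesgue_measure R]_x (expR (- b * (x - m) ^+ 2))%:E = C%:E)%E.
Proof.
(* The standard deviation for which the normal density is a multiple of e^(-b (x - m)^2); its total
   mass 1 gives a value independent of m. *)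
move=> b0; pose sd := Num.sqrt (2 * b)^-1.
have b2 : 0 < (2 * b)^-1 by rewrite invr_gt0 mulr_gt0.
have sd0 : sd != 0 by rewrite gt_eqF// sqrtr_gt0.
have sdE : (sd ^+ 2 *+ 2)^-1 = b.
  rewrite sqr_sqrtr ?ltW// -mulr_natr invfM invrK.
  by field.
exists (normal_peak sd)^-1 => [|m]; first by rewrite invr_gt0 normal_peak_gt0.
have := integral_normal_pdf m sd; rewrite (normal_pdfE m sd0).
under eq_integral do rewrite EFinM.
rewrite ge0_integralZl//; last 3 first.
- by apply/measurable_EFinP; exact: measurable_normal_fun.
- by move=> x _; rewrite lee_fin normal_fun_ge0.
- by rewrite lee_fin normal_peak_ge0.
have -> : (\int[lebesgue_measure]_x (normal_fun m sd x)%:E =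
    \int[lebesgue_measure]_x (expR (- b * (x - m) ^+ 2))%:E)%E.
  by apply: eq_integral => x _; rewrite /normal_fun sdE mulrC mulrN mulNr.
set G := (\int[_]_x _)%E => GE.
have p0 := normal_peak_gt0 sd0.
have pV : ((normal_peak sd)^-1%:E * (normal_peak sd)%:E = 1 :> \bar R)%E.
  by rewrite -EFinM mulVf// gt_eqF.
by rewrite -[G]mul1e -pV -muleA GE mule1.
Qed.

Lemma measurable_gaussian_plane (b x y : R) : measurable_fun [set: mR * mR]
  (fun w => (expR (- b * ((w.1 - x) ^+ 2 + (w.2 - y) ^+ 2)))%:E).
Proof.
apply/measurable_EFinP; apply: measurableT_comp => //.
apply: measurable_funM => //; apply: measurable_funD; apply: measurable_funX.
- by apply: measurable_funB => //; exact: measurable_fst.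
- by apply: measurable_funB => //; exact: measurable_snd.
Qed.

Lemma integral_gaussian_plane (b : R) : 0 < b ->
  exists2 C : R, 0 < C & forall x y : R,
    (\int[area]_w (expR (- b * ((w.1 - x) ^+ 2 + (w.2 - y) ^+ 2)))%:E = C%:E)%E.
Proof.
move=> b0; have [C C0 HC] := integral_gaussian_line b0.
exists (C * C) => [|x y]; first exact: mulr_gt0.
pose g (m u : R) := expR (- b * (u - m) ^+ 2).
have HCg m : (\int[@lebesgue_measure R]_u (g m u)%:E = C%:E)%E by exact: HC.
have g0 m u : (0 <= (g m u)%:E)%E by rewrite lee_fin expR_ge0.
have mg m : measurable_fun [set: mR] (fun u : mR => (g m u)%:E).
  apply/measurable_EFinP; apply: measurableT_comp => //.
  apply: measurable_funM => //; apply: measurable_funX.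
  by apply: measurable_funB.
pose f (w : mR * mR) := (g x w.1 * g y w.2)%:E.
have fE w : f w = (expR (- b * ((w.1 - x) ^+ 2 + (w.2 - y) ^+ 2)))%:E.
  by rewrite /f /g -expRD mulrDr.
under eq_integral do rewrite -fE.
have mf : measurable_fun setT f.
  by rewrite (funext fE); exact: measurable_gaussian_plane.
have f0 w : (0 <= f w)%E by rewrite lee_fin mulr_ge0 ?expR_ge0.
rewrite [LHS](fubini_tonelli1 _ mf f0).
transitivity (\int[@lebesgue_measure R]_u (C%:E * (g x u)%:E))%E.
  apply: eq_integral => u _; rewrite /fubini_F /f /=.
  under eq_integral do rewrite EFinM.
  transitivity ((g x u)%:E * \int[@lebesgue_measure R]_v (g y v)%:E)%E.
    by apply: (ge0_integralZl _ _ (mg y)).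
  by rewrite HCg muleC.
transitivity (C%:E * \int[@lebesgue_measure R]_u (g x u)%:E)%E.
  by apply: (ge0_integralZl _ _ (mg x)) => //; rewrite lee_fin ltW.
by rewrite HCg EFinM.
Qed.

Lemma slice_weight_kernel alpha I J s t : imag_units I -> imag_units J ->
  slice_weight alpha (normalized_kernel alpha (slice_pt J s)) I t ^+ 2 =
  (1 + qdot I J) / 2 * expR (- alpha * ((t.1 - s.1) ^+ 2 + (t.2 - s.2) ^+ 2)) +
  (1 - qdot I J) / 2 * expR (- alpha * ((t.1 - s.1) ^+ 2 + (t.2 + s.2) ^+ 2)).
Proof.
move=> uI uJ; rewrite /slice_weight /normalized_kernel qnormZ.
rewrite ger0_norm ?expR_ge0// !exprMn qnorm_fock_kernel// qnorm_slice_pt//.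
have E (k l a b c d : R) : expR a * (expR b * (k * expR c + l * expR d)) =
    k * expR (a + b + c) + l * expR (a + b + d) by rewrite !expRD; ring.
rewrite -!expRM_natl E.
by congr (_ * expR _ + _ * expR _); field.
Qed.

Lemma qdot_unit_le I J : imag_units I -> imag_units J -> `|qdot I J| <= 1.
Proof. by move=> uI uJ; have := qdot_le I J; rewrite !imag_units_norm// mulr1. Qed.

(** The weights (1 + k)/2 and (1 - k)/2 lie in [0, 1], so the square root of the combination of x^2
    and y^2 is at most x + y, uniformly in the two units. *)
Lemma slice_weight_kernel_le alpha p I J s t : 0 < p -> imag_units I -> imag_units J ->
  slice_weight alpha (normalized_kernel alpha (slice_pt J s)) I t `^ p <=
  2 `^ p * (expR (- (p * alpha / 2) * ((t.1 - s.1) ^+ 2 + (t.2 - s.2) ^+ 2)) +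
            expR (- (p * alpha / 2) * ((t.1 - s.1) ^+ 2 + (t.2 - - s.2) ^+ 2))).
Proof.
move=> p0 uI uJ.
pose e (d : R) := expR (- (alpha / 2) * d).
have e0 d : 0 <= e d by exact: expR_ge0.
have eE d : e d ^+ 2 = expR (- alpha * d).
  by rewrite -expRM_natl; congr expR; field.
have ep d : e d `^ p = expR (- (p * alpha / 2) * d).
  by rewrite -expRM; congr expR; field.
rewrite -!ep opprK; apply: le_trans (powR_addr_le _ _ _) => //.
rewrite ge0_ler_powR ?nnegrE ?addr_ge0 ?slice_weight_ge0//; first exact: ltW.
rewrite -(@ler_pXn2r _ 2)// ?nnegrE ?addr_ge0 ?slice_weight_ge0//.
rewrite slice_weight_kernel// -!eE.
have := qdot_unit_le uI uJ; rewrite ler_norml => /andP[k1 k2].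
set x := e _; set y := e _; have x0 : 0 <= x := e0 _; have y0 : 0 <= y := e0 _.
have h1 : 0 <= (1 - qdot I J) * x ^+ 2 by rewrite mulr_ge0 ?sqr_ge0 ?subr_ge0.
have h2 : 0 <= (1 + qdot I J) * y ^+ 2.
  by rewrite mulr_ge0 ?sqr_ge0// -lerBlDl sub0r.
have h3 : 0 <= x * y by exact: mulr_ge0.
by rewrite sqrrD; move: h1 h2 h3; lra.
Qed.
End kernel_integrals.

(** * The kernels as test functions *)

Section kernel_test_functions.
Context {R : realType}.
Local Notation area := (@area R).
Local Notation mR := (measurableTypeR R).
Local Notation sigma := (@sphere_measure R).
Implicit Types (I J z : quat R) (s t : R * R) (alpha p r : R).

Lemma gauss_pow_ge0 alpha p f z : 0 <= gauss_pow alpha p f z.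
Proof. exact: powR_ge0. Qed.

Lemma measurable_gauss_kernel alpha p z :
  measurable_fun setT (gauss_pow alpha p (normalized_kernel alpha z)).
Proof.
by have [f0 [f1 [ff Cf0 Cf1 _]]] := normalized_kernel_regular alpha z;
  exact: (measurable_gauss_pow ff Cf0 Cf1).
Qed.

Lemma integral_gauss_kernel alpha p : 0 < alpha -> 0 < p ->
  exists2 C : R, 0 < C & forall z,
    (\int[qvolume]_w (gauss_pow alpha p (normalized_kernel alpha z) w)%:E <= C%:E)%E.
Proof.
move=> alpha0 p0.
have b0 : 0 < p * alpha / 2 by rewrite divr_gt0// mulr_gt0.
have [G G0 HG] := integral_gaussian_plane b0.
pose M := 2 `^ p * (G + G).
have M0 : 0 < M by rewrite mulr_gt0 ?powR_gt0// addr_gt0.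
have sT : sigma setT \is a fin_num := sphere_measure_fin_num measurableT.
exists (M * (fine (sigma setT) + 1)) => [|z].
  by rewrite mulr_gt0// ltr_wpDl// fine_ge0.
have mF : measurable_fun setT
    (fun w : quat R => (gauss_pow alpha p (normalized_kernel alpha z) w)%:E).
  by apply/measurable_EFinP; exact: measurable_gauss_kernel.
have F0 (w : quat R) : (0 <= (gauss_pow alpha p (normalized_kernel alpha z) w)%:E)%E.
  by rewrite lee_fin gauss_pow_ge0.
have [mG ->] := integral_qvolume mF F0.
apply: (@le_trans _ _ (\int[sigma]_I M%:E)%E); last first.
  rewrite integral_cst//; apply: (@le_trans _ _ (M%:E * (fine (sigma setT))%:E)%E).
    by rewrite fineK.
  by rewrite -EFinM lee_fin ler_wpM2l ?ltW// ltrDl.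
(* The bound on a slice needs a unit I; the remaining I form a null set for the sphere measure. *)
apply: ae_ge0_le_integral => //.
- by move=> I _; apply: integral_ge0.
- by move=> I _; rewrite lee_fin ltW.
exists (~` @imag_units R); split.
- exact: measurableC measurable_imag_units.
- exact: sphere_measure_units.
apply: subsetC => I uI _.
have [J uJ ->] := slice_ptP z; move: (qRe z, qIm_norm z) => s.
pose e (y : R) (w : mR * mR) : R :=
  expR (- (p * alpha / 2) * ((w.1 - s.1) ^+ 2 + (w.2 - y) ^+ 2)).
have me y : measurable_fun [set: mR * mR] (fun w => (e y w)%:E).
  exact: measurable_gaussian_plane.
have e0 y (w : R * R) : (0 <= (e y w)%:E)%E by rewrite lee_fin expR_ge0.
have p2 : (0 <= (2 `^ p)%:E)%E by rewrite lee_fin powR_ge0.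
have e2 (w : R * R) : (0 <= (e s.2 w)%:E + (e (- s.2) w)%:E)%E by rewrite adde_ge0.
have m2 : measurable_fun [set: mR * mR]
    (fun w => ((2 `^ p)%:E * ((e s.2 w)%:E + (e (- s.2) w)%:E))%E).
  by apply: measurable_funeM; exact: emeasurable_funD.
have mS : measurable_fun [set: mR * mR] (fun w => (gauss_pow alpha p
    (normalized_kernel alpha (slice_pt J s)) (slice_pt I w))%:E).
  apply/measurable_EFinP.
  apply: (measurableT_comp (measurable_gauss_kernel alpha p (slice_pt J s))).
  exact: (measurableT_comp measurable_slice_pt
    (measurable_fun_pair (measurable_cst I) (@measurable_id _ _ setT))).
apply: (@le_trans _ _ (\int[area]_(w in upper_half)
    ((2 `^ p)%:E * ((e s.2 w)%:E + (e (- s.2) w)%:E)))%E).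
  apply: ge0_le_integral => //.
  - exact: measurable_upper_half.
  - by move=> w _; rewrite lee_fin gauss_pow_ge0.
  - exact: measurable_funTS.
  - exact: measurable_funTS.
  - by move=> w _; rewrite gauss_pow_slice// -EFinD -EFinM lee_fin slice_weight_kernel_le.
apply: (@le_trans _ _ (\int[area]_w
    ((2 `^ p)%:E * ((e s.2 w)%:E + (e (- s.2) w)%:E)))%E).
  apply: ge0_subset_integral => //; first exact: measurable_upper_half.
  by move=> w _; rewrite mule_ge0.
rewrite (@ge0_integralZl _ _ _ area _ measurableT _ (emeasurable_funD (me _) (me _)))//.
rewrite (@ge0_integralD _ _ _ area _ measurableT)//.
by rewrite [X in (_ * (X + _))%E]HG [X in (_ * (_ + X))%E]HG.
Qed.

Lemma kernels_of_carleson alpha p (mu : {measure set (quat R) -> \bar R}) :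
  0 < alpha -> 0 < p -> fock_carleson alpha p mu ->
  exists2 C : R, 0 < C & forall z : quat R,
    (\int[mu]_w (gauss_pow alpha p (normalized_kernel alpha z) w)%:E <= C%:E)%E.
Proof.
move=> alpha0 p0 [C C0 HC]; have [M M0 HM] := integral_gauss_kernel alpha0 p0.
have k0 : 0 < p * alpha / pi by rewrite divr_gt0 ?mulr_gt0 ?pi_gt0.
have le_norm z : (fock_norm_pow alpha p (normalized_kernel alpha z) <=
    (p * alpha / pi * M)%:E)%E.
  by rewrite /fock_norm_pow [leRHS]EFinM lee_wpmul2l// lee_fin ltW.
exists (C * (p * alpha / pi * M)) => [|z]; first exact: mulr_gt0 C0 (mulr_gt0 k0 M0).
apply: (le_trans (HC _ _)).
  split; first exact: normalized_kernel_regular.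
  exact: le_lt_trans (le_norm z) (ltry _).
by rewrite [leRHS]EFinM lee_wpmul2l// lee_fin ltW.
Qed.

(** When <I, J> >= 0, the first term of the squared weight alone is at least e^(-alpha r^2) / 2; the
    exponent p / 2 comes from passing through the square. *)
Lemma slice_weight_kernel_ge alpha p r I J s t : 0 < alpha -> 0 < p ->
  imag_units I -> imag_units J -> 0 <= qdot I J ->
  (t.1 - s.1) ^+ 2 + (t.2 - s.2) ^+ 2 < r ^+ 2 ->
  (expR (- alpha * r ^+ 2) / 2) `^ (p / 2) <=
  slice_weight alpha (normalized_kernel alpha (slice_pt J s)) I t `^ p.
Proof.
move=> alpha0 p0 uI uJ k0 st.
have w0 := slice_weight_ge0 alpha (normalized_kernel alpha (slice_pt J s)) I t.
have sq x : 0 <= x -> x `^ p = (x ^+ 2) `^ (p / 2).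
  by move=> x0; rewrite -powR_mulrn// -powRrM; congr (_ `^ _); field.
rewrite sq//.
rewrite ge0_ler_powR ?nnegrE ?divr_ge0 ?expR_ge0 ?exprn_ge0// ?(ltW p0)//.
rewrite slice_weight_kernel//.
have := qdot_unit_le uI uJ; rewrite ler_norml => /andP[_ k1].
apply: (@le_trans _ _ ((1 + qdot I J) / 2 *
    expR (- alpha * ((t.1 - s.1) ^+ 2 + (t.2 - s.2) ^+ 2)))); last first.
  by rewrite lerDl mulr_ge0 ?expR_ge0// divr_ge0// subr_ge0.
rewrite mulrC ler_pM ?expR_ge0 ?invr_ge0//.
  by rewrite ler_pdivlMr// mulVf// lerDl.
by rewrite ler_expR !mulNr lerN2 ler_wpM2l ?ltW.
Qed.

(* The kernels at z and at its conjugate are bounded below on the two halves of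
   the box, where <Im w, Im z> is nonnegative and nonpositive respectively. *)
Lemma boxes_of_kernels alpha p r (mu : {measure set (quat R) -> \bar R}) :
  0 < alpha -> 0 < p -> 0 < r ->
  (exists2 C : R, 0 < C & forall z : quat R,
    (\int[mu]_w (gauss_pow alpha p (normalized_kernel alpha z) w)%:E <= C%:E)%E) ->
  exists2 C : R, 0 < C & forall z : quat R, (mu (symmetric_box z r) <= C%:E)%E.
Proof.
move=> alpha0 p0 r0 [C C0 HC]; pose k := (expR (- alpha * r ^+ 2) / 2) `^ (p / 2).
have k0 : 0 < k by rewrite powR_gt0// divr_gt0 ?expR_gt0.
exists (k^-1 * (C + C)) => [|z]; first by rewrite mulr_gt0 ?invr_gt0// addr_gt0.
have [J uJ zE] := slice_ptP z; set s := (_, _) in zE.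
pose f z (w : quat R) := gauss_pow alpha p (normalized_kernel alpha z) w.
have mf z' : measurable_fun setT (fun w : quat R => (f z' w)%:E).
  by apply/measurable_EFinP; exact: measurable_gauss_kernel.
have f0 z' w : (0 <= (f z' w)%:E)%E by rewrite lee_fin gauss_pow_ge0.
pose z' := slice_pt (- J) s.
(* Adding the two kernels makes it unnecessary to cut the box into its halves: at each w one of the
   summands is at least k. *)
have low w : symmetric_box z r w -> (k%:E <= (f z w)%:E + (f z' w)%:E)%E.
  move=> /(symmetric_boxP _ _ r0) zw.
  have [I uI wE] := slice_ptP w; set t := (_, _) in wE.
  have [IJ|IJ] := leP 0 (qdot I J).
    apply: le_trans (leeDl _ (f0 z' w)); rewrite lee_fin /f {1}zE wE gauss_pow_slice//.
    exact: slice_weight_kernel_ge.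
  apply: le_trans (leeDr _ (f0 z w)); rewrite lee_fin /f wE gauss_pow_slice//.
  apply: slice_weight_kernel_ge => //; first exact: imag_unitsN.
  by rewrite qdotNr oppr_ge0 ltW.
have mS := measurable_symmetric_box z r0.
have kS : (k%:E * mu (symmetric_box z r) <= (C + C)%:E)%E.
  rewrite -integral_cst//.
  apply: (@le_trans _ _ (\int[mu]_(w in symmetric_box z r)
      ((f z w)%:E + (f z' w)%:E))%E).
    apply: ge0_le_integral => //.
    - by move=> w _; rewrite lee_fin ltW.
    - by apply: measurable_funTS; exact: emeasurable_funD.
  apply: (@le_trans _ _ (\int[mu]_w ((f z w)%:E + (f z' w)%:E))%E).
    apply: ge0_subset_integral => //; first exact: emeasurable_funD.
    by move=> w _; rewrite adde_ge0.
  rewrite ge0_integralD// EFinD; apply: leeD; exact: HC.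
have -> : mu (symmetric_box z r) = (k^-1%:E * (k%:E * mu (symmetric_box z r)))%E.
  by rewrite muleA -EFinM mulVf ?gt_eqF// mul1e.
by rewrite [leRHS]EFinM lee_wpmul2l// lee_fin invr_ge0 ltW.
Qed.

End kernel_test_functions.

Theorem theorem3p3 (R : realType) (alpha p r : R)
    (mu : {measure set (quat R) -> \bar R}) :
  0 < alpha -> 0 < p -> 0 < r ->
  radon_on (~` real_axis) mu ->
  let a := fock_carleson alpha p mu in
  let b := exists2 C : R, 0 < C & forall z : quat R,
    (\int[mu]_w (gauss_pow alpha p (normalized_kernel alpha z) w)%:E
       <= C%:E)%E in
  let c := exists2 C : R, 0 < C & forall z : quat R,
    (mu (symmetric_box z r) <= C%:E)%E in
  (a <-> b) /\ (b <-> c).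
Proof.
move=> alpha0 p0 r0 _ a b c.
have ab : a -> b := kernels_of_carleson alpha0 p0.
have bc : b -> c := boxes_of_kernels alpha0 p0 r0.
have ca : c -> a := fock_carleson_of_boxes alpha0 p0 r0.
by split; split; auto.
Qed.
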